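(* When $2/3<t\le 1$, the limiting gap distribution function $G_t(\lambda)=\lim_{J\to\infty}G_{t,J}(\lambda)$ (defined in the context) is $$G_t(\lambda)=\begin{cases} 1+\lambda t-\lambda t^2+\frac32\lambda t\log(t)-\lambda t\log(2), & \text{if } 0\le\lambda\le 1;\\ 1+5t-4\lambda t-\lambda t^2+t(2+3\lambda)\log(\lambda)+\frac32\lambda t\log(t)-\lambda t\log(2), & \text{if } 1\le\lambda\le\frac1t;\\ -1+3t-2\lambda t+\lambda t^2+\lambda t\log\left(\frac{\lambda}{2}\right)-t\left(2+\frac12\lambda\right)\log(t), & \text{if } \frac1t\le\lambda\le 2;\\ -1-2t+\frac12\lambda t+\lambda t^2-t\left(2+\frac12\lambda\right)\log\left(\frac{\lambda t}{2}\right), & \text{if } 2\le\lambda\le\frac2t;\\ 0, & \text{if } \frac2t\le\lambda. \end{cases}$$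
   Context: Fix $t>0$. For a positive integer $J$ (large enough that $tJ^2>J$) let $P_{t,J}=(-tJ^2,0)$ and $O=(0,0)$, and let $\mathcal R_J=\mathbb Z^2\cap([-J,J]\times[0,J])$, a set of $N=N_J=(2J+1)(J+1)$ lattice points. For $P\in\mathcal R_J$ consider the angle $\angle(P P_{t,J} O)$ at the vertex $P_{t,J}$ between the rays from $P_{t,J}$ to $P$ and to $O$. List these $N$ angles, with multiplicity, in nondecreasing order: $0=\alpha_1\le\alpha_2\le\dots\le\alpha_N=\alpha_{\max}$. Put $\Delta_{av}=\alpha_{\max}/N_J$ and, for $\lambda\ge 0$, $$G_{t,J}(\lambda)=\frac{1}{N_J}\#\{j:\ 1\le j\le N-1,\ \alpha_{j+1}-\alpha_j\ge\lambda\Delta_{av}\}.$$ The limiting gap distribution function is $G_t(\lambda)=\lim_{J\to\infty}G_{t,J}(\lambda)$. *)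

(* Defs.v *)
From HB Require Import structures.
From mathcomp Require Import all_boot all_order all_algebra.
From mathcomp Require Import all_classical all_reals all_analysis.

Set Implicit Arguments.
Unset Strict Implicit.
Unset Printing Implicit Defensive.

Import Order.TTheory GRing.Theory Num.Theory.

Local Open Scope ring_scope.

Definition dot {R : realType} (u v : R * R) : R := u.1 * v.1 + u.2 * v.2.

Definition enorm {R : realType} (u : R * R) : R := Num.sqrt (dot u u).

(* Unoriented angle, in [0, pi], at the vertex B between the rays BA and BC. *)
Definition angle {R : realType} (A B C : R * R) : R :=
  acos (dot (A - B) (C - B) / (enorm (A - B) * enorm (C - B))).

Definition origin {R : realType} : R * R := (0, 0).

Definition viewpoint {R : realType} (t : R) (J : nat) : R * R :=
  (- (t * J%:R ^+ 2), 0).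

(* Duplicate-free enumeration of Z^2 `&` ([-J, J] x [0, J]); see
   mem_lattice_points, uniq_lattice_points and size_lattice_points. *)
Definition lattice_points (J : nat) : seq (int * int) :=
  [seq (i%:Z - J%:Z, j%:Z) | i <- iota 0 (2 * J + 1), j <- iota 0 (J + 1)].

Lemma mem_lattice_points (J : nat) (p : int * int) :
  (p \in lattice_points J) =
  (- J%:Z <= p.1 <= J%:Z) && (0 <= p.2 <= J%:Z).
Proof.
apply/allpairsP/andP => [[[i j] /= [+ + ->]] | ].
  rewrite !mem_iota !add0n !addn1 !ltnS /= => iJ jJ; split => /=.
    by rewrite lerBrDr addNr lez_nat lerBlDr -PoszD lez_nat addnn -mul2n.
  by rewrite !lez_nat.
case: p => x y /= [/andP[Jx xJ] /andP[y0 yJ]].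
have xJ0 : 0 <= x + J%:Z by rewrite -lerBlDr sub0r.
exists (absz (x + J%:Z), absz y); split => /=.
- rewrite mem_iota add0n addn1 ltnS /= -lez_nat gez0_abs //.
  by rewrite mul2n -addnn PoszD lerD2r.
- by rewrite mem_iota add0n addn1 ltnS /= -lez_nat gez0_abs.
- by rewrite !gez0_abs // addrK.
Qed.

Lemma uniq_lattice_points (J : nat) : uniq (lattice_points J).
Proof.
apply: allpairs_uniq; rewrite ?iota_uniq // => -[i j] [i' j'] _ _ /= [].
by move=> /addIr[->] ->.
Qed.

Lemma size_lattice_points (J : nat) :
  size (lattice_points J) = ((2 * J + 1) * (J + 1))%N.
Proof. by rewrite size_allpairs !size_iota. Qed.

Definition numpts (J : nat) : nat := size (lattice_points J).

Definition sorted_angles {R : realType} (t : R) (J : nat) : seq R :=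
  sort <=%R
    [seq angle (p.1%:~R, p.2%:~R) (viewpoint t J) origin
    | p <- lattice_points J].

(* The indices are 1-based: alpha t J 1 <= ... <= alpha t J (numpts J). *)
Definition alpha {R : realType} (t : R) (J j : nat) : R :=
  nth 0 (sorted_angles t J) j.-1.

Definition avg_gap {R : realType} (t : R) (J : nat) : R :=
  alpha t J (numpts J) / (numpts J)%:R.

Definition gap_distribution {R : realType} (t : R) (J : nat) (lambda : R) : R :=
  (count (fun j => lambda * avg_gap t J <= alpha t J j.+1 - alpha t J j)
     (index_iota 1 (numpts J)))%:R / (numpts J)%:R.

(* Main.v *)
Require Import Defs.
From HB Require Import structures.
From mathcomp Require Import all_boot all_order all_algebra.
From mathcomp Require Import all_classical all_reals all_analysis.
From mathcomp Require Import ring lra zify.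

Import Order.TTheory GRing.Theory Num.Theory.
Import numFieldNormedType.Exports.

Local Open Scope classical_set_scope.
Local Open Scope ring_scope.

(** Write [c = t J^2] and let [u = (x + c) / y] be the inverse slope, from the
    viewpoint, of the lattice point [(x, y)]. At this distance the angle between
    two lattice points is asymptotically proportional to their cross product
    seen from the viewpoint: a cross product [k * J] is worth [2 * k / t] average gaps
    ([small_cross_small_angle], [small_angle_small_cross]). With
    [a = lambda * t / 2], counting gaps of at least [lambda] average gaps thus
    amounts to counting the points [(x, y)] such that no lattice point of the
    rectangle has a cross product with it between [0] and [a * J]
    ([gap_count_le], [gap_count_ge]).

    The first candidate [k] rows above [(x, y)] has abscissa [x + floor (k u)]
    and cross product [y * frac (k u)]. In terms of [xi = x / J],
    [eta = y / J], [w = t / eta] and [g = a / eta], it lies in the rectangle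
    when [|xi + k w| <= 1] and blocks the point when [frac (k u) < g]. If
    [g > 1], the left neighbour in the same row always blocks. If [g <= 1], then
    [w >= t > 2/3] leaves only [k = 1, -1, 2, -2], so that isolation is decided
    by [xi], [eta] and [frac u], up to few exceptional points ([isolatedE],
    [exceptional_sum]). Inclusion-exclusion writes the set of isolated points as
    a combination of five boxes ([unblocked_boxes]).

    The remaining fact is that [frac u] is asymptotically uniform and
    independent of [xi] and [eta] ([cell_sum]). In one row, points with
    [frac u < b] are counted by sums of floors, whose primitive is quadratic up
    to the second Bernoulli function [bern]; this gives the expected main term
    and an oscillation [y * bern (c / y + ...)] ([sum_flr_window]). Summed over
    the rows these oscillations cancel because [c / y] is equidistributed modulo
    one ([sum_osc]): on short blocks it is almost linear in [y] with an almost
    rational slope, and the slope varies fast enough to be rarely close to a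
    rational of small denominator.

    Consequently the gap distribution tends to half the integral over [eta] in
    [[a, 1]] of [2 - 2 g (2 - w)_+ - 2 g (1 - w)_+ + 4 (2 g - 1)_+ (1 - w)_+]
    ([isolated_densityE], [cvg_gap_distribution]), whose integrand has corners
    at [t / 2], [t] and [2 * a]; the order of these points, of [a] and of [1]
    distinguishes the cases of the theorem. *)

Set Implicit Arguments.
Unset Strict Implicit.

(** * Gaps of a finite list of reals *)

Lemma sub_in_count (T : eqType) (a b : pred T) (s : seq T) :
  {in s, forall x, a x -> b x} -> (count a s <= count b s)%N.
Proof.
elim: s => //= x s IH ab; apply: leq_add; last first.
  by apply: IH => y ys; apply: ab; rewrite inE ys orbT.
have /implyP := ab x (mem_head _ _).
by case: (a x); case: (b x).
Qed.

(** Reading a list with default value [0] and comparing the entries [j] and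
    [j - 1] for [1 <= j < size s] is the shape in which the gap distribution
    counts its gaps. *)
Definition gap_count {R : realType} (delta : R) (s : seq R) : nat :=
  count (fun j => delta <= nth 0 s j - nth 0 s j.-1) (index_iota 1 (size s)).

Section GapCount.
Variables (T : eqType) (R : realType) (f : T -> R) (pts : seq T).

Let le_f : rel T := relpre f <=%R.
Let spts := sort le_f pts.

Let le_nth_spts x0 i j : (i <= j < size pts)%N ->
  f (nth x0 spts i) <= f (nth x0 spts j).
Proof.
move=> /andP[ij jN].
have tr : transitive le_f by move=> a b c; exact: le_trans.
have srt : sorted le_f spts by apply: sort_sorted => a b; exact: le_total.
have := sorted_leq_nth tr (fun a => lexx (f a)) x0 srt.
move=> /(_ i j); apply => //; rewrite inE size_sort //.
exact: leq_ltn_trans ij jN.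
Qed.

Let gap_countE x0 delta :
  gap_count delta (sort <=%R (map f pts)) =
  count (fun i => delta <= f (nth x0 spts i.+1) - f (nth x0 spts i))
        (iota 0 (size pts).-1).
Proof.
rewrite /gap_count size_sort size_map /index_iota subn1 -[1%N]addn0 iotaDl count_map.
apply: eq_in_count => i; rewrite mem_iota add0n => /andP[_ iN] /=.
rewrite ltn_predRL in iN.
by rewrite sort_map !(nth_map x0) ?size_sort // ltnW.
Qed.

Let count_spts x0 (P : pred T) :
  count P pts = count (fun i => P (nth x0 spts i)) (iota 0 (size pts)).
Proof.
have /permP/(_ P) <- : perm_eq spts pts by rewrite perm_sort.
by rewrite -[in LHS](mkseq_nth x0 spts) count_map size_sort.
Qed.

(** Among points with equal values, only the one listed last can be followed by
    a positive gap. An upper bound may therefore count every point of such a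
    group, whereas the lower bound below has to exclude ties. *)
Lemma gap_count_le (delta : R) (P : pred T) : 0 < delta ->
  (forall p, p \in pts ->
    (forall p', p' \in pts -> f p < f p' -> delta <= f p' - f p) -> P p) ->
  (gap_count delta (sort <=%R (map f pts)) <= count P pts)%N.
Proof.
move=> d0 HP; case E : pts => [//|x0 r]; rewrite -E (gap_countE x0) (count_spts x0).
have -> : size pts = ((size pts).-1 + 1)%N by rewrite E /= addn1.
rewrite iotaD count_cat addn1 /=; apply: leq_trans (leq_addr _ _).
apply: sub_in_count => i; rewrite mem_iota add0n => /andP[_ iN] gap.
rewrite ltn_predRL in iN.
apply: HP => [|p']; first by rewrite -(mem_sort le_f) mem_nth // size_sort ltnW.
rewrite -(mem_sort le_f) -/spts => /(nthP x0)[l]; rewrite size_sort => lN <-.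
case: (leqP l i) => [li|il fp].
  by rewrite ltNge le_nth_spts // li ltnW.
by apply: le_trans gap _; rewrite lerD2r le_nth_spts // il.
Qed.

(** The successor reflects that the point listed last starts no gap. *)
Lemma gap_count_ge (delta : R) (P : pred T) : uniq pts -> 0 < delta ->
  (forall p, P p -> p \in pts ->
    forall p', p' \in pts -> p' != p -> f p <= f p' -> delta <= f p' - f p) ->
  (count P pts <= (gap_count delta (sort <=%R (map f pts))).+1)%N.
Proof.
move=> upts d0 HP; case E : pts => [//|x0 r]; rewrite -E (gap_countE x0) (count_spts x0).
have -> : size pts = ((size pts).-1 + 1)%N by rewrite E /= addn1.
rewrite iotaD count_cat addn1 /= -[in leqRHS]addn1 leq_add //; last first.
  by rewrite addn0; case: (P _).
apply: sub_in_count => i; rewrite mem_iota add0n => /andP[_ iN] Pi.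
rewrite ltn_predRL in iN.
have mem_spts j : (j < size pts)%N -> nth x0 spts j \in pts.
  by move=> jN; rewrite -(mem_sort le_f) mem_nth // size_sort.
apply: HP Pi _ _ _ _ _; rewrite ?mem_spts // 1?ltnW //.
  by rewrite nth_uniq ?size_sort ?sort_uniq // 1?ltnW // gtn_eqF.
by rewrite le_nth_spts // leqnSn.
Qed.

Lemma last_sort_max (p0 : T) : p0 \in pts ->
  (forall p, p \in pts -> f p <= f p0) ->
  nth 0 (sort <=%R (map f pts)) (size pts).-1 = f p0.
Proof.
move=> p0in pmax.
have N0 : (0 < size pts)%N by case: pts p0in.
have N1 : ((size pts).-1 < size pts)%N by rewrite prednK.
rewrite sort_map (nth_map p0) ?size_sort //; apply/eqP; rewrite eq_le; apply/andP; split.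
  by apply: pmax; rewrite -(mem_sort le_f) mem_nth // size_sort.
move: (p0in); rewrite -(mem_sort le_f) => /(nthP p0)[l]; rewrite size_sort => lN.
move=> {1}<-; have := @le_nth_spts p0 l (size pts).-1; apply.
by rewrite N1 andbT -ltnS prednK.
Qed.

End GapCount.

(** * Summing the floor function *)

Section FloorSum.
Variable R : realType.
Implicit Types (U V a b beta y : R) (m n : nat).

Definition flr U : R := (Num.floor U)%:~R.
Definition frac U : R := U - flr U.

(** The second Bernoulli function, up to affine normalisation: the periodic
    part of the primitive of the floor function. *)
Definition bern U : R := frac U * (1 - frac U) / 2.

Definition flr_prim U : R := U * (U - 1) / 2 + bern U.

Lemma frac_itv U : 0 <= frac U < 1.
Proof. by have := floor_itv U; rewrite /frac /flr intrD => /andP[? ?]; lra. Qed.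

Lemma flrDz U (k : int) : flr (U + k%:~R) = flr U + k%:~R.
Proof. by rewrite /flr floorDrz ?intr_int // intrKfloor intrD. Qed.

Lemma fracDz U (k : int) : frac (U + k%:~R) = frac U.
Proof. by rewrite /frac flrDz; lra. Qed.

Lemma frac_small U : 0 <= U < 1 -> frac U = U.
Proof.
by move=> U01; rewrite /frac /flr (@floor_def _ U 0) ?subr0 //.
Qed.

Lemma le_flr U V : U <= V -> flr U <= flr V.
Proof. by move=> UV; rewrite ler_int le_floor. Qed.

Lemma bernDz U (k : int) : bern (U + k%:~R) = bern U.
Proof. by rewrite /bern fracDz. Qed.

Lemma bern_itv U : 0 <= bern U <= 1 / 8.
Proof.
have := frac_itv U; rewrite /bern; move: (frac U) => x /andP[? ?].
have := sqr_ge0 (x - 1 / 2); have : 0 <= x * (1 - x) by apply: mulr_ge0; lra.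
by rewrite expr2 => ? ?; apply/andP; split; lra.
Qed.

(** The floor function is a subgradient of its (convex) primitive. *)
Lemma flr_prim_sub U V : U <= V ->
  flr U * (V - U) <= flr_prim V - flr_prim U <= flr V * (V - U).
Proof.
move=> UV; have := floor_itv U; have := floor_itv V; have := le_floor UV.
rewrite !intrD /flr_prim /bern /frac /flr => ab /andP[V1 V2] /andP[U1 U2].
move: ab; rewrite le_eqVlt => /orP[/eqP E|].
  by rewrite E; apply/andP; split; lra.
rewrite -lezD1 -(ler_int R) intrD => ab; apply/andP.
move: ab V1 V2 U1 U2; set A := (Num.floor U)%:~R; set B := (Num.floor V)%:~R.
by move=> *; split; nra.
Qed.

(** Subtracting the quadratic part from the subgradient inequality gives the
    bound for nearby points, across integers too; distant points are covered by
    the range of [bern]. *)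
Lemma bern_lip U V : `|bern U - bern V| <= `|U - V|.
Proof.
wlog UV : U V / U <= V.
  move=> H; case: (leP U V) => [|/ltW] h; first exact: H.
  by rewrite distrC (distrC U); exact: H.
have /andP[? ?] := bern_itv U; have /andP[? ?] := bern_itv V.
rewrite (distrC U) (ger0_norm (_ : 0 <= V - U)) ?subr_ge0 //.
case: (leP 1 (V - U)) => h; first by rewrite ler_norml; apply/andP; split; lra.
have := flr_prim_sub UV; rewrite /flr_prim => /andP[].
have := frac_itv U; have := frac_itv V; rewrite /frac => /andP[? ?] /andP[? ?].
move=> ? ?; rewrite ler_norml; apply/andP; split; nra.
Qed.

(** Each step of the sum is squeezed by the subgradient inequality, so the
    errors are nonnegative and telescope. *)
Lemma sum_flr m beta y : 0 < y ->
  0 <= y * (flr_prim ((m%:R + beta) / y) - flr_prim (beta / y))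
       - \sum_(0 <= i < m) flr ((i%:R + beta) / y)
  <= flr ((m%:R + beta) / y) - flr (beta / y).
Proof.
move=> y0; elim: m => [|m IH]; first by rewrite big_geq // add0r !subrr mulr0 subrr lexx.
rewrite big_nat_recr //=.
set U := (m%:R + beta) / y in IH *; set V := (m.+1%:R + beta) / y.
have VU : V - U = y^-1 by rewrite /V /U -addn1 natrD; field; rewrite gt_eqF.
have UV : U <= V by rewrite -subr_ge0 VU invr_ge0 ltW.
have /andP[h1 h2] := flr_prim_sub UV.
have e (z : R) : y * (z * (V - U)) = z by rewrite VU; field; rewrite gt_eqF.
rewrite -(ler_pM2l y0) e in h1; rewrite -(ler_pM2l y0) e in h2.
by move: IH => /andP[? ?]; apply/andP; split; lra.
Qed.

Lemma flr_sub_le U V : flr V - flr U <= V - U + 1.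
Proof.
by have := frac_itv U; have := frac_itv V; rewrite /frac => /andP[? ?] /andP[? ?]; lra.
Qed.

(** [flr U - flr (U - b)] tells whether the fractional part of [U] is below
    [b]; summed along a row it yields a linear main term and an oscillation
    carried by the Bernoulli function alone. *)
Lemma sum_flr_window m beta y b : 0 < y -> 0 <= b ->
  `|\sum_(0 <= i < m) (flr ((i%:R + beta) / y) - flr ((i%:R + beta) / y - b))
    - (b * m%:R + y * (bern ((m%:R + beta) / y) - bern (beta / y)
                       - bern ((m%:R + beta) / y - b) + bern (beta / y - b)))|
  <= m%:R / y + 1.
Proof.
move=> y0 b0; rewrite sumrB.
have yN : y != 0 by rewrite gt_eqF.
have shift (z : R) : (z + beta) / y - b = (z + (beta - b * y)) / y by field.
have shift0 : beta / y - b = (beta - b * y) / y by field.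
rewrite [X in _ - X - _](_ : _ = \sum_(0 <= i < m) flr ((i%:R + (beta - b * y)) / y));
  last by apply: eq_bigr => i _; rewrite shift.
have := sum_flr m beta y0; have := sum_flr m (beta - b * y) y0.
have := flr_sub_le (beta / y) ((m%:R + beta) / y).
have := flr_sub_le ((beta - b * y) / y) ((m%:R + (beta - b * y)) / y).
rewrite -shift -shift0 /flr_prim.
set S1 := \sum_(0 <= i < m) _; set S2 := \sum_(0 <= i < m) _.
have E (z : R) : (z + beta) / y - beta / y = z / y by field.
have -> : (m%:R + beta) / y - b - (beta / y - b) = m%:R / y by field.
rewrite E;
move=> h1 h2 /andP[h3 h4] /andP[h5 h6].
set X1 := y * _ in h3 h4; set X2 := y * _ in h5 h6.
have -> : b * m%:R + y * (bern ((m%:R + beta) / y) - bern (beta / y)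
    - bern ((m%:R + beta) / y - b) + bern (beta / y - b)) = X2 - X1.
  by rewrite /X1 /X2; field.
by rewrite ler_norml; apply/andP; split; lra.
Qed.

End FloorSum.

(** * Equidistribution of t J^2 / y modulo one *)

Section Equidistribution.
Variable R : realType.
Implicit Types (theta alpha : R) (n p Q K J : nat).

Lemma sum_sample_bern n : (0 < n)%N ->
  \sum_(j < n) bern (j%:R / n%:R : R) = n%:R / 12 - (12 * n%:R)^-1.
Proof.
move=> n0; have nR : 0 < n%:R :> R by rewrite ltr0n.
have E (j : 'I_n) : bern (j%:R / n%:R : R) =
    (j%:R * n%:R - j%:R ^+ 2) / (2 * n%:R ^+ 2).
  rewrite /bern frac_small; first by field; rewrite gt_eqF.
  by rewrite divr_ge0 //= ltr_pdivrMr // mul1r ltr_nat ltn_ord.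
under eq_bigr do rewrite E.
rewrite -mulr_suml.
have S m : \sum_(j < m) (j%:R * n%:R - j%:R ^+ 2) =
    n%:R * (m%:R * (m%:R - 1) / 2) - m%:R * (m%:R - 1) * (2 * m%:R - 1) / 6 :> R.
  elim: m => [|m IH]; first by rewrite big_ord0; ring.
  by rewrite big_ord_recr /= IH -addn1 natrD; field.
by rewrite S; field; rewrite gt_eqF.
Qed.

(** Over [n] consecutive multiples of a reduced fraction with denominator [n]
    the samples are, up to one common shift smaller than [1 / n], the [n]-th
    parts of unity in another order. *)
Lemma sum_rotation_bern theta n p : (0 < n)%N -> coprime p n ->
  `|\sum_(h < n) (bern (theta + (p * h)%:R / n%:R) - 1 / 12)| <= 2.
Proof.
move=> n0 cop; have nR : 0 < n%:R :> R by rewrite ltr0n.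
have nN : n%:R != 0 :> R by rewrite gt_eqF.
set z := Num.floor (n%:R * theta); set k := `|(z %% n%:Z)%Z|%N.
have kz : (k%:Z = z %% n%:Z)%Z by rewrite gez0_abs // modz_ge0 // eqz_nat -lt0n.
pose theta' := theta - z%:~R / n%:R.
have theta'_itv : 0 <= theta' < 1 / n%:R.
  have := frac_itv (n%:R * theta); rewrite /frac /flr -/z => /andP[h1 h2].
  have -> : theta' = (n%:R * theta - z%:~R) / n%:R by rewrite /theta'; field.
  apply/andP; split; first by rewrite divr_ge0 // ltW.
  by rewrite ltr_pM2r ?invr_gt0 //; lra.
(* [z = floor (n theta)] is the whole number of steps [1 / n] in [theta], so
   the [h]-th sample is the [(k + p h) mod n]-th part of unity. *)
pose s (h : 'I_n) := Ordinal (ltn_pmod (k + p * h) n0).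
have E (h : 'I_n) : bern (theta + (p * h)%:R / n%:R) = bern (theta' + (s h)%:R / n%:R).
  have -> : theta + (p * h)%:R / n%:R =
      theta' + (s h)%:R / n%:R + ((z %/ n%:Z)%Z + ((k + p * h) %/ n)%N%:Z)%:~R.
    have /(congr1 (fun i : int => i%:~R : R)) := divz_eq z n%:Z.
    rewrite -kz rmorphD rmorphM /= !pmulrn => zE.
    have /(congr1 (fun i : nat => i%:R : R)) := divn_eq (k + p * h) n.
    rewrite !natrD !natrM => kE; rewrite rmorphD /= -!pmulrn /theta' zE.
    have -> : (s h)%:R = k%:R + p%:R * h%:R - ((k + p * h) %/ n)%:R * n%:R :> R.
      by rewrite kE /=; lra.
    by rewrite -?pmulrn; field.
  by rewrite bernDz.
have s_inj : injective s.
  move=> h h' /(congr1 val) /= /eqP; rewrite eqn_modDl => hh'.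
  apply: val_inj => /=; wlog le : h h' hh' / (h <= h')%N.
    move=> H; case: (leqP h h') => [|/ltnW] hh; first exact: H.
    by apply/esym/H => //; rewrite eq_sym.
  move: hh'; rewrite eq_sym eqn_mod_dvd ?leq_mul // -mulnBr Gauss_dvdr 1?coprime_sym //.
  have [|d0] := posnP (h' - h)%N.
    by move=> /eqP; rewrite subn_eq0 => le' _; apply/eqP; rewrite eqn_leq le le'.
  move=> /(dvdn_leq d0).
  by rewrite leqNgt (leq_ltn_trans (leq_subr _ _)).
rewrite sumrB (eq_bigr _ (fun h _ => E h)).
have -> : \sum_(h < n) bern (theta' + (s h)%:R / n%:R) =
          \sum_(j < n) bern (theta' + j%:R / n%:R).
  by rewrite [RHS](reindex_inj s_inj).
have -> : \sum_(h < n) (1 / 12) = n%:R / 12 :> R.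
  by rewrite sumr_const card_ord -mulr_natl; field.
have : `|\sum_(j < n) (bern (theta' + j%:R / n%:R) - bern (j%:R / n%:R))| <= 1.
  apply: le_trans (ler_norm_sum _ _ _) _.
  have -> : 1 = \sum_(j < n) (1 / n%:R) :> R.
    by rewrite sumr_const card_ord -mulr_natl; field.
  apply: ler_sum => j _; apply: le_trans (bern_lip _ _) _.
  by rewrite addrK ger0_norm; case/andP: theta'_itv => // _ /ltW.
rewrite sumrB sum_sample_bern // => H.
have : 0 <= (12 * n%:R)^-1 :> R by rewrite invr_ge0 mulr_ge0.
have : (12 * n%:R)^-1 <= 1 :> R.
  have n1 : 1 <= n%:R :> R by rewrite ler1n.
  by rewrite invf_le1; lra.
by move: H; rewrite !ler_norml => /andP[? ?] ? ?; apply/andP; split; lra.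
Qed.

(** The usual pigeonhole argument; dividing by the greatest common divisor only
    improves the approximation. *)
Lemma dirichlet_approximation alpha Q : 0 <= alpha -> (0 < Q)%N ->
  exists n p, [/\ (0 < n <= Q)%N, coprime p n & `|n%:R * alpha - p%:R| <= Q%:R^-1].
Proof.
move=> a0 Q0; have QR : 0 < Q%:R :> R by rewrite ltr0n.
have binP (i : 'I_Q.+1) : (Num.truncn (Q%:R * frac (i%:R * alpha)) < Q)%N.
  have /andP[f0 f1] := frac_itv (i%:R * alpha).
  by rewrite truncn_lt_nat ?mulr_ge0 // gtr_pMr.
pose bin i := Ordinal (binP i).
have /injectivePn[i [j ij bij]] : ~~ injectiveb bin.
  by apply/negP => /injectiveP /leq_card; rewrite !card_ord ltnn.
wlog lt : i j ij bij / (i < j)%N.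
  move=> H; case: (ltngtP i j) => [|lt|/val_inj E]; first exact: H.
    by apply: (H j i); rewrite // eq_sym.
  by rewrite E eqxx in ij.
pose n0 := (j - i)%N.
have le : (i <= j)%N := ltnW lt.
pose p0 := `|Num.floor (j%:R * alpha) - Num.floor (i%:R * alpha)|%N.
have p0E : p0%:R = flr (j%:R * alpha) - flr (i%:R * alpha).
  rewrite /p0 pmulrn gez0_abs ?rmorphB //= subr_ge0 le_floor //.
  by rewrite ler_wpM2r // ler_nat.
have H : `|n0%:R * alpha - p0%:R| <= Q%:R^-1.
  have -> : n0%:R * alpha - p0%:R = frac (j%:R * alpha) - frac (i%:R * alpha).
    by rewrite p0E /frac natrB //; ring.
  have nn k : 0 <= Q%:R * frac (k%:R * alpha).
    by apply: mulr_ge0 => //; case/andP: (frac_itv (k%:R * alpha)).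
  have := truncn_itv (nn i); have := truncn_itv (nn j).
  have /= := congr1 val bij => ->.
  rewrite -[(Num.truncn _).+1]addn1 natrD => /andP[h1 h2] /andP[h3 h4].
  rewrite -(ler_pM2l QR) divff ?gt_eqF // -{1}(ger0_norm (ltW QR)) -normrM mulrBr.
  by rewrite ler_norml; apply/andP; split; lra.
have n00 : (0 < n0)%N by rewrite subn_gt0.
have d0 : (0 < gcdn p0 n0)%N by rewrite gcdn_gt0 n00 orbT.
exists (n0 %/ gcdn p0 n0)%N, (p0 %/ gcdn p0 n0)%N; split.
- rewrite divn_gt0 // dvdn_leq ?dvdn_gcdr //=.
  apply: leq_trans (leq_div _ _) _; apply: leq_trans (leq_subr _ _) _.
  by rewrite -ltnS.
- rewrite /coprime -(eqn_pmul2r d0) mul1n muln_gcdl !divnK ?dvdn_gcdl ?dvdn_gcdr //.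
- set d := gcdn p0 n0 in d0 *; have dR : 1 <= d%:R :> R by rewrite ler1n.
  apply: le_trans H.
  have -> : n0%:R * alpha - p0%:R = ((n0 %/ d)%:R * alpha - (p0 %/ d)%:R) * d%:R.
    rewrite mulrBl -natrM divnK ?dvdn_gcdl // mulrAC -natrM divnK ?dvdn_gcdr //.
  by rewrite normrM ler_peMr // ger0_norm // (le_trans ler01).
Qed.

(** Cutting an interval greedily into blocks with small sums; points that
    start no block are summed trivially. *)
Lemma sum_by_blocks (a : nat -> R) (bad : pred nat) (B kappa : R) Q m n :
  0 <= B -> 0 <= kappa ->
  (forall y, (m <= y < n)%N -> `|a y| <= B) ->
  (forall y, (m <= y)%N -> (y + Q <= n)%N -> ~~ bad y ->
     exists2 k, (0 < k <= Q)%N & `|\sum_(h < k) a (y + h)%N| <= kappa * k%:R) ->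
  `|\sum_(m <= y < n) a y| <=
    kappa * (n - m)%:R + B * (Q%:R + \sum_(m <= y < n) (bad y)%:R).
Proof.
move=> B0 k0; have [l] := ubnP (n - m); elim: l m => // l IH m ln aB blk.
case: (leqP n m) => [nm|mn].
  rewrite !big_geq // normr0 (eqP nm) mulr0 add0r addr0 mulr_ge0 //.
have sum_ge0 (i : nat) : 0 <= \sum_(i <= y < n) (bad y)%:R :> R.
  by apply: sumr_ge0 => y _; exact: ler0n.
case: (leqP (m + Q) n) => [mQ|nQ]; last first.
  apply: le_trans (ler_norm_sum _ _ _) _.
  have : \sum_(m <= i < n) `|a i| <= \sum_(m <= i < n) B by apply: ler_sum_nat.
  rewrite sumr_const_nat -mulr_natr => /le_trans; apply.
  have : (n - m)%:R <= Q%:R :> R by rewrite ler_nat leq_subLR ltnW.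
  move=> /(ler_wpM2l B0) h; rewrite mulrDr.
  by have := mulr_ge0 B0 (sum_ge0 m); have := mulr_ge0 k0 (ler0n R (n - m)); lra.
have [badm|goodm] := boolP (bad m).
  have := IH m.+1; rewrite subnS -ltnS prednK ?subn_gt0 // => /(_ ln).
  have aB' y : (m < y < n)%N -> `|a y| <= B by move=> /andP[/ltnW my yn]; apply: aB; rewrite my.
  have blk' y : (m < y)%N -> (y + Q <= n)%N -> ~~ bad y ->
    exists2 k, (0 < k <= Q)%N & `|\sum_(h < k) a (y + h)%N| <= kappa * k%:R.
    by move=> /ltnW; exact: blk.
  move=> /(_ aB' blk') H; rewrite big_ltn // (big_ltn mn) badm.
  have h1 : (n - m).-1%:R <= (n - m)%:R :> R by rewrite ler_nat leq_pred.
  have h2 := ler_wpM2l k0 h1.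
  have h3 := aB m; rewrite leqnn mn in h3.
  apply: le_trans (ler_normD _ _) _; have := h3 isT; rewrite /= in H *.
  by move: H; rewrite !mulrDr mulr1; lra.
have [k /andP[kpos kQ] Hk] := blk m (leqnn m) mQ goodm.
have mkn : (m + k <= n)%N by apply: leq_trans mQ; rewrite leq_add2l.
have lk : (n - (m + k) < l)%N.
  by rewrite subnDA -subSn ?leq_subRL ?(ltnW mn) //; lia.
have aB' y : (m + k <= y < n)%N -> `|a y| <= B.
  by move=> /andP[my yn]; apply: aB; rewrite yn andbT (leq_trans (leq_addr k m)).
have blk' y : (m + k <= y)%N -> (y + Q <= n)%N -> ~~ bad y ->
    exists2 k, (0 < k <= Q)%N & `|\sum_(h < k) a (y + h)%N| <= kappa * k%:R.
  by move=> my; apply: blk; rewrite (leq_trans (leq_addr k m)).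
have H := IH _ lk aB' blk'.
rewrite (@big_cat_nat _ _ _ (m + k)%N) ?leq_addr //=.
rewrite -{1}[m]add0n big_addn addKn big_mkord.
rewrite (eq_bigr (fun h : 'I_k => a (m + h)%N)); last by move=> h _; rewrite addnC.
have bad_le : \sum_(m + k <= y < n) (bad y)%:R <= \sum_(m <= y < n) (bad y)%:R :> R.
  rewrite [leRHS](@big_cat_nat _ _ _ (m + k)%N) ?leq_addr //= lerDr.
  by apply: sumr_ge0 => y _; exact: ler0n.
have h1 := ler_wpM2l B0 bad_le.
have -> : (n - m)%N = (k + (n - (m + k)))%N by lia.
apply: le_trans (ler_normD _ _) _.
by move: H; rewrite natrD !mulrDr; lra.
Qed.

Lemma count_close_points (P : pred nat) (m n d : nat) :
  (forall y y', (m <= y)%N -> (y <= y')%N -> (y' < n)%N -> P y -> P y' -> (y' - y <= d)%N) ->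
  \sum_(m <= y < n) (P y)%:R <= d.+1%:R :> R.
Proof.
have [l] := ubnP (n - m); elim: l m => // l IH m ln H.
case: (leqP n m) => [nm|mn]; first by rewrite big_geq.
have [Pm|nPm] := boolP (P m); last first.
  rewrite big_ltn // (negPf nPm) add0r; apply: IH; first by lia.
  by move=> y y' /ltnW; exact: H.
have -> : \sum_(m <= y < n) (P y)%:R = \sum_(m <= y < n | (y <= m + d)%N) (P y)%:R :> R.
  rewrite [RHS]big_mkcond; apply: eq_big_nat => y /andP[my yn].
  case: ifP => // /negbT; rewrite -ltnNge => lty.
  have [Py|//] := boolP (P y).
  by have := H _ _ (leqnn m) my yn Pm Py; lia.
apply: (@le_trans _ _ (\sum_(m <= y < (m + d).+1) 1)); last first.
  by rewrite sumr_const_nat -mulr_natr mul1r ler_nat; lia.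
case: (leqP n (m + d).+1) => [nd|dn].
  rewrite [leRHS](@big_cat_nat _ _ _ n) //=; last exact: ltnW.
  rewrite -[leLHS]addr0; apply: lerD; last by apply: sumr_ge0.
  rewrite big_mkcond; apply: ler_sum_nat => y _.
  by case: ifP => // _; case: (P y).
rewrite (@big_cat_nat _ _ _ (m + d).+1) //=; [|lia|exact: ltnW].
rewrite [X in _ + X]big_nat_cond [X in _ + X]big1 ?addr0; last by move=> y; lia.
rewrite big_mkcond; apply: ler_sum_nat => y _.
by case: ifP => // _; case: (P y).
Qed.

End Equidistribution.

Section BlockEstimate.
Variables (R : realType).

Lemma nat_above (x : R) : exists2 n : nat, (0 < n)%N & x <= n%:R.
Proof.
exists (Num.truncn x).+1 => //; case: (leP 0 x) => x0.
  by have /andP[_ /ltW] := truncn_itv x0.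
by apply: le_trans (ltW x0) _.
Qed.

Lemma norm3_le (x1 x2 x3 b1 b2 b3 z : R) :
  `|x1| <= b1 -> `|x2| <= b2 -> `|x3| <= b3 -> z = x1 + x2 + x3 ->
  `|z| <= b1 + b2 + b3.
Proof.
move=> h1 h2 h3 ->; apply: le_trans (ler_normD _ _) _; apply: lerD h3.
by apply: le_trans (ler_normD _ _) _; exact: lerD.
Qed.

Definition lip_on (a : R) (f : R -> R) (L : R) : Prop :=
  forall x y, a <= x <= 1 -> a <= y <= 1 -> `|f x - f y| <= L * `|x - y|.

Definition row0 (a : R) (J : nat) : nat := (Num.truncn (a * J%:R)).+1.

Lemma row0P (a : R) (J y : nat) : 0 <= a -> (row0 a J <= y)%N -> a * J%:R < y%:R.
Proof.
by move=> a0; rewrite /row0 -truncn_lt_nat // mulr_ge0.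
Qed.

(** The oscillation of row [y] around the mean [1 / 12] of [bern], in units of
    [J]; the phase [psi] absorbs the abscissa up to which the row is counted. *)
Definition osc (t : R) (psi : R -> R) (J y : nat) : R :=
  y%:R / J%:R * (bern (t * J%:R ^+ 2 / y%:R + psi (y%:R / J%:R)) - 1 / 12).

Variables (t a L : R) (psi : R -> R).
Hypotheses (t0 : 0 < t) (a0 : 0 < a) (L0 : 0 <= L) (psiL : lip_on a psi L).

Let inv_ineq (J y h : R) : 0 < J -> a * J < y -> 0 <= h ->
  `|t * J ^+ 2 / (y + h) - t * J ^+ 2 / y + t * J ^+ 2 / y ^+ 2 * h|
    <= t / a ^+ 3 * h ^+ 2 / J.
Proof.
move=> J0 aJy h0; have aJ0 : 0 < a * J by exact: mulr_gt0.
have y0 : 0 < y by exact: lt_trans aJy.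
have yh0 : 0 < y + h by exact: ltr_wpDr.
have -> : t * J ^+ 2 / (y + h) - t * J ^+ 2 / y + t * J ^+ 2 / y ^+ 2 * h =
    t * J ^+ 2 * h ^+ 2 / (y ^+ 2 * (y + h)).
  by field; rewrite !gt_eqF.
have den0 : 0 < y ^+ 2 * (y + h) by rewrite mulr_gt0 // exprn_gt0.
rewrite ger0_norm; last by rewrite divr_ge0 ?(ltW den0) // !mulr_ge0 ?exprn_ge0 // ltW.
have -> : t / a ^+ 3 * h ^+ 2 / J = t * J ^+ 2 * h ^+ 2 / (a * J) ^+ 3.
  by field; rewrite !gt_eqF.
apply: ler_wpM2l; first by rewrite !mulr_ge0 ?exprn_ge0 // ltW.
rewrite lef_pV2 ?posrE ?exprn_gt0 // (exprSr _ 2); apply: ler_pM.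
- by rewrite exprn_ge0 // ltW.
- exact: ltW.
- by rewrite lerXn2r ?nnegrE ?ltW.
- by rewrite ler_wpDr // ltW.
Qed.

Lemma bern12_bound (U : R) : `|bern U - 1 / 12| <= 1.
Proof. by have /andP[? ?] := bern_itv U; rewrite ler_norml; apply/andP; split; lra. Qed.

(** Inside a block, replace [t J^2 / y] by its tangent line, the slope of the
    line by [p / n], and the slowly varying weight and phase by their values at
    the first row. *)
Let term_approx (J y h n p Q : nat) : (0 < n)%N -> (h < n)%N -> (n <= Q)%N ->
  a * J%:R < y%:R -> (y + h <= J)%N ->
  `|n%:R * (t * J%:R ^+ 2 / y%:R ^+ 2) - p%:R| <= Q%:R^-1 ->
  `|osc t psi J (y + h) - y%:R / J%:R *
     (bern (t * J%:R ^+ 2 / y%:R + psi (y%:R / J%:R) - (p * h)%:R / n%:R) - 1 / 12)|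
  <= (1 + t / a ^+ 3 + L) * (Q%:R ^+ 2 / J%:R) + Q%:R^-1.
Proof.
move=> n0 hn nQ aJy yhJ napprox.
have Q0 : (0 < Q)%N by exact: leq_trans nQ.
have nR : 0 < n%:R :> R by rewrite ltr0n.
have yR : 0 < y%:R :> R by apply: le_lt_trans aJy; rewrite mulr_ge0 // ltW.
have y0 : (0 < y)%N by rewrite -(ltr0n R).
have J0 : (0 < J)%N by apply: leq_trans yhJ; rewrite addn_gt0 y0.
have JR : 0 < J%:R :> R by rewrite ltr0n.
have hQ : h%:R <= Q%:R :> R by rewrite ler_nat (leq_trans (ltnW hn)).
have Q1 : 1 <= Q%:R :> R by rewrite ler1n.
have yhJR : y%:R + h%:R <= J%:R :> R by rewrite -natrD ler_nat.
have h0 : 0 <= h%:R :> R by [].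
have e1 := inv_ineq JR aJy h0.
have eta1 : a <= (y%:R / J%:R : R) <= 1.
  by apply/andP; rewrite ler_pdivlMr // ler_pdivrMr // mul1r (ltW aJy); split=> //; lra.
have eta2 : a <= ((y + h)%:R / J%:R : R) <= 1.
  rewrite natrD ler_pdivlMr // ler_pdivrMr // mul1r yhJR andbT.
  by apply: ltW; apply: lt_le_trans aJy _; lra.
have e2 := psiL eta2 eta1.
have hE : (y + h)%:R - y%:R = h%:R :> R by rewrite natrD addrC addKr.
rewrite -mulrBl hE (@ger0_norm _ (h%:R / J%:R)) ?divr_ge0 // in e2.
have e3 : `|t * J%:R ^+ 2 / y%:R ^+ 2 * h%:R - (p * h)%:R / n%:R| <= Q%:R^-1.
  have -> : t * J%:R ^+ 2 / y%:R ^+ 2 * h%:R - (p * h)%:R / n%:R =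
     (n%:R * (t * J%:R ^+ 2 / y%:R ^+ 2) - p%:R) * (h%:R / n%:R).
    by rewrite natrM; field; rewrite !gt_eqF.
  rewrite normrM (ger0_norm (_ : 0 <= h%:R / n%:R)) ?divr_ge0 //.
  apply: le_trans napprox; rewrite ler_piMr //.
  by rewrite ler_pdivrMr // mul1r ler_nat ltnW.
rewrite natrD in e2; rewrite /osc natrD.
set U := t * J%:R ^+ 2 / (y%:R + h%:R) + _.
set V := t * J%:R ^+ 2 / y%:R + _ - _.
have UV : `|U - V| <= t / a ^+ 3 * h%:R ^+ 2 / J%:R + L * (h%:R / J%:R) + Q%:R^-1.
  by rewrite -normrN in e3; apply: (norm3_le e1 e2 e3); rewrite /U /V; ring.
have -> : (y%:R + h%:R) / J%:R * (bern U - 1 / 12) - y%:R / J%:R * (bern V - 1 / 12) =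
    h%:R / J%:R * (bern U - 1 / 12) + y%:R / J%:R * (bern U - bern V) by ring.
apply: le_trans (ler_normD _ _) _.
rewrite (normrM (h%:R / J%:R)) (normrM (y%:R / J%:R)).
have hJ0 : 0 <= h%:R / J%:R :> R by rewrite divr_ge0.
have yJ0 : 0 <= y%:R / J%:R :> R by rewrite divr_ge0.
rewrite !(ger0_norm hJ0) !(ger0_norm yJ0).
have f1 : h%:R / J%:R * `|bern U - 1 / 12| <= h%:R / J%:R.
  by rewrite ler_piMr // bern12_bound.
have f2 : y%:R / J%:R * `|bern U - bern V| <= `|U - V|.
  apply: le_trans (bern_lip _ _); rewrite ler_piMl //.
  by case/andP: eta1.
have f3 : h%:R / J%:R <= Q%:R ^+ 2 / J%:R :> R.
  by rewrite ler_wpM2r ?invr_ge0 // expr2; apply: le_trans hQ _; rewrite ler_peMr.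
have f4 : h%:R ^+ 2 / J%:R <= Q%:R ^+ 2 / J%:R :> R.
  by rewrite ler_wpM2r ?invr_ge0 // lerXn2r ?nnegrE.
have f5 := ler_wpM2l L0 f3.
have ta0 : 0 <= t / a ^+ 3 by rewrite divr_ge0 ?exprn_ge0 // ltW.
have := ler_wpM2l ta0 f4; rewrite mulrA => f6.
apply: le_trans (lerD f1 f2) _; apply: le_trans (lerD f3 UV) _.
rewrite !mulrDl mul1r -!addrA lerD2l !addrA lerD2r; exact: lerD f6 f5.
Qed.

(** The linearised block is a rotation, whose sum is bounded, and the [n]
    linearisation errors [Q^-1] add up to at most one. *)
Lemma block_estimate (J y n p Q : nat) : (0 < n)%N -> (n <= Q)%N -> coprime p n ->
  a * J%:R < y%:R -> (y + Q <= J.+1)%N ->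
  `|n%:R * (t * J%:R ^+ 2 / y%:R ^+ 2) - p%:R| <= Q%:R^-1 ->
  `|\sum_(h < n) osc t psi J (y + h)|
     <= 3 + n%:R * ((1 + t / a ^+ 3 + L) * (Q%:R ^+ 2 / J%:R)).
Proof.
move=> n0 nQ cop aJy yQJ napprox.
have nR : 0 < n%:R :> R by rewrite ltr0n.
set C := (1 + t / a ^+ 3 + L) * (Q%:R ^+ 2 / J%:R).
set theta := t * J%:R ^+ 2 / y%:R + psi (y%:R / J%:R).
pose b (h : 'I_n) := bern (theta - (p * h)%:R / n%:R) - 1 / 12.
have -> : \sum_(h < n) osc t psi J (y + h) =
    \sum_(h < n) (osc t psi J (y + h) - y%:R / J%:R * b h) + y%:R / J%:R * \sum_(h < n) b h.
  by rewrite mulr_sumr -big_split /=; apply: eq_bigr => h _; rewrite subrK.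
apply: le_trans (ler_normD _ _) _; rewrite (normrM (y%:R / J%:R)).
have yJ : y%:R / J%:R <= 1 :> R.
  have J0 : (0 < J)%N.
    case: J aJy yQJ {napprox theta b C} => // aJy yQJ.
    by have : (0 < y)%N; [rewrite -(ltr0n R) (le_lt_trans _ aJy) // mulr0|lia].
  by rewrite ler_pdivrMr ?ltr0n // mul1r ler_nat; lia.
have sb : `|\sum_(h < n) b h| <= 2.
  (* The rotation runs backwards; [- p] and [p * (n - 1)] agree modulo [n]. *)
  have cop' : coprime (p * n.-1) n.
    rewrite coprimeMl cop /=; case: (n) n0 => // m _.
    by rewrite /= coprimenS.
  apply: le_trans (sum_rotation_bern theta n0 cop').
  rewrite le_eqVlt; apply/orP; left; apply/eqP; congr (`| _ |).
  apply: eq_bigr => h _; rewrite /b; congr (_ - _).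
  rewrite -(bernDz (theta - (p * h)%:R / n%:R) (p * h)%N%:Z); congr (bern _).
  rewrite -[n in (p * n.-1)%N](prednK n0) /= -pmulrn !natrM.
  have -> : n.-1%:R = n%:R - 1 :> R by rewrite -[in RHS](prednK n0) -addn1 natrD addrK.
  by field; rewrite gt_eqF.
have yJ0 : 0 <= y%:R / J%:R :> R by rewrite divr_ge0.
have s1 : `|y%:R / J%:R| * `|\sum_(h < n) b h| <= 2.
  by rewrite ger0_norm //; apply: le_trans sb; rewrite ler_piMl.
have s2 : `|\sum_(h < n) (osc t psi J (y + h) - y%:R / J%:R * b h)| <= n%:R * C + 1.
  apply: le_trans (ler_norm_sum _ _ _) _.
  apply: (@le_trans _ _ (\sum_(h < n) (C + Q%:R^-1))).
    apply: ler_sum => h _; apply: term_approx => //.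
    by rewrite -ltnS; apply: leq_trans yQJ; rewrite ltn_add2l (leq_trans (ltn_ord h)).
  rewrite sumr_const card_ord -(mulr_natl (C + _)) mulrDr lerD2l.
  by rewrite ler_pdivrMr ?mul1r ?ler_nat // ltr0n (leq_trans n0).
by lra.
Qed.

End BlockEstimate.

Section SumOsc.
Variables (R : realType) (t a L : R) (psi : R -> R).
Hypotheses (t0 : 0 < t) (a0 : 0 < a) (L0 : 0 <= L) (psiL : lip_on a psi L).

Let slope (J y : nat) : R := t * J%:R ^+ 2 / y%:R ^+ 2.

Let near_rational (Q J n p y : nat) : bool :=
  (0 < n)%N && (`|n%:R * slope J y - p%:R| <= Q%:R^-1).

(** The rows at which [t J^2 / y] moves with a slope close to a rational of
    denominator below [K]: blocks starting there are too short to cancel. *)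
Let bad (K P Q J : nat) (y : nat) : bool :=
  [exists n : 'I_K, [exists p : 'I_P, near_rational Q J n p y]].

Let slope_gap (J y y' : nat) : (0 < y)%N -> (y <= y')%N -> (y' <= J)%N ->
  t * (y' - y)%:R / J%:R <= slope J y - slope J y'.
Proof.
move=> y0 yy' y'J.
have y'0 : (0 < y')%N by exact: leq_trans yy'.
have yR : 0 < y%:R :> R by rewrite ltr0n.
have y'R : 0 < y'%:R :> R by rewrite ltr0n.
have JR : 0 < J%:R :> R by rewrite ltr0n (leq_trans y'0).
have yy'R : y%:R <= y'%:R :> R by rewrite ler_nat.
have y'JR : y'%:R <= J%:R :> R by rewrite ler_nat.
rewrite natrB // /slope.
have -> : t * J%:R ^+ 2 / y%:R ^+ 2 - t * J%:R ^+ 2 / y'%:R ^+ 2 =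
    t * (y'%:R - y%:R) / J%:R * (J%:R ^+ 3 * (y%:R + y'%:R) / (y%:R ^+ 2 * y'%:R ^+ 2)).
  by field; rewrite !gt_eqF.
rewrite ler_peMr //; first by rewrite divr_ge0 ?mulr_ge0 ?subr_ge0 // ltW.
rewrite ler_pdivlMr ?mulr_gt0 ?exprn_gt0 // mul1r.
apply: (@le_trans _ _ (J%:R ^+ 3 * y'%:R)); last first.
  by rewrite ler_wpM2l ?exprn_ge0 // lerDr ltW.
rewrite (exprSr y'%:R 1) mulrA ler_wpM2r ?(ltW y'R) // (exprSr _ 2) expr1.
apply: ler_pM; rewrite ?exprn_ge0 ?(ltW y'R) //.
by rewrite lerXn2r ?nnegrE // (le_trans yy'R).
Qed.

Let count_near_rational (Q J n p m : nat) : (0 < Q)%N -> (0 < m)%N ->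
  \sum_(m <= y < J.+1) (near_rational Q J n p y)%:R <= 2 * J%:R / (t * Q%:R) + 1.
Proof.
move=> Q0 m0; have QR : 0 < Q%:R :> R by rewrite ltr0n.
have tQ : 0 < t * Q%:R by exact: mulr_gt0.
have D0 : 0 <= 2 * J%:R / (t * Q%:R) by rewrite divr_ge0 ?mulr_ge0 // ltW.
have H := @count_close_points R (near_rational Q J n p) m J.+1
  (Num.truncn (2 * J%:R / (t * Q%:R))).
have : forall y y' : nat, (m <= y)%N -> (y <= y')%N -> (y' < J.+1)%N ->
    near_rational Q J n p y -> near_rational Q J n p y' ->
    (y' - y <= Num.truncn (2 * J%:R / (t * Q%:R)))%N.
  move=> y y' my yy' y'J /andP[n0 h1] /andP[_ h2].
  have y0 : (0 < y)%N by exact: leq_trans my.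
  have JR : 0 < J%:R :> R by rewrite ltr0n; exact: leq_trans (leq_trans y0 yy') y'J.
  rewrite truncn_ge_nat // ler_pdivlMr //.
  have := slope_gap y0 yy' y'J; set d := slope J y - _ => g.
  have n1 : 1 <= n%:R :> R by rewrite ler1n.
  have tyy : 0 <= t * (y' - y)%:R / J%:R by rewrite divr_ge0 ?mulr_ge0 // ltW.
  have d0 : 0 <= d by exact: le_trans g.
  have : d <= 2 / Q%:R.
    apply: (@le_trans _ _ (n%:R * d)); first by rewrite ler_peMl.
    move: h1 h2; rewrite !ler_norml => /andP[_ h1] /andP[h2 _].
    by rewrite /d mulrBr; lra.
  move=> /(le_trans g); rewrite ler_pdivrMr // mulrAC ler_pdivlMr //.
  by move=> h; rewrite (mulrC _ (t * _)) mulrAC.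
move=> /H /le_trans; apply.
by rewrite -addn1 natrD lerD2r truncn_le.
Qed.

Let count_bad (K P Q J m : nat) : (0 < Q)%N -> (0 < m)%N ->
  \sum_(m <= y < J.+1) (bad K P Q J y)%:R
    <= (K * P)%:R * (2 * J%:R / (t * Q%:R) + 1).
Proof.
move=> Q0 m0.
apply: (@le_trans _ _ (\sum_(m <= y < J.+1) \sum_(n < K) \sum_(p < P)
    (near_rational Q J n p y)%:R)).
  apply: ler_sum_nat => y _.
  have pos (n : 'I_K) : 0 <= \sum_(p < P) (near_rational Q J n p y)%:R :> R.
    by apply: sumr_ge0.
  case: (boolP (bad _ _ _ _ _)) => [/existsP[n /existsP[p H]]|_]; last first.
    exact: sumr_ge0.
  rewrite (bigD1 n) //= (bigD1 p) //= H -addrA lerDl.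
  by rewrite addr_ge0 //; exact: sumr_ge0.
rewrite exchange_big /=.
under eq_bigr do rewrite exchange_big /=.
apply: (@le_trans _ _ (\sum_(n < K) \sum_(p < P) (2 * J%:R / (t * Q%:R) + 1))).
  by apply: ler_sum => n _; apply: ler_sum => p _; exact: count_near_rational.
rewrite !sumr_const !card_ord -mulrnA -(mulr_natl (_ + 1)) mulnC.
by rewrite lexx.
Qed.

(** Rows are grouped into blocks on which [t J^2 / y] is almost linear in [y]
    with an almost rational slope; a block of reduced denominator [n] sums to
    [O(1)], which is small against [n] unless [n] is bounded. As the slope
    varies at rate at least [t / J], few rows have a slope close to a rational
    of bounded denominator. *)
Theorem sum_osc (eps : R) : 0 < eps -> exists J0, forall J, (J0 <= J)%N ->
  `|\sum_(row0 a J <= y < J.+1) osc t psi J y| <= eps * J%:R.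
Proof.
move=> e0.
(* [K] makes the bounded block sums small against the length of the blocks,
   [P] exceeds all numerators that occur, and [Q] makes the bad rows rare. *)
have [K K0 HK] := nat_above (9 / eps).
have [P P0 HP] := nat_above (K%:R * (t / a ^+ 2) + 2).
have [Q Q0 HQ] := nat_above (6 * (K * P)%:R / (t * eps)).
pose C := 1 + t / a ^+ 3 + L.
have C0 : 0 <= C by rewrite !addr_ge0 // divr_ge0 ?exprn_ge0 // ltW.
have [J0 J00 HJ0] := nat_above (3 * (C * Q%:R ^+ 2 + Q%:R + (K * P)%:R) / eps).
exists J0 => J J0J.
have J0' : (0 < J)%N by exact: leq_trans J0J.
have JR : 0 < J%:R :> R by rewrite ltr0n.
have QR : 0 < Q%:R :> R by rewrite ltr0n.
have KR : 0 < K%:R :> R by rewrite ltr0n.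
pose kappa := 3 / K%:R + C * (Q%:R ^+ 2 / J%:R).
have kappa0 : 0 <= kappa.
  by rewrite addr_ge0 ?divr_ge0 ?mulr_ge0 ?invr_ge0 ?exprn_ge0 // ltW.
have aJ y : (row0 a J <= y)%N -> a * J%:R < y%:R by apply: row0P; exact: ltW.
have osc1 y : (row0 a J <= y < J.+1)%N -> `|osc t psi J y| <= 1.
  move=> /andP[_ yJ]; rewrite /osc normrM ger0_norm ?divr_ge0 //.
  apply: le_trans (ler_piMl (normr_ge0 _) _) (bern12_bound _).
  by rewrite ler_pdivrMr // mul1r ler_nat -ltnS.
have blk y : (row0 a J <= y)%N -> (y + Q <= J.+1)%N -> ~~ bad K P Q J y ->
    exists2 k, (0 < k <= Q)%N & `|\sum_(h < k) osc t psi J (y + h)%N| <= kappa * k%:R.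
  move=> ly yQ good.
  have aJy := aJ _ ly.
  have yR : 0 < y%:R :> R by apply: le_lt_trans aJy; rewrite mulr_ge0 // ltW.
  have slope0 : 0 <= slope J y by rewrite /slope divr_ge0 ?mulr_ge0 ?exprn_ge0 // ltW.
  have slopeA : slope J y <= t / a ^+ 2.
    rewrite /slope ler_pdivrMr ?exprn_gt0 // mulrAC ler_pdivlMr ?exprn_gt0 //.
    rewrite -mulrA -exprMn_comm; last exact: mulrC.
    rewrite ler_wpM2l ?(ltW t0) // (mulrC J%:R) ler_sqr ?nnegrE ?mulr_ge0 ?(ltW a0) //.
    exact: ltW.
  have [n [p [/andP[n0 nQ] cop happ]]] := dirichlet_approximation slope0 Q0.
  exists n; first by rewrite n0.
  have nR : 0 < n%:R :> R by rewrite ltr0n.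
  have Kn : (K <= n)%N.
    rewrite leqNgt; apply/negP => nK; move/negP: good; apply.
    have pP : (p < P)%N.
      rewrite -(ltr_nat R); apply: lt_le_trans HP.
      have h1 : n%:R * slope J y <= K%:R * (t / a ^+ 2).
        by apply: ler_pM => //; rewrite ler_nat ltnW.
      have h2 : Q%:R^-1 <= 1 :> R by rewrite invf_le1 // ler1n.
      by move: happ; rewrite ler_norml => /andP[h3 _]; lra.
    apply/existsP; exists (Ordinal nK); apply/existsP; exists (Ordinal pP).
    by rewrite /near_rational n0.
  apply: le_trans (block_estimate t0 a0 L0 psiL n0 nQ cop aJy yQ happ) _.
  rewrite -/C /kappa (mulrDl (3 / K%:R)) (mulrC n%:R) lerD2r.
  by rewrite mulrAC ler_pdivlMr // ler_wpM2l // ler_nat.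
have := sum_by_blocks ler01 kappa0 osc1 blk.
move=> /le_trans; apply.
have h1 := count_bad K P J Q0 (ltn0Sn (Num.truncn (a * J%:R))).
rewrite mul1r.
have h2 : kappa * (J.+1 - row0 a J)%:R <= kappa * J%:R.
  by rewrite ler_wpM2l // ler_nat /row0 subSS leq_subr.
have h3 : kappa * J%:R = 3 / K%:R * J%:R + C * Q%:R ^+ 2.
  by rewrite /kappa; field; rewrite !gt_eqF.
have h4 : 3 / K%:R * J%:R <= eps / 3 * J%:R.
  rewrite ler_wpM2r // ler_pdivrMr //.
  by move: HK; rewrite ler_pdivrMr //; lra.
have h5 : (K * P)%:R * (2 * J%:R / (t * Q%:R) + 1) <= eps / 3 * J%:R + (K * P)%:R.
  rewrite mulrDr mulr1 lerD2r.
  move: HQ; rewrite ler_pdivrMr ?mulr_gt0 // => HQ.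
  rewrite mulrA ler_pdivrMr ?mulr_gt0 //.
  rewrite (_ : _ * (2 * _) = 6 * (K * P)%:R * (J%:R / 3)); last by field.
  rewrite (_ : eps / 3 * _ * _ = Q%:R * (t * eps) * (J%:R / 3)); last by field.
  by rewrite ler_wpM2r // divr_ge0.
have h6 : C * Q%:R ^+ 2 + Q%:R + (K * P)%:R <= eps / 3 * J%:R.
  have : J0%:R <= J%:R :> R by rewrite ler_nat.
  move=> /(le_trans HJ0); rewrite ler_pdivrMr //; lra.
rewrite -/(row0 a J) in h1.
lra.
Qed.

End SumOsc.

(** * Lipschitz functions of the height *)

Section Tame.
Variables (R : realType) (a : R).
Hypothesis a0 : 0 < a.
Implicit Types f g : R -> R.

Definition tame f : Prop :=
  exists L, [/\ 0 <= L, lip_on a f L & forall x, a <= x <= 1 -> `|f x| <= L].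

Lemma tame_cst c : tame (fun=> c).
Proof. by exists `|c|; split=> // x y _ _; rewrite subrr normr0 mulr_ge0. Qed.

Lemma tame_inv : tame (fun x => x^-1).
Proof.
have a2 : 0 < a ^+ 2 by rewrite exprn_gt0.
exists (a^-1 + (a ^+ 2)^-1); split.
- by rewrite addr_ge0 // invr_ge0 ltW.
- move=> x y /andP[ax _] /andP[ay _].
  have x0 : 0 < x by exact: lt_le_trans ax.
  have y0 : 0 < y by exact: lt_le_trans ay.
  have -> : x^-1 - y^-1 = (y - x) / (x * y) by field; rewrite !gt_eqF.
  rewrite normrM distrC mulrC ler_wpM2r //.
  rewrite ger0_norm ?invr_ge0 ?mulr_ge0 ?(ltW x0) ?(ltW y0) //.
  apply: (@le_trans _ _ (a ^+ 2)^-1); last by rewrite lerDr invr_ge0 ltW.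
  by rewrite lef_pV2 ?posrE ?mulr_gt0 // expr2 ler_pM // ltW.
- move=> x /andP[ax _]; have x0 : 0 < x by exact: lt_le_trans ax.
  rewrite ger0_norm ?invr_ge0 ?(ltW x0) //.
  apply: (@le_trans _ _ a^-1); first by rewrite lef_pV2.
  by rewrite lerDl invr_ge0 ltW.
Qed.

Lemma tameN f : tame f -> tame (fun x => - f x).
Proof.
move=> [L [L0 fL fB]]; exists L; split=> // x.
  by move=> y ax ay; rewrite -opprD normrN; exact: fL.
by move=> ax; rewrite normrN; exact: fB.
Qed.

Lemma tameD f g : tame f -> tame g -> tame (fun x => f x + g x).
Proof.
move=> [L [L0 fL fB]] [M [M0 gM gB]]; exists (L + M); split.
- exact: addr_ge0.
- move=> x y ax ay; rewrite mulrDl.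
  rewrite (_ : _ - _ = (f x - f y) + (g x - g y)); last by ring.
  by apply: le_trans (ler_normD _ _) _; apply: lerD; [exact: fL|exact: gM].
- move=> x ax; apply: le_trans (ler_normD _ _) _.
  by apply: lerD; [exact: fB|exact: gB].
Qed.

Lemma tameB f g : tame f -> tame g -> tame (fun x => f x - g x).
Proof. by move=> tf tg; apply: tameD tf (tameN tg). Qed.

Lemma tameM f g : tame f -> tame g -> tame (fun x => f x * g x).
Proof.
move=> [L [L0 fL fB]] [M [M0 gM gB]]; exists (2 * (L * M) + L * M); split.
- by rewrite addr_ge0 ?mulr_ge0.
- move=> x y ax ay.
  rewrite (_ : _ - _ = (f x - f y) * g x + f y * (g x - g y)); last by ring.
  have d0 := normr_ge0 (x - y).
  have h1 : `|(f x - f y) * g x| <= L * `|x - y| * M.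
    by rewrite normrM ler_pM //; [exact: fL|exact: gB].
  have h2 : `|f y * (g x - g y)| <= L * (M * `|x - y|).
    by rewrite normrM ler_pM //; [exact: fB|exact: gM].
  apply: le_trans (ler_normD _ _) _.
  have := mulr_ge0 (mulr_ge0 L0 M0) d0; lra.
- move=> x ax; rewrite normrM.
  have : `|f x| * `|g x| <= L * M by rewrite ler_pM //; [exact: fB|exact: gB].
  by have := mulr_ge0 L0 M0; lra.
Qed.

Let maxE (u v : R) : Num.max u v = (u + v + `|u - v|) / 2.
Proof.
by rewrite /Num.max; case: ltP => h; [rewrite ltr0_norm|rewrite ger0_norm]; lra.
Qed.

Let minE (u v : R) : Num.min u v = (u + v - `|u - v|) / 2.
Proof.
by rewrite /Num.min; case: ltP => h; [rewrite ltr0_norm|rewrite ger0_norm]; lra.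
Qed.

Lemma tame_norm f : tame f -> tame (fun x => `|f x|).
Proof.
move=> [L [L0 fL fB]]; exists L; split=> // x.
  by move=> y ax ay; apply: le_trans (ler_dist_dist _ _) (fL _ _ ax ay).
by move=> ax; rewrite normr_id; exact: fB.
Qed.

Lemma eq_tame f g : f =1 g -> tame f -> tame g.
Proof. by move=> /funext ->. Qed.

Lemma tame_max f g : tame f -> tame g -> tame (fun x => Num.max (f x) (g x)).
Proof.
move=> tf tg; apply: (@eq_tame (fun x => (f x + g x + `|f x - g x|) / 2)).
  by move=> x; rewrite maxE.
apply: tameM (tame_cst _); apply: tameD; first exact: tameD.
by apply: tame_norm; exact: tameB.
Qed.

Lemma tame_min f g : tame f -> tame g -> tame (fun x => Num.min (f x) (g x)).
Proof.
move=> tf tg; apply: (@eq_tame (fun x => (f x + g x - `|f x - g x|) / 2)).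
  by move=> x; rewrite minE.
apply: tameM (tame_cst _); apply: tameB; first exact: tameD.
by apply: tame_norm; exact: tameB.
Qed.

End Tame.

(** * Counting lattice points in cells *)

Section Cells.
Variables (R : realType) (t a : R).
Hypotheses (t0 : 0 < t) (a0 : 0 < a).
Implicit Types (J y i m : nat) (xi b : R -> R).

(** The inverse slope, from the viewpoint, of the point with abscissa [i - J]
    and ordinate [y]. *)
Definition phase J y i : R := (i%:R + (t * J%:R ^+ 2 - J%:R)) / y%:R.

Lemma window_flr (U b : R) : 0 <= b <= 1 ->
  (frac U < b)%R%:R = flr U - flr (U - b).
Proof.
move=> /andP[b0 b1]; have := frac_itv U; rewrite /frac => /andP[f0 f1].
case: ltP => h.
  rewrite [X in _ - X](_ : _ = flr U - 1); first by rewrite opprB addrCA subrr addr0.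
  rewrite /flr (@floor_def _ (U - b) (Num.floor U - 1)) ?rmorphB //.
  by rewrite subrK; move: h f0 f1; rewrite /flr => *; apply/andP; split; lra.
rewrite [X in _ - X](_ : _ = flr U); first by rewrite subrr.
rewrite /flr (@floor_def _ (U - b) (Num.floor U)) //.
by rewrite intrD; move: h f0 f1; rewrite /flr => *; apply/andP; split; lra.
Qed.

Lemma nat_ceil (z : R) : 0 <= z ->
  exists m, [/\ z <= m%:R, m%:R < z + 1 & forall i, (i < m)%N = (i%:R < z)].
Proof.
move=> z0; have /andP[h1 h2] := truncn_itv z0; set k := Num.truncn z in h1 h2.
have [E|kz] := eqVneq (k%:R : R) z.
  exists k; split=> [||i]; rewrite -?E ?ltr_nat //; lra.
have lt_kz : k%:R < z by rewrite lt_neqAle kz h1.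
exists k.+1; split=> [||i]; first exact: ltW.
  by rewrite -addn1 natrD; lra.
rewrite ltnS; apply/idP/idP => [ik|].
  by apply: le_lt_trans lt_kz; rewrite ler_nat.
by move=> /lt_trans/(_ h2); rewrite ltr_nat.
Qed.

Definition left_of J (xi : R) i : bool := i%:R < J%:R * (1 + xi).

(** Counting the points left of [xi] in one row: the number [m] of admissible
    indices differs from [J (1 + xi)] by less than one, which moves the
    arguments of [bern] by at most [1 / y] and is harmless. *)
Let corner_row J y (xi b : R) : (y <= J)%N -> a * J%:R < y%:R ->
  -1 <= xi <= 1 -> 0 <= b <= 1 ->
  `|\sum_(0 <= i < 2 * J + 1) (left_of J xi i)%:R * (frac (phase J y i) < b)%R%:R
    - (b * (J%:R * (1 + xi))
       + y%:R * (bern (t * J%:R ^+ 2 / y%:R + xi / (y%:R / J%:R))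
                 - bern (t * J%:R ^+ 2 / y%:R - 1 / (y%:R / J%:R))
                 - bern (t * J%:R ^+ 2 / y%:R + (xi / (y%:R / J%:R) - b))
                 + bern (t * J%:R ^+ 2 / y%:R + (- (1 / (y%:R / J%:R)) - b))))|
  <= 2 / a + 5.
Proof.
move=> yJ aJy /andP[xi0 xi1] b01.
have yR : 0 < y%:R :> R by apply: le_lt_trans aJy; rewrite mulr_ge0 // ltW.
have JR : 0 < J%:R :> R by apply: lt_le_trans yR _; rewrite ler_nat.
have z0 : 0 <= J%:R * (1 + xi) by rewrite mulr_ge0 //; lra.
have [m [zm mz ltm]] := nat_ceil z0.
have z2J : J%:R * (1 + xi) <= 2 * J%:R by rewrite mulrC ler_wpM2r //; lra.
have m2J : (m <= 2 * J + 1)%N.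
  rewrite -(ler_nat R) natrD natrM; lra.
rewrite [X in `|X - _|](_ : _ =
  \sum_(0 <= i < m) (flr (phase J y i) - flr (phase J y i - b))); last first.
  rewrite (@big_cat_nat _ _ _ m) //= [X in _ + X]big_nat_cond [X in _ + X]big1 ?addr0.
    by apply: eq_big_nat => i /andP[_ im]; rewrite /left_of -ltm im mul1r window_flr.
  by move=> i /andP[/andP[mi _] _]; rewrite /left_of -ltm ltnNge mi mul0r.
have /andP[b0 b1] := b01.
have := sum_flr_window m (t * J%:R ^+ 2 - J%:R) yR b0.
rewrite -/(phase _ _ _).
have -> : (t * J%:R ^+ 2 - J%:R) / y%:R = t * J%:R ^+ 2 / y%:R - 1 / (y%:R / J%:R).
  by field; rewrite !gt_eqF.
set S := \sum_(0 <= i < m) _; set c := t * J%:R ^+ 2 / y%:R.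
set e1 := xi / _; set e2 := 1 / _.
have -> : c + (- e2 - b) = c - e2 - b by ring.
have -> : c + (e1 - b) = c + e1 - b by ring.
have close : `|(m%:R + (t * J%:R ^+ 2 - J%:R)) / y%:R - (c + e1)| <= y%:R^-1.
  have -> : (m%:R + (t * J%:R ^+ 2 - J%:R)) / y%:R - (c + e1) =
     (m%:R - J%:R * (1 + xi)) / y%:R by rewrite /c /e1; field; rewrite !gt_eqF.
  rewrite normrM (ger0_norm (_ : 0 <= y%:R^-1)) ?invr_ge0 //.
  by rewrite ler_piMl ?invr_ge0 // ler_norml; apply/andP; split; lra.
move: close; set W := (_ + _) / _ => close.
have h1 : `|y%:R * (bern W - bern (c + e1))| <= 1.
  rewrite normrM ger0_norm // -[leRHS](divff (lt0r_neq0 yR)) ler_wpM2l //.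
  exact: le_trans (bern_lip _ _) close.
have h2 : `|y%:R * (bern (W - b) - bern (c + e1 - b))| <= 1.
  rewrite normrM ger0_norm // -[leRHS](divff (lt0r_neq0 yR)) ler_wpM2l //.
  apply: le_trans (bern_lip _ _) _.
  by rewrite (_ : _ - _ = W - (c + e1)) //; ring.
have h3 : `|b * (m%:R - J%:R * (1 + xi))| <= 1.
  rewrite normrM !ger0_norm ?subr_ge0 //.
  by apply: mulr_ile1; rewrite ?subr_ge0 //; lra.
have h4 : m%:R / y%:R <= 2 / a + 1.
  rewrite ler_pdivrMr // mulrDl mul1r.
  have h : 2 * J%:R <= 2 / a * y%:R.
    by rewrite mulrAC ler_pdivlMr // -mulrA ler_wpM2l // mulrC ltW.
  have y1 : 1 <= y%:R :> R by rewrite ler1n -(ltr0n R).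
  by lra.
move: h1 h2 h3 h4; rewrite !ler_norml.
move=> /andP[? ?] /andP[? ?] /andP[? ?] ? /andP[? ?].
by apply/andP; split; lra.
Qed.

(** The four Bernoulli terms of a row enter with signs that cancel their means,
    and each of them is summed by [sum_osc]. *)
Let corner_sum xi b : tame a xi -> tame a b ->
  (forall x, a <= x <= 1 -> -1 <= xi x <= 1) ->
  (forall x, a <= x <= 1 -> 0 <= b x <= 1) ->
  forall eps, 0 < eps -> exists J0, forall J, (J0 <= J)%N ->
  `|\sum_(row0 a J <= y < J.+1)
      (\sum_(0 <= i < 2 * J + 1)
         (left_of J (xi (y%:R / J%:R)) i)%:R * (frac (phase J y i) < b (y%:R / J%:R))%R%:R
       - b (y%:R / J%:R) * (J%:R * (1 + xi (y%:R / J%:R))))| <= eps * J%:R ^+ 2.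
Proof.
move=> txi tb xi1 b1 eps e0.
have ti := tame_inv a0.
have [L1 [L10 l1 _]] : tame a (fun x => xi x / x) by exact: tameM.
have [L2 [L20 l2 _]] : tame a (fun x => - (1 / x)).
  by apply: tameN; apply: tameM ti; exact: tame_cst.
have [L3 [L30 l3 _]] : tame a (fun x => xi x / x - b x) by apply: tameB => //; exact: tameM.
have [L4 [L40 l4 _]] : tame a (fun x => - (1 / x) - b x).
  by apply: tameB => //; apply: tameN; apply: tameM ti; exact: tame_cst.
have e5 : 0 < eps / 5 by rewrite divr_gt0.
have [J1 H1] := sum_osc t0 a0 L10 l1 e5.
have [J2 H2] := sum_osc t0 a0 L20 l2 e5.
have [J3 H3] := sum_osc t0 a0 L30 l3 e5.
have [J4 H4] := sum_osc t0 a0 L40 l4 e5.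
have [J5 J50 H5] := nat_above ((2 / a + 5) / (eps / 5)).
exists (maxn J1 (maxn J2 (maxn J3 (maxn J4 J5)))) => J.
rewrite !geq_max => /and5P[JJ1 JJ2 JJ3 JJ4 JJ5].
have {}H1 := H1 _ JJ1; have {}H2 := H2 _ JJ2.
have {}H3 := H3 _ JJ3; have {}H4 := H4 _ JJ4.
have J0 : (0 < J)%N by exact: leq_trans JJ5.
have JR : 0 < J%:R :> R by rewrite ltr0n.
have JN : J%:R != 0 :> R by rewrite gt_eqF.
set S1 := \sum_(_ <= _ < _) _ in H1; set S2 := \sum_(_ <= _ < _) _ in H2.
set S3 := \sum_(_ <= _ < _) _ in H3; set S4 := \sum_(_ <= _ < _) _ in H4.
pose D y := \sum_(0 <= i < 2 * J + 1)
  (left_of J (xi (y%:R / J%:R)) i)%:R * (frac (phase J y i) < b (y%:R / J%:R))%R%:R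
  - b (y%:R / J%:R) * (J%:R * (1 + xi (y%:R / J%:R))).
pose O y := J%:R * (osc t (fun x => xi x / x) J y - osc t (fun x => - (1 / x)) J y
  - osc t (fun x => xi x / x - b x) J y + osc t (fun x => - (1 / x) - b x) J y).
have OS : \sum_(row0 a J <= y < J.+1) O y = J%:R * (S1 - S2 - S3 + S4).
  by rewrite -mulr_sumr big_split /= 2!sumrB.
have DO : `|\sum_(row0 a J <= y < J.+1) (D y - O y)| <= (2 / a + 5) * J%:R.
  apply: le_trans (ler_norm_sum _ _ _) _.
  apply: (@le_trans _ _ (\sum_(row0 a J <= y < J.+1) (2 / a + 5))); last first.
    rewrite sumr_const_nat -(mulr_natr (_ + _)) ler_wpM2l //.
      by rewrite addr_ge0 // divr_ge0 // ltW.
    by rewrite ler_nat /row0 subSS leq_subr.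
  apply: ler_sum_nat => y /andP[ry yJ]; rewrite ltnS in yJ.
  have aJy := row0P (ltW a0) ry.
  have eta : a <= (y%:R / J%:R : R) <= 1.
    by rewrite ler_pdivlMr // ler_pdivrMr // mul1r ler_nat yJ ltW.
  have := corner_row yJ aJy (xi1 _ eta) (b1 _ eta).
  rewrite le_eqVlt => h; move: h; rewrite -le_eqVlt; apply: le_trans.
  rewrite le_eqVlt; apply/orP; left; apply/eqP; congr (`| _ |).
  rewrite /D /O /osc; field; exact: JN.
have -> : \sum_(row0 a J <= y < J.+1) D y =
    \sum_(row0 a J <= y < J.+1) (D y - O y) + J%:R * (S1 - S2 - S3 + S4).
  by rewrite -OS -big_split /=; apply: eq_bigr => y _; rewrite subrK.
apply: le_trans (ler_normD _ _) _.
have h1 : `|J%:R * (S1 - S2 - S3 + S4)| <= J%:R * (4 * (eps / 5) * J%:R).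
  rewrite normrM ger0_norm // ler_wpM2l //.
  by move: H1 H2 H3 H4; rewrite !ler_norml => /andP[? ?] /andP[? ?] /andP[? ?] /andP[? ?];
    apply/andP; split; lra.
have h2 : (2 / a + 5) * J%:R <= eps / 5 * J%:R ^+ 2.
  rewrite expr2 mulrA ler_wpM2r // -ler_pdivrMl // mulrC.
  by apply: le_trans H5 _; rewrite ler_nat.
lra.
Qed.

(** Counted with sign, so that a cell is the alternating sum of four corners
    whatever the order of its ends. *)
Definition cell J y (xi1 xi2 b1 b2 : R) i : R :=
  ((left_of J xi2 i)%:R - (left_of J xi1 i)%:R) *
  ((frac (phase J y i) < b2)%R%:R - (frac (phase J y i) < b1)%R%:R).

(** The fractional part of the inverse slope is asymptotically uniform and
    independent of the position in the rectangle. *)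
Theorem cell_sum xi1 xi2 b1 b2 :
  tame a xi1 -> tame a xi2 -> tame a b1 -> tame a b2 ->
  (forall x, a <= x <= 1 -> -1 <= xi1 x <= 1) ->
  (forall x, a <= x <= 1 -> -1 <= xi2 x <= 1) ->
  (forall x, a <= x <= 1 -> 0 <= b1 x <= 1) ->
  (forall x, a <= x <= 1 -> 0 <= b2 x <= 1) ->
  forall eps, 0 < eps -> exists J0, forall J, (J0 <= J)%N ->
  `|\sum_(row0 a J <= y < J.+1)
      (let x := y%:R / J%:R in
       \sum_(0 <= i < 2 * J + 1) cell J y (xi1 x) (xi2 x) (b1 x) (b2 x) i
       - J%:R * ((xi2 x - xi1 x) * (b2 x - b1 x)))| <= eps * J%:R ^+ 2.
Proof.
move=> txi1 txi2 tb1 tb2 Bxi1 Bxi2 Bb1 Bb2 eps e0.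
have e4 : 0 < eps / 4 by rewrite divr_gt0.
have [J1 H1] := corner_sum txi2 tb2 Bxi2 Bb2 e4.
have [J2 H2] := corner_sum txi2 tb1 Bxi2 Bb1 e4.
have [J3 H3] := corner_sum txi1 tb2 Bxi1 Bb2 e4.
have [J4 H4] := corner_sum txi1 tb1 Bxi1 Bb1 e4.
exists (maxn J1 (maxn J2 (maxn J3 J4))) => J.
rewrite !geq_max => /and4P[/H1{}H1 /H2{}H2 /H3{}H3 /H4{}H4].
set S1 := \sum_(_ <= _ < _) _ in H1; set S2 := \sum_(_ <= _ < _) _ in H2.
set S3 := \sum_(_ <= _ < _) _ in H3; set S4 := \sum_(_ <= _ < _) _ in H4.
rewrite [X in `|X|](_ : _ = S1 - S2 - S3 + S4); last first.
  rewrite -!sumrB -big_split /=; apply: eq_bigr => y _.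
  rewrite /cell.
  under eq_bigr do rewrite mulrBr !mulrBl.
  by rewrite !sumrB; ring.
by move: H1 H2 H3 H4; rewrite !ler_norml => /andP[? ?] /andP[? ?] /andP[? ?] /andP[? ?];
    apply/andP; split; lra.
Qed.

End Cells.

(** * Riemann sums over the rows *)

Section Riemann.
Variables (R : realType) (a : R).
Hypothesis a0 : 0 < a.
Implicit Types (f F G : R -> R).

(** [F] is a primitive of [f], in a quantitative form that, contrary to
    differentiability, glues along points where [f] has a corner. *)
Definition prim f F : Prop :=
  exists2 L, 0 <= L & forall u v, a <= u -> u <= v -> v <= 1 ->
    `|F v - F u - f u * (v - u)| <= L * (v - u) ^+ 2.

Lemma primD f g F G : prim f F -> prim g G ->
  prim (fun x => f x + g x) (fun x => F x + G x).
Proof.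
move=> [L L0 fF] [M M0 gG]; exists (L + M); first exact: addr_ge0.
move=> u v au uv v1; rewrite (mulrDl L).
rewrite (_ : _ - _ = (F v - F u - f u * (v - u)) + (G v - G u - g u * (v - u))); last by ring.
by apply: le_trans (ler_normD _ _) _; apply: lerD; [exact: fF|exact: gG].
Qed.

Lemma primZ c f F : prim f F -> prim (fun x => c * f x) (fun x => c * F x).
Proof.
move=> [L L0 fF]; exists (`|c| * L); first by rewrite mulr_ge0.
move=> u v au uv v1.
rewrite (_ : _ - _ = c * (F v - F u - f u * (v - u))); last by ring.
by rewrite normrM -mulrA ler_wpM2l //; exact: fF.
Qed.

Lemma eq_prim f g F G : f =1 g -> F =1 G -> prim f F -> prim g G.
Proof. by move=> /funext -> /funext ->. Qed.

Lemma prim_cst c : prim (fun=> c) (fun x => c * x).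
Proof.
exists 0 => // u v _ _ _.
by rewrite (_ : _ - _ = 0) ?normr0 ?mul0r //; ring.
Qed.

Lemma prim_inv : prim (fun x => x^-1) (@ln R).
Proof.
exists (a ^+ 2)^-1 => [|u v au uv v1]; first by rewrite invr_ge0 exprn_ge0 // ltW.
have u0 : 0 < u by exact: lt_le_trans au.
have v0 : 0 < v by exact: lt_le_trans uv.
have h1 : ln v - ln u <= (v - u) / u.
  rewrite -ln_div ?posrE // (_ : v / u = 1 + (v - u) / u); last by field; rewrite gt_eqF.
  apply: le_ln1Dx; apply: (@lt_le_trans _ _ 0); first by rewrite ltrN10.
  by rewrite divr_ge0 ?subr_ge0 // ltW.
have h2 : ln u - ln v <= (u - v) / v.
  rewrite -ln_div ?posrE // (_ : u / v = 1 + (u - v) / v); last by field; rewrite gt_eqF.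
  by apply: le_ln1Dx; rewrite ltr_pdivlMr //; lra.
have h3 : (v - u) / u + (u - v) / v = (v - u) ^+ 2 / (u * v) by field; rewrite !gt_eqF.
have h4 : (v - u) ^+ 2 / (u * v) <= (a ^+ 2)^-1 * (v - u) ^+ 2.
  rewrite mulrC ler_wpM2r ?sqr_ge0 // lef_pV2 ?posrE ?mulr_gt0 ?exprn_gt0 // expr2.
  by apply: ler_pM => //; [exact: ltW|exact: ltW|exact: le_trans uv].
by rewrite (mulrC u^-1) ler_norml; apply/andP; split; lra.
Qed.

Lemma prim_inv2 : prim (fun x => (x ^+ 2)^-1) (fun x => - x^-1).
Proof.
exists (a ^+ 3)^-1 => [|u v au uv v1]; first by rewrite invr_ge0 exprn_ge0 // ltW.
have u0 : 0 < u by exact: lt_le_trans au.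
have v0 : 0 < v by exact: lt_le_trans uv.
have -> : - v^-1 - - u^-1 - (u ^+ 2)^-1 * (v - u) = - ((v - u) ^+ 2 / (u ^+ 2 * v)).
  by field; rewrite !gt_eqF.
rewrite normrN ger0_norm; last by rewrite divr_ge0 ?sqr_ge0 // mulr_ge0 ?sqr_ge0 // ltW.
rewrite mulrC ler_wpM2r ?sqr_ge0 // lef_pV2 ?posrE ?mulr_gt0 ?exprn_gt0 // (exprSr a 2).
apply: ler_pM; rewrite ?sqr_ge0 ?(ltW a0) //; last exact: le_trans uv.
by rewrite lerXn2r ?nnegrE // ltW.
Qed.

Definition clip (m1 m2 x : R) : R := Num.min (Num.max x m1) m2.

(** Freezing a function outside the interval between two of its zeros [m1] and
    [m2] extends it by zero, and freezing the primitive integrates the result;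
    an end beyond [a] or [1] need not be a zero. *)
Lemma prim_clip f F m1 m2 : tame a f -> prim f F ->
  m1 <= m2 -> m1 <= 1 -> a <= m2 ->
  f m1 = 0 \/ m1 <= a -> f m2 = 0 \/ 1 <= m2 ->
  prim (f \o clip m1 m2) (F \o clip m1 m2).
Proof.
move=> [L [L0 fL _]] [M M0 fF] m12 m11 am2 z1 z2.
exists (L + M) => [|u v au uv v1]; first exact: addr_ge0.
have u1 : u <= 1 by exact: le_trans v1.
have av : a <= v by exact: le_trans uv.
rewrite /= /clip /Num.max /Num.min.
have d0 : 0 <= v - u by rewrite subr_ge0.
have sq0 := sqr_ge0 (v - u).
have bnd0 : 0 <= (L + M) * (v - u) ^+ 2 by rewrite mulr_ge0 ?addr_ge0.
case: (ltP u m1) => um1.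
  have fm1 : f m1 = 0 by case: z1 => // m1a; move: (le_lt_trans au um1); rewrite ltNge m1a.
  have am1 : a <= m1 by exact: le_trans (ltW um1).
  have mE : (if m1 < m2 then m1 else m2) = m1.
    by case: ltP => // h; apply/eqP; rewrite eq_le m12 h.
  case: (ltP v m1) => vm1.
    by rewrite mE subrr sub0r fm1 mul0r oppr0 normr0.
  rewrite mE fm1 mul0r subr0.
  have vE : m1 <= (if v < m2 then v else m2) <= v by case: (ltP v m2) => h; rewrite ?vm1 ?m12 //=.
  move: vE; set w := if v < m2 then _ else _ => /andP[m1w wv].
  have := fF m1 w am1 m1w (le_trans wv v1); rewrite fm1 mul0r subr0 => /le_trans; apply.
  apply: (@le_trans _ _ (M * (v - u) ^+ 2)); last by rewrite ler_wpM2r // lerDr.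
  by rewrite ler_wpM2l // lerXn2r ?nnegrE ?subr_ge0 //; lra.
have -> : (if v < m1 then m1 else v) = v by rewrite ltNge (le_trans um1 uv).
case: (ltP v m2) => vm2.
  rewrite (le_lt_trans uv vm2); apply: le_trans (fF _ _ au uv v1) _.
  by rewrite ler_wpM2r // lerDr.
case: (ltP u m2) => um2; last first.
  rewrite subrr sub0r normrN.
  case: z2 => [->|m21]; first by rewrite mul0r normr0.
  have -> : v = u by apply/eqP; rewrite eq_le uv andbT; apply: le_trans v1 (le_trans m21 um2).
  by rewrite subrr mulr0 normr0 expr0n mulr0.
have m21 : m2 <= 1 by exact: le_trans v1.
have h1 := fF _ _ au (ltW um2) m21.
have h2 : `|f u * (v - m2)| <= L * (v - u) ^+ 2.
  case: z2 => [fm2|m21'].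
    rewrite normrM (ger0_norm (_ : 0 <= v - m2)) ?subr_ge0 // expr2 mulrA.
    apply: ler_pM; rewrite ?subr_ge0 //; last by rewrite lerD2l lerN2 ltW.
    have := fL m2 u; rewrite m21 am2 au u1 fm2 sub0r normrN => /(_ isT isT) /le_trans; apply.
    by rewrite ler_wpM2l // ger0_norm ?subr_ge0 ?(ltW um2) // lerD2r.
  have -> : v = m2 by apply/eqP; rewrite eq_le vm2 andbT; exact: le_trans m21'.
  by rewrite subrr mulr0 normr0 mulr_ge0 // sqr_ge0.
rewrite (_ : _ - _ = (F m2 - F u - f u * (m2 - u)) - f u * (v - m2)); last by ring.
apply: le_trans (ler_normB _ _) _; rewrite mulrDl addrC; apply: lerD h2 _.
apply: le_trans h1 _.
by rewrite ler_wpM2l // lerXn2r ?nnegrE ?subr_ge0 ?(ltW um2) // lerD2r.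
Qed.

(** Comparing each term with an increment of [F] makes an error quadratic in the
    mesh; the end rows contribute boundedly. *)
Lemma row_riemann_sum f F : tame a f -> prim f F -> a <= 1 ->
  forall eps, 0 < eps -> exists J0, forall J, (J0 <= J)%N ->
  `|\sum_(row0 a J <= y < J.+1) f (y%:R / J%:R) - J%:R * (F 1 - F a)| <= eps * J%:R.
Proof.
move=> [B [B0 _ fB]] [L L0 fF] a1 eps e0.
have [J0 J00 HJ0] := nat_above ((2 * B + 2 * L) / eps).
exists J0 => J J0J.
have Jpos : (0 < J)%N by exact: leq_trans J0J.
have JR : 0 < J%:R :> R by rewrite ltr0n.
have J1 : 1 <= J%:R :> R by rewrite ler1n.
have [E|an1] := eqVneq a 1.
  rewrite big_geq; last by rewrite /row0 E mul1r ltnS truncn_ge_nat.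
  by rewrite E !subrr mulr0 subrr normr0 mulr_ge0 // ltW.
have a1' : a < 1 by rewrite lt_neqAle an1.
have rJ : (row0 a J <= J)%N.
  by rewrite /row0 truncn_lt_nat ?gtr_pMl // mulr_ge0 // ltW.
apply: (@le_trans _ _ (2 * B + 2 * L)); last first.
  move: HJ0; rewrite ler_pdivrMr // => /le_trans; apply.
  by rewrite mulrC ler_wpM2l ?(ltW e0) // ler_nat.
rewrite big_nat_recr //=.
set r := row0 a J in rJ *.
have rR : a * J%:R < r%:R by apply: row0P => //; exact: ltW.
have rR' : r%:R <= a * J%:R + 1.
  by rewrite /r /row0 -addn1 natrD lerD2r truncn_le mulr_ge0 // ltW.
pose Fy (y : nat) := F (y%:R / J%:R).
have tel : \sum_(r <= y < J) J%:R * (Fy y.+1 - Fy y) = J%:R * (F 1 - Fy r).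
  by rewrite -mulr_sumr telescope_sumr // /Fy divff ?gt_eqF.
have h1 : `|\sum_(r <= y < J) (J%:R * (Fy y.+1 - Fy y) - f (y%:R / J%:R))| <= L.
  apply: le_trans (ler_norm_sum _ _ _) _.
  apply: (@le_trans _ _ (\sum_(r <= y < J) (L / J%:R))); last first.
    rewrite sumr_const_nat -(mulr_natr (L / _)) mulrAC ler_pdivrMr // ler_wpM2l //.
    by rewrite ler_nat leq_subr.
  apply: ler_sum_nat => y /andP[ry yJ].
  have yJR : y%:R + 1 <= J%:R :> R by rewrite natr1 ler_nat.
  have ryR : r%:R <= y%:R :> R by rewrite ler_nat.
  have H1 : a <= y%:R / J%:R.
    by rewrite ler_pdivlMr //; apply: ltW; exact: lt_le_trans ryR.
  have H2 : y%:R / J%:R <= (y%:R + 1) / J%:R :> R by rewrite ler_pM2r ?invr_gt0 // lerDl.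
  have H3 : (y%:R + 1) / J%:R <= 1 :> R by rewrite ler_pdivrMr // mul1r.
  have := fF _ _ H1 H2 H3.
  have -> : (y%:R + 1) / J%:R - y%:R / J%:R = J%:R^-1 :> R by field; rewrite gt_eqF.
  move=> H.
  rewrite /Fy -(natr1 y).
  rewrite (_ : J%:R * _ - _ = J%:R * (F ((y%:R + 1) / J%:R) - F (y%:R / J%:R) -
       f (y%:R / J%:R) / J%:R)); last by field; rewrite gt_eqF.
  rewrite normrM ger0_norm //.
  have := ler_wpM2l (ltW JR) H; move=> /le_trans; apply.
  by rewrite exprVn (_ : J%:R * _ = L / J%:R) //; field; rewrite gt_eqF.
have h2 : `|J%:R * (Fy r - F a)| <= B + L.
  have rJR : r%:R <= J%:R :> R by rewrite ler_nat.
  have := fF a (r%:R / J%:R) (lexx a).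
  rewrite ler_pdivlMr // ler_pdivrMr // mul1r => /(_ (ltW rR) rJR) H.
  have dr : 0 <= r%:R / J%:R - a <= J%:R^-1.
    rewrite subr_ge0 ler_pdivlMr // (ltW rR) /= lerBlDr ler_pdivrMr //.
    by rewrite mulrDl mulVf ?gt_eqF //; lra.
  have fa : `|f a| <= B by apply: fB; rewrite lexx.
  rewrite normrM ger0_norm //.
  move: dr H; rewrite -/(Fy r); set d := r%:R / J%:R - a => /andP[d0 dJ] H.
  have h3 : `|f a * d| <= B * J%:R^-1 by rewrite normrM ler_pM // ger0_norm.
  have h4 : L * d ^+ 2 <= L * J%:R^-1.
    rewrite ler_wpM2l // expr2; apply: le_trans (dJ); rewrite ler_piMl //.
    by apply: le_trans dJ _; rewrite invf_le1.
  have : `|Fy r - F a| <= (B + L) * J%:R^-1.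
    rewrite (_ : Fy r - F a = (Fy r - F a - f a * d) + f a * d); last by ring.
    by apply: le_trans (ler_normD _ _) _; lra.
  move=> /(ler_wpM2l (ltW JR)) /le_trans; apply.
  by rewrite mulrC -mulrA mulVf ?mulr1 // gt_eqF.
have h5 : `|f (J%:R / J%:R)| <= B by apply: fB; rewrite divff ?gt_eqF // a1 lexx.
rewrite sumrB tel in h1.
move: h1 h2 h5; rewrite !ler_norml => /andP[? ?] /andP[? ?] /andP[? ?].
by apply/andP; split; lra.
Qed.

End Riemann.

(** * Angles as slopes *)

Section Angles.
Variable R : realType.
Implicit Types (t : R) (J : nat) (p q : int * int).

Lemma atan_diff (u v : R) : 0 <= u -> u <= v ->
  (v - u) / (1 + v ^+ 2) <= atan v - atan u <= v - u.
Proof.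
move=> u0; rewrite le_eqVlt => /orP[/eqP ->|uv]; first by rewrite !subrr mul0r lexx.
have der (x : R) : x \in `]u, v[ -> is_derive x (1 : R) (@atan R) (1 + x ^+ 2)^-1.
  by move=> _; exact: is_derive1_atan.
have cont : {within `[u, v], continuous (@atan R)}.
  by apply: continuous_subspaceT => x; exact: continuous_atan.
have [z /[!in_itv]/= /andP[uz zv] ->] := MVT uv der cont.
have d0 : 0 < v - u by rewrite subr_gt0.
have sq (x : R) : 0 < 1 + x ^+ 2 by rewrite ltr_pwDl // sqr_ge0.
rewrite mulrC ler_pM2r // ler_piMl ?(ltW d0) //; last first.
  by rewrite invf_le1 // lerDl sqr_ge0.
rewrite lef_pV2 ?posrE // lerD2l lerXn2r ?nnegrE ?(ltW zv) //.
- by apply: le_trans (ltW uz).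
- by apply: le_trans u0 (ltW (lt_trans uz zv)).
Qed.

(** Distance from the viewpoint to the vertical line through [p]. *)
Definition dist t J p : R := p.1%:~R + t * J%:R ^+ 2.

Definition slope t J p : R := p.2%:~R / dist t J p.

(** The cosine of the angle is [X / sqrt (X^2 + y^2)] with [X] the horizontal
    distance, which is the cosine of the arctangent of [y / X]. *)
Lemma angle_slope t J p : 0 < t * J%:R ^+ 2 -> 0 < dist t J p -> 0 <= p.2 ->
  angle (p.1%:~R, p.2%:~R) (viewpoint t J) origin = atan (slope t J p).
Proof.
rewrite /angle /viewpoint /origin /enorm /dot /=.
set c := t * J%:R ^+ 2 => c0 X0 y0.
rewrite !opprK !subr0 !add0r mulr0 addr0 -/(dist t J p); set X := dist t J p in X0 *.
rewrite -!expr2 expr0n /= addr0 sqrtr_sqr (gtr0_norm c0).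
set y := p.2%:~R.
have yR : 0 <= y by rewrite ler0z.
have s0 : 0 <= slope t J p by rewrite divr_ge0 // ltW.
have -> : X * c / (Num.sqrt (X ^+ 2 + y ^+ 2) * c) = cos (atan (slope t J p)).
  rewrite cos_atan.
  have -> : X ^+ 2 + y ^+ 2 = X ^+ 2 * (1 + slope t J p ^+ 2).
    by rewrite /slope -/X -/y; field; rewrite gt_eqF.
  rewrite sqrtrM ?sqr_ge0 // sqrtr_sqr (gtr0_norm X0).
  have : 0 < Num.sqrt (1 + slope t J p ^+ 2) by rewrite sqrtr_gt0 ltr_pwDl // sqr_ge0.
  by move: (Num.sqrt _) => z z0; field; rewrite !gt_eqF.
rewrite cosK // in_itv /=; apply/andP; split.
  by rewrite -(@atan0 R); exact: le_atan.
apply: ltW; apply: lt_trans (atan_ltpi2 _) _.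
by have := pi_gt0 R; lra.
Qed.

Lemma slope_diff t J p q : 0 < dist t J p -> 0 < dist t J q ->
  slope t J q - slope t J p =
  (q.2%:~R * dist t J p - p.2%:~R * dist t J q) / (dist t J p * dist t J q).
Proof. by move=> p0 q0; rewrite /slope; field; rewrite !gt_eqF. Qed.

Lemma lattice_dist t J p : p \in lattice_points J ->
  t * J%:R ^+ 2 - J%:R <= dist t J p <= t * J%:R ^+ 2 + J%:R.
Proof.
rewrite mem_lattice_points => /andP[/andP[h1 h2] _]; rewrite /dist.
rewrite -(ler_int R) mulrNz -pmulrn in h1; rewrite -(ler_int R) -pmulrn in h2.
by apply/andP; split; lra.
Qed.

Lemma lattice_height J p : p \in lattice_points J -> 0 <= (p.2%:~R : R) <= J%:R.
Proof.
rewrite mem_lattice_points => /andP[_ /andP[h1 h2]].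
by rewrite ler0z h1 /= -(ler_int R) -pmulrn in h2 *.
Qed.

Definition view_angle t J p : R := angle (p.1%:~R, p.2%:~R) (viewpoint t J) origin.

Section FixedJ.
Variables (t : R) (J : nat).
Hypotheses (J0 : (0 < J)%N) (cJ : J%:R < t * J%:R ^+ 2).

Let JR : 0 < J%:R :> R. Proof. by rewrite ltr0n. Qed.
Let c0 : 0 < t * J%:R ^+ 2. Proof. exact: lt_trans cJ. Qed.

Lemma dist_gt0 p : p \in lattice_points J -> 0 < dist t J p.
Proof. by move=> /(lattice_dist t) /andP[h _]; apply: lt_le_trans h; rewrite subr_gt0. Qed.

Lemma view_angleE p : p \in lattice_points J -> view_angle t J p = atan (slope t J p).
Proof.
move=> pin; apply: angle_slope => //; first exact: dist_gt0.
by move: pin; rewrite mem_lattice_points => /andP[_ /andP[]].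
Qed.

Definition max_slope : R := J%:R / (t * J%:R ^+ 2 - J%:R).

Lemma slope_itv p : p \in lattice_points J -> 0 <= slope t J p <= max_slope.
Proof.
move=> pin; have d0 := dist_gt0 pin.
have /andP[y0 yJ] := lattice_height pin; have /andP[dJ _] := lattice_dist t pin.
have cJ0 : 0 < t * J%:R ^+ 2 - J%:R by rewrite subr_gt0.
apply/andP; split; first by rewrite divr_ge0 // ltW.
apply: ler_pM => //; first by rewrite invr_ge0 ltW.
by rewrite lef_pV2.
Qed.

Lemma avg_gapE : avg_gap t J = atan max_slope / ((2 * J%:R + 1) * (J%:R + 1)).
Proof.
have pin : (- J%:Z, J%:Z) \in lattice_points J.
  by rewrite mem_lattice_points /= !lexx /=; lia.
rewrite /avg_gap /alpha /sorted_angles /numpts.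
rewrite (last_sort_max (f := view_angle t J) pin) => [|p ppin].
  rewrite view_angleE // size_lattice_points !(natrM, natrD).
  by rewrite /slope /dist /= mulrNz -pmulrn (addrC (- _)).
rewrite !view_angleE //; apply: le_atan.
have /andP[_ /le_trans] := slope_itv ppin; apply.
by rewrite /slope /dist /= mulrNz -pmulrn (addrC (- _)).
Qed.

Lemma gap_distributionE lambda : gap_distribution t J lambda =
  (gap_count (lambda * avg_gap t J) (sorted_angles t J))%:R
    / ((2 * J%:R + 1) * (J%:R + 1)).
Proof.
rewrite /gap_distribution /gap_count /sorted_angles size_sort size_map.
by rewrite /numpts size_lattice_points !(natrM, natrD).
Qed.

End FixedJ.

(** Up to a factor tending to one, the angle between two lattice points is
    their cross product seen from the viewpoint over [(t J^2)^2]; measured in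
    average gaps, a cross product of [k * J] is worth [2 * k / t]. *)
Lemma small_cross_small_angle t lambda k : 0 < t -> 0 < lambda ->
  0 <= k -> k < lambda * t / 2 ->
  exists J0, forall J, (J0 <= J)%N -> forall p q,
  p \in lattice_points J -> q \in lattice_points J ->
  0 < q.2%:~R * dist t J p - p.2%:~R * dist t J q <= k * J%:R ->
  0 < view_angle t J q - view_angle t J p < lambda * avg_gap t J.
Proof.
move=> t0 l0 k0 kl.
have [J1 J10 H1] := nat_above (2 / t + 1).
have [J2 J20 H2] := nat_above ((4 * k + 24 * k / t ^+ 2 + lambda) / (lambda * t - 2 * k) + 1).
exists (maxn J1 J2) => J; rewrite geq_max => /andP[JJ1 JJ2] p q pin qin /andP[D0 Dk].
have J0 : (0 < J)%N by exact: leq_trans JJ1.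
have JR : 0 < J%:R :> R by rewrite ltr0n.
have J1R : 1 <= J%:R :> R by rewrite ler1n.
have {}H1 : 2 / t < J%:R.
  by have : J1%:R <= J%:R :> R; [rewrite ler_nat|lra].
have {}H2 : (4 * k + 24 * k / t ^+ 2 + lambda) / (lambda * t - 2 * k) < J%:R.
  by have : J2%:R <= J%:R :> R; [rewrite ler_nat|lra].
rewrite ltr_pdivrMr // in H1; rewrite ltr_pdivrMr ?subr_gt0 in H2; last by lra.
have cJ : J%:R < t * J%:R ^+ 2 by rewrite expr2 mulrA ltr_pMl //; lra.
have c2 : t * J%:R ^+ 2 / 2 <= t * J%:R ^+ 2 - J%:R.
  have : 2 * J%:R <= t * J%:R ^+ 2 by rewrite expr2 mulrA ler_pM2r // mulrC ltW.
  lra.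
have p0 := dist_gt0 cJ pin; have q0 := dist_gt0 cJ qin.
have /andP[sp0 spm] := slope_itv cJ pin; have /andP[sq0 sqm] := slope_itv cJ qin.
have sd := slope_diff p0 q0.
have sd0 : slope t J p < slope t J q.
  by rewrite -subr_gt0 sd divr_gt0 ?mulr_gt0.
rewrite !view_angleE // subr_gt0 lt_atan //=.
have /andP[_ h] := atan_diff sp0 (ltW sd0); apply: le_lt_trans h _.
rewrite avg_gapE //.
have cJ0 : 0 < t * J%:R ^+ 2 - J%:R by rewrite subr_gt0.
have m0 : 0 <= max_slope t J by rewrite divr_ge0 // ltW.
have /andP[h _] := atan_diff (lexx 0) m0; rewrite atan0 !subr0 in h.
set m := max_slope t J in m0 h.
have N0 : 0 < (2 * J%:R + 1) * (J%:R + 1) :> R by rewrite mulr_gt0 // addr_gt0 // mulr_gt0.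
apply: (@lt_le_trans _ _ (lambda * (m / (1 + m ^+ 2) / ((2 * J%:R + 1) * (J%:R + 1))))); last first.
  by rewrite ler_wpM2l ?(ltW l0) // ler_wpM2r // invr_ge0 ltW.
set c := t * J%:R ^+ 2 - J%:R in c2 cJ0.
have s2 : slope t J q - slope t J p <= k * J%:R / c ^+ 2.
  rewrite sd; apply: ler_pM => //; rewrite ?(ltW D0) ?invr_ge0 ?mulr_ge0 ?(ltW p0) ?(ltW q0) //.
  rewrite lef_pV2 ?posrE ?mulr_gt0 ?exprn_gt0 // expr2; apply: ler_pM; rewrite ?(ltW cJ0) //.
    by have /andP[] := lattice_dist t pin.
  by have /andP[] := lattice_dist t qin.
apply: le_lt_trans s2 _.
have mE : m = J%:R / c by [].
have m2 : m ^+ 2 * J%:R ^+ 2 <= 4 / t ^+ 2.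
  rewrite mE ler_pdivlMr ?exprn_gt0 //.
  have -> : (J%:R / c) ^+ 2 * J%:R ^+ 2 * t ^+ 2 = 4 * ((t * J%:R ^+ 2 / 2) / c) ^+ 2.
    by field; rewrite gt_eqF.
  rewrite ler_piMr // expr_le1 // ?divr_ge0 ?mulr_ge0 ?(ltW t0) ?(ltW cJ0) ?exprn_ge0 //.
  by rewrite ler_pdivrMr // mul1r.
have q1 : 0 < 1 + m ^+ 2 by rewrite ltr_pwDl // sqr_ge0.
have -> : lambda * (m / (1 + m ^+ 2) / ((2 * J%:R + 1) * (J%:R + 1))) =
   (lambda * c * J%:R / c ^+ 2) / ((1 + m ^+ 2) * ((2 * J%:R + 1) * (J%:R + 1))).
  by rewrite [X in X / (1 + _)]mE; field; rewrite !gt_eqF // addr_gt0 // mulr_gt0.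
rewrite ltr_pdivlMr ?mulr_gt0 // mulrAC ltr_pM2r ?invr_gt0 ?exprn_gt0 //.
rewrite mulrAC ltr_pM2r //.
have key : k * ((1 + m ^+ 2) * ((2 * J%:R + 1) * (J%:R + 1))) <=
    2 * k * J%:R ^+ 2 + (4 * k + 24 * k / t ^+ 2) * J%:R.
  have e1 : (2 * J%:R + 1) * (J%:R + 1) <= 2 * J%:R ^+ 2 + 4 * J%:R :> R.
    by rewrite expr2; lra.
  have e2 : (2 * J%:R + 1) * (J%:R + 1) <= 6 * J%:R ^+ 2 :> R by nra.
  have e3 : m ^+ 2 * ((2 * J%:R + 1) * (J%:R + 1)) <= 24 / t ^+ 2 * J%:R.
    apply: (@le_trans _ _ (m ^+ 2 * (6 * J%:R ^+ 2))).
      by rewrite ler_wpM2l // sqr_ge0.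
    apply: (@le_trans _ _ (24 / t ^+ 2)); first by lra.
    by rewrite ler_peMr // divr_ge0 // exprn_ge0 // ltW.
  have e4 := ler_wpM2l k0 (lerD e1 e3).
  by rewrite (mulrDl 1) mul1r; apply: le_trans e4 _; lra.
apply: le_lt_trans key _; rewrite /c.
by rewrite -(ltr_pM2r JR) in H2; rewrite expr2; lra.
Qed.

(** The converse, again with slack in [k]. *)
Lemma small_angle_small_cross t lambda k : 0 < t -> 0 < lambda -> lambda * t / 2 < k ->
  exists J0, forall J, (J0 <= J)%N -> forall p q,
  p \in lattice_points J -> q \in lattice_points J ->
  view_angle t J p <= view_angle t J q ->
  view_angle t J q - view_angle t J p < lambda * avg_gap t J ->
  0 <= q.2%:~R * dist t J p - p.2%:~R * dist t J q < k * J%:R.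
Proof.
move=> t0 l0 kl.
have kpos : 0 < k by apply: lt_trans kl; rewrite divr_gt0 // mulr_gt0.
have g0 : 0 < (2 * k - lambda * t) * t by rewrite mulr_gt0 // subr_gt0; lra.
have [J1 J10 H1] := nat_above (2 / t + 1).
have [J2 J20 H2] := nat_above ((2 * lambda * t + 2 * k + 17 * lambda) / ((2 * k - lambda * t) * t)).
exists (maxn J1 J2) => J; rewrite geq_max => /andP[JJ1 JJ2] p q pin qin le_pq small.
have J0 : (0 < J)%N by exact: leq_trans JJ1.
have JR : 0 < J%:R :> R by rewrite ltr0n.
have J1R : 1 <= J%:R :> R by rewrite ler1n.
have {}H1 : 2 / t < J%:R.
  by have : J1%:R <= J%:R :> R; [rewrite ler_nat|lra].
have {}H2 : (2 * lambda * t + 2 * k + 17 * lambda) / ((2 * k - lambda * t) * t) <= J%:R.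
  by apply: le_trans H2 _; rewrite ler_nat.
rewrite ltr_pdivrMr // in H1; rewrite ler_pdivrMr // in H2.
have cJ : J%:R < t * J%:R ^+ 2 by rewrite expr2 mulrA ltr_pMl //; lra.
have J2tJ : 2 * J%:R <= t * J%:R ^+ 2 by rewrite expr2 mulrA ler_pM2r // mulrC ltW.
have p0 := dist_gt0 cJ pin; have q0 := dist_gt0 cJ qin.
have /andP[sp0 spm] := slope_itv cJ pin; have /andP[sq0 sqm] := slope_itv cJ qin.
have sd := slope_diff p0 q0.
rewrite !view_angleE // in le_pq small.
have sd0 : slope t J p <= slope t J q.
  by rewrite leNgt; apply/negP => /lt_atan; rewrite ltNge le_pq.
have cJ0 : 0 < t * J%:R ^+ 2 - J%:R by rewrite subr_gt0.
have m0 : 0 <= max_slope t J by rewrite divr_ge0 // ltW.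
have /andP[h1 _] := atan_diff sp0 sd0.
have /andP[_ h2] := atan_diff (lexx 0) m0; rewrite atan0 !subr0 in h2.
rewrite avg_gapE // in small.
have N0 : 0 < (2 * J%:R + 1) * (J%:R + 1) :> R by rewrite mulr_gt0 // addr_gt0 // mulr_gt0.
set m := max_slope t J in sqm m0 h2 small.
have m1 : 0 < 1 + m ^+ 2 by rewrite ltr_pwDl // sqr_ge0.
set X := dist t J p in p0 sd *; set Y := dist t J q in q0 sd *.
set D := q.2%:~R * X - _ in sd *.
have DE : D = (slope t J q - slope t J p) * (X * Y).
  by rewrite sd divfK // mulf_neq0 // gt_eqF.
set s := slope t J q - slope t J p in sd0 h1 sd DE.
have s0 : 0 <= s by rewrite subr_ge0.
have sB : s < (1 + m ^+ 2) * (lambda * (m / (2 * J%:R ^+ 2))).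
  rewrite -ltr_pdivrMl // mulrC; apply: le_lt_trans (_ : _ <= s / (1 + slope t J q ^+ 2)) _.
    rewrite ler_wpM2l // lef_pV2 ?posrE // ?lerD2l ?lerXn2r ?nnegrE //.
    by rewrite ltr_pwDl // sqr_ge0.
  apply: le_lt_trans h1 _; apply: lt_le_trans small _.
  rewrite ler_wpM2l ?(ltW l0) //; apply: ler_pM => //.
  - by rewrite -(@atan0 R); exact: le_atan.
  - rewrite lef_pV2 ?posrE ?mulr_gt0 ?exprn_gt0 // expr2; lra.
rewrite DE; apply/andP; split; first by rewrite !mulr_ge0 // ltW.
set d := t * J%:R ^+ 2 + J%:R.
have d0 : 0 < d by rewrite addr_gt0 // (lt_trans JR).
have XYd : X * Y <= d ^+ 2.
  rewrite expr2; apply: ler_pM; rewrite ?(ltW p0) ?(ltW q0) //.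
    by have /andP[] := lattice_dist t pin.
  by have /andP[] := lattice_dist t qin.
apply: le_lt_trans (ler_wpM2l s0 XYd) _.
rewrite -(ltr_pM2r (exprn_gt0 2 d0)) in sB; apply: lt_le_trans sB _.
set c := t * J%:R ^+ 2 - J%:R in cJ0.
have mE : m = J%:R / c by [].
have md : m ^+ 2 * d ^+ 2 <= 16 * J%:R ^+ 2.
  rewrite mE; have -> : (J%:R / c) ^+ 2 * d ^+ 2 = (d / c) ^+ 2 * J%:R ^+ 2.
    by field; rewrite gt_eqF.
  rewrite ler_wpM2r ?sqr_ge0 //.
  have dc : d / c <= 4 by rewrite ler_pdivrMr // /d /c; lra.
  have dc0 : 0 <= d / c by rewrite divr_ge0 // ltW.
  by rewrite expr2; nra.
rewrite [X in _ * (lambda * (X / _))]mE.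
have -> : (1 + m ^+ 2) * (lambda * (J%:R / c / (2 * J%:R ^+ 2))) * d ^+ 2 =
    lambda * (d ^+ 2 + m ^+ 2 * d ^+ 2) / (2 * J%:R * c).
  by field; rewrite !gt_eqF.
rewrite ler_pdivrMr ?mulr_gt0 //.
apply: (@le_trans _ _ (lambda * (d ^+ 2 + 16 * J%:R ^+ 2))).
  by rewrite ler_wpM2l ?(ltW l0) // lerD2l.
have := ler_wpM2l (ltW JR) H2 => H3.
have H4 : lambda * 17 <= lambda * 17 * J%:R by rewrite ler_peMr // mulr_ge0 // ltW.
have -> : k * J%:R * (2 * J%:R * c) = J%:R ^+ 2 * (2 * k * c) by ring.
have -> : lambda * (d ^+ 2 + 16 * J%:R ^+ 2) =
    J%:R ^+ 2 * (lambda * ((t * J%:R + 1) ^+ 2 + 16)) by rewrite /d; ring.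
rewrite ler_wpM2l ?sqr_ge0 // /c !expr2; lra.
Qed.

End Angles.

(** * The limiting set of isolated points *)

Section Ideal.
Variable R : realType.
Implicit Types xi v w g : R.

(** Limiting conditions for a point of relative abscissa [xi], whose inverse
    slope [u] has fractional part [v], to be blocked by the row one step up, one
    step down, two steps up and two steps down. The second factor of each spells
    out [frac (k u) < g] in terms of [v], up to the end points. *)
Definition blockedp1 xi w g v := (xi < 1 - w) && (v < g).
Definition blockedm1 xi w g v := (w - 1 <= xi) && (1 - g <= v).
Definition blockedp2 xi w g v :=
  (xi < 1 - 2 * w) && ((v < g / 2) || (1 / 2 <= v) && (v < (1 + g) / 2)).
Definition blockedm2 xi w g v :=
  (2 * w - 1 <= xi) && ((1 - g) / 2 <= v) && (v < 1 / 2) ||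
  (2 * w - 1 <= xi) && (1 - g / 2 <= v).

Definition blocked xi w g v :=
  [|| blockedp1 xi w g v, blockedm1 xi w g v, blockedp2 xi w g v | blockedm2 xi w g v].

(** The signed indicator of a box, in the form taken by [cell] below. *)
Definition box xi v (xi1 xi2 b1 b2 : R) : R :=
  ((xi < xi2)%R%:R - (xi < xi1)%R%:R) * ((v < b2)%R%:R - (v < b1)%R%:R).

(** Inclusion-exclusion over the four blocking rows, as a truth table: the
    [z]'s compare the abscissa with the ends of the zones, the [v]'s compare
    the fractional part with the ends of the windows. *)
Let boxes_truth_table (zp2 zp1 zm1 zm2 vg2 vg vh2 vh v1g vg' vg2' : bool) :
  zp2 ==> zp1 -> zp2 ==> zm1 -> zm1 ==> zm2 -> zp1 ==> zm2 ->
  vg2 ==> vg -> vh2 ==> vh -> vh2 ==> v1g -> vh ==> vg' -> vg ==> vg' ->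
  v1g ==> vg2' -> vh ==> vg2' -> vg2 ==> vh -> vg' ==> (v1g || vg || ~~ vh) ->
  ((~~ [|| zp1 && vg, ~~ zm1 && ~~ v1g, zp2 && (vg2 || ~~ vh && vg')
       | (~~ zm2 && ~~ vh2) && vh || ~~ zm2 && ~~ vg2'])%:R : int) =
  1 - zp1%:R * vg%:R - (1 - zm1%:R) * (1 - v1g%:R)
    + (~~ zm1 && zp1)%:R * ((v1g || vg)%:R - v1g%:R)
    - zp2%:R * (vg'%:R - (vg || vh)%:R) - (1 - zm2%:R) * ((vh && v1g)%:R - vh2%:R).
Proof.
by case: zp2; case: zp1; case: zm1; case: zm2 => //= _ _ _ _;
  case: vg2; case: vg => //; case: vh2; case: vh => //; case: v1g => //;
  case: vg' => //; case: vg2'.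
Qed.

Lemma unblocked_boxes xi w g v : -1 <= xi < 1 -> 0 <= v < 1 -> 0 <= g <= 1 -> 2 / 3 < w ->
  (~~ blocked xi w g v)%:R =
  1 - box xi v (-1) (Num.max (-1) (1 - w)) 0 g
    - box xi v (Num.min 1 (w - 1)) 1 (1 - g) 1
    + box xi v (- Num.max 0 (1 - w)) (Num.max 0 (1 - w)) (1 - g) (Num.max (1 - g) g)
    - box xi v (-1) (Num.max (-1) (1 - 2 * w)) (Num.max g (1 / 2)) ((1 + g) / 2)
    - box xi v (Num.min 1 (2 * w - 1)) 1 ((1 - g) / 2) (Num.min (1 / 2) (1 - g)).
Proof.
move=> /andP[xi0 xi1] /andP[v0 v1] /andP[g0 g1] w23.
have xm : (xi < -1) = false by apply/negbTE; rewrite -leNgt.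
have vm : (v < 0) = false by apply/negbTE; rewrite -leNgt.
have emid : (xi < Num.max 0 (1 - w))%R%:R - (xi < - Num.max 0 (1 - w))%R%:R =
    (~~ (xi < w - 1) && (xi < 1 - w))%:R :> R.
  rewrite /Num.max; case: (ltP 0 (1 - w)) => hw.
    by rewrite opprB; case: (ltP xi (w - 1)); case: (ltP xi (1 - w)) => //= *; lra.
  by rewrite oppr0 subrr; case: (ltP xi (w - 1)); case: (ltP xi (1 - w)) => //= *; lra.
rewrite /box emid !lt_max !lt_min xm vm xi1 v1 /= !subr0.
rewrite /blocked /blockedp1 /blockedm1 /blockedp2 /blockedm2 !leNgt.
have i1 : (v < g / 2) ==> (v < g) by apply/implyP => *; lra.
have i2 : (v < (1 - g) / 2) ==> (v < 1 / 2) by apply/implyP => *; lra.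
have i3 : (v < (1 - g) / 2) ==> (v < 1 - g) by apply/implyP => *; lra.
have i4 : (v < 1 / 2) ==> (v < (1 + g) / 2) by apply/implyP => *; lra.
have i5 : (v < g) ==> (v < (1 + g) / 2) by apply/implyP => *; lra.
have i6 : (v < 1 - g) ==> (v < 1 - g / 2) by apply/implyP => *; lra.
have i7 : (v < 1 / 2) ==> (v < 1 - g / 2) by apply/implyP => *; lra.
have i8 : (v < g / 2) ==> (v < 1 / 2) by apply/implyP => *; lra.
have i9 : (v < (1 + g) / 2) ==> ((v < 1 - g) || (v < g) || ~~ (v < 1 / 2)).
  by apply/implyP => *; case: (ltP v (1-g)) => //; case: (ltP v g) => //= *; rewrite -leNgt; lra.
have z1 : (xi < 1 - 2 * w) ==> (xi < 1 - w) by apply/implyP => *; lra.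
have z2 : (xi < 1 - 2 * w) ==> (xi < w - 1) by apply/implyP => *; lra.
have z3 : (xi < w - 1) ==> (xi < 2 * w - 1) by apply/implyP => *; lra.
have z4 : (xi < 1 - w) ==> (xi < 2 * w - 1) by apply/implyP => *; lra.
have /(congr1 (fun z : int => z%:~R : R)) := boxes_truth_table z1 z2 z3 z4 i1 i2 i3 i4 i5 i6 i7 i8 i9.
by rewrite !(rmorphB, rmorphD, rmorphM, rmorph_nat, rmorph1).
Qed.

End Ideal.

(** * Blocking in the lattice *)

Section LatticePoints.
Variables (R : realType) (t : R).
Implicit Types (J i y : nat).

Definition pt J i y : int * int := (i%:Z - J%:Z, y%:Z).

Definition relx J i : R := (i%:R - J%:R) / J%:R.

Lemma pt_lattice J i y : (i <= 2 * J)%N -> (y <= J)%N -> pt J i y \in lattice_points J.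
Proof.
move=> iJ yJ; rewrite mem_lattice_points /=; lia.
Qed.

Lemma dist_pt J i y : dist t J (pt J i y) = i%:R + (t * J%:R ^+ 2 - J%:R).
Proof. by rewrite /dist /= rmorphB /=; lra. Qed.

Lemma relx_itv J i : (0 < J)%N -> (i <= 2 * J)%N -> -1 <= relx J i <= 1.
Proof.
move=> J0 iJ; have JR : 0 < J%:R :> R by rewrite ltr0n.
have : i%:R <= 2 * J%:R :> R by rewrite -natrM ler_nat.
by have := ler0n R i; rewrite /relx ler_pdivlMr // ler_pdivrMr // => *; apply/andP; split; lra.
Qed.

Lemma cross_pt J i y (q : int * int) : (0 < y)%N ->
  (q.2%:~R : R) * dist t J (pt J i y) - y%:R * dist t J q =
  y%:R * ((q.2 - y%:Z)%:~R * phase t J y i - (q.1 - (pt J i y).1)%:~R).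
Proof.
move=> y0; have yR : 0 < y%:R :> R by rewrite ltr0n.
rewrite dist_pt /phase /dist /= !rmorphB /=.
by field; rewrite gt_eqF.
Qed.

End LatticePoints.

Section Blocking.
Variables (R : realType) (t lambda : R).
Hypotheses (ht : 2 / 3 < t) (l0 : 0 < lambda).
Implicit Types (J i y : nat) (k : int) (e : R).

Let t0 : 0 < t. Proof. by apply: lt_trans ht; rewrite divr_gt0. Qed.
Let a : R := lambda * t / 2.
Let a0 : 0 < a. Proof. by rewrite divr_gt0 // mulr_gt0. Qed.

(** Moving [k] rows up along the ray through a point moves it sideways by
    [k] times its inverse slope. *)
Let shift_bound J i y k : (0 < J)%N -> (i <= 2 * J)%N -> a * J%:R < y%:R ->
  `|(i%:R - J%:R + k%:~R * phase t J y i)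
    - J%:R * (relx R J i + k%:~R * (t / (y%:R / J%:R)))| <= `|k%:~R| / a.
Proof.
move=> J0 iJ aJy; have JR : 0 < J%:R :> R by rewrite ltr0n.
have yR : 0 < y%:R :> R by apply: le_lt_trans aJy; rewrite mulr_ge0 // ltW.
rewrite (_ : _ - _ = k%:~R * (relx R J i * (J%:R / y%:R))); last first.
  by rewrite /phase /relx; field; rewrite !gt_eqF.
rewrite normrM ler_wpM2l //.
have /andP[? ?] := relx_itv R J0 iJ.
have Jy : 0 <= J%:R / y%:R :> R by rewrite divr_ge0.
rewrite normrM (ger0_norm Jy); apply: (@le_trans _ _ (J%:R / y%:R)).
  by rewrite ler_piMl // ler_norml; apply/andP; split; lra.
by rewrite ler_pdivrMr // mulrC ler_pdivlMr // mulrC ltW.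
Qed.

(** The witness lies [k] rows up, at the last lattice point before the ray:
    its cross product with the given point is [y] times the fractional part. *)
Lemma blocking_row e : 0 < e -> exists J0, forall J, (J0 <= J)%N ->
  forall i y k, (i <= 2 * J)%N -> a * J%:R < y%:R -> (y + 2 <= J)%N ->
  `|k| <= 2 -> `|relx R J i + k%:~R * (t / (y%:R / J%:R))| <= 1 - e ->
  0 < frac (k%:~R * phase t J y i) <= a / (y%:R / J%:R) - e ->
  exists2 q, q \in lattice_points J &
    0 < view_angle t J q - view_angle t J (pt J i y) < lambda * avg_gap t J.
Proof.
move=> e0; (* For [e >= 1] the window [(0, a / (y / J) - e]] is empty. *)
have [e1|e1] := leP 1 e.
  exists 1%N => J J1 i y k iJ aJy yJ _ _ /andP[h1 h2].
  have JR : 0 < J%:R :> R by rewrite ltr0n.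
  have yR : 0 < y%:R :> R by apply: le_lt_trans aJy; rewrite mulr_ge0 // ltW.
  have : a / (y%:R / J%:R) < 1 by rewrite ltr_pdivrMr ?divr_gt0 // mul1r ltr_pdivlMr.
  lra.
have ka : a - a * e < lambda * t / 2 by rewrite -/a gtrBl mulr_gt0.
have ka0 : 0 <= a - a * e by rewrite subr_ge0 ler_piMr ?(ltW a0) ?(ltW e1).
have [J1 HJ1] := small_cross_small_angle t0 l0 ka0 ka.
have [J2 J20 HJ2] := nat_above ((2 / a + 1) / e).
have [J3 J30 HJ3] := nat_above (2 / a).
exists (maxn J1 (maxn J2 J3)) => J; rewrite !geq_max => /and3P[JJ1 JJ2 JJ3].
move=> i y k iJ aJy yJ k2 zone /andP[fr0 fr1].
have J0 : (0 < J)%N by exact: leq_trans JJ2.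
have JR : 0 < J%:R :> R by rewrite ltr0n.
have yR : 0 < y%:R :> R by apply: le_lt_trans aJy; rewrite mulr_ge0 // ltW.
have y0 : (0 < y)%N by rewrite -(ltr0n R).
have y2 : (2 <= y)%N.
  rewrite -(ler_nat R); apply: le_trans (ltW aJy); rewrite mulrC -ler_pdivrMr //.
  by apply: le_trans HJ3 _; rewrite ler_nat.
have eJ : 2 / a + 1 <= e * J%:R.
  by rewrite (mulrC e) -ler_pdivrMr //; apply: le_trans HJ2 _; rewrite ler_nat.
have kR : `|k%:~R| <= 2 :> R by rewrite -intr_norm (ler_int R _ 2).
pose u := phase t J y i.
pose q : int * int := (i%:Z - J%:Z + Num.floor (k%:~R * u), y%:Z + k).
have kE : (q.2 - y%:Z = k)%Z by rewrite /q /= addrC addKr.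
have flE : (q.1 - (pt J i y).1 = Num.floor (k%:~R * u))%Z by rewrite /q /= addrC addKr.
have qin : q \in lattice_points J.
  have sh := shift_bound k J0 iJ aJy.
  have ka2 : `|k%:~R| / a <= 2 / a by rewrite ler_wpM2r // invr_ge0 ltW.
  have zJ : `|J%:R * (relx R J i + k%:~R * (t / (y%:R / J%:R)))| <= J%:R * (1 - e).
    by rewrite normrM ger0_norm // ler_wpM2l.
  have /andP[f0 f1] := frac_itv (k%:~R * u).
  rewrite /frac /flr in f0 f1.
  have : `|i%:R - J%:R + k%:~R * u| <= J%:R - 1.
    rewrite -/u in sh; move: sh zJ; set A := i%:R - J%:R + k%:~R * u.
    set B := J%:R * (relx R J i + _) => sh zJ.
    rewrite -(subrK B A); apply: le_trans (ler_normD _ _) _.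
    apply: le_trans (lerD sh zJ) _.
    by clear -ht l0 t0 a0 ka2 eJ; lra.
  rewrite ler_norml => /andP[g1 g2].
  rewrite mem_lattice_points /= -!(ler_int R) !(intrD, mulrNz) -!pmulrn.
  apply/andP; split; first by clear -ht l0 t0 a0 f0 f1 g1 g2; apply/andP; split; lra.
  move: kR; rewrite ler_norml => /andP[p1 p2].
  have p3 : y%:R + 2 <= J%:R :> R by rewrite -natrD ler_nat.
  have p4 : 2 <= y%:R :> R by rewrite ler_nat.
  by clear -ht l0 t0 a0 p1 p2 p3 p4; apply/andP; split; lra.
have yJ' : (y <= J)%N by rewrite (leq_trans _ yJ) // leq_addr.
have pin := pt_lattice iJ yJ'.
exists q; first exact: qin.
apply: (HJ1 J JJ1 _ q pin qin).
rewrite -pmulrn cross_pt // kE flE -/u.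
rewrite -/(flr _) -/(frac _) mulr_gt0 //=.
apply: (@le_trans _ _ (y%:R * (a / (y%:R / J%:R) - e))); first by rewrite ler_pM2l.
rewrite mulrBr (_ : y%:R * (a / _) = a * J%:R); last by field; rewrite !gt_eqF.
rewrite mulrBl lerD2l lerN2 mulrAC ler_pM2r //; exact: ltW.
Qed.

(** Conversely, a point close behind has cross product below [y], so its
    abscissa is forced by its row; the rectangle is [2 J] wide and a step of one
    row moves sideways by at least about [t J > 2 J / 3], which leaves at most
    two rows on either side. *)
Lemma blocked_row e : 0 < e -> exists J0, forall J, (J0 <= J)%N ->
  forall i y q, (i <= 2 * J)%N -> a * (1 + e) * J%:R <= y%:R -> (y <= J)%N ->
  q \in lattice_points J -> q != pt J i y ->
  view_angle t J (pt J i y) <= view_angle t J q ->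
  view_angle t J q - view_angle t J (pt J i y) < lambda * avg_gap t J ->
  exists k : int, [/\ k \in [:: 1; -1; 2; -2],
    `|relx R J i + k%:~R * (t / (y%:R / J%:R))| <= 1 + e &
    frac (k%:~R * phase t J y i) < a / (y%:R / J%:R) + e].
Proof.
move=> e0.
have ka : lambda * t / 2 < a * (1 + e) by rewrite -/a mulrDr mulr1 ltrDl mulr_gt0.
have [J1 HJ1] := small_angle_small_cross t0 l0 ka.
have [J2 J20 HJ2] := nat_above ((1 + 2 / a) / e).
have [J3 J30 HJ3] := nat_above (4 / (3 * t - 2) + 1).
have [J4 J40 HJ4] := nat_above (1 / t + 1).
exists (maxn J1 (maxn J2 (maxn J3 J4))) => J; rewrite !geq_max => /and4P[JJ1 JJ2 JJ3 JJ4].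
move=> i y q iJ aJy yJ qin qp le_pq small.
have J0 : (0 < J)%N by exact: leq_trans JJ2.
have JR : 0 < J%:R :> R by rewrite ltr0n.
have J1R : 1 <= J%:R :> R by rewrite ler1n.
have aJy' : a * J%:R < y%:R.
  by apply: lt_le_trans aJy; rewrite mulrDr mulr1 mulrDl ltrDl !mulr_gt0.
have yR : 0 < y%:R :> R by apply: le_lt_trans aJy'; rewrite mulr_ge0 // ltW.
have y0 : (0 < y)%N by rewrite -(ltr0n R).
have eJ : 1 + 2 / a <= e * J%:R.
  by rewrite (mulrC e) -ler_pdivrMr //; apply: le_trans HJ2 _; rewrite ler_nat.
have tJ3 : 4 < (3 * t - 2) * J%:R.
  have : 4 / (3 * t - 2) < J%:R.
    by have : J3%:R <= J%:R :> R; [rewrite ler_nat|lra].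
  have t3 : 0 < 3 * t - 2 by move: ht; lra.
  by rewrite ltr_pdivrMr // mulrC.
have tJ1 : 1 < t * J%:R.
  have : 1 / t < J%:R by have : J4%:R <= J%:R :> R; [rewrite ler_nat|lra].
  by rewrite ltr_pdivrMr // mulrC.
have := HJ1 J JJ1 _ q (pt_lattice iJ yJ) qin le_pq small.
rewrite -pmulrn cross_pt //.
set k := q.2 - y%:Z; set h := q.1 - (pt J i y).1; set u := phase t J y i.
move=> /andP[r0 r1].
rewrite pmulr_rge0 // in r0.
have r1' : k%:~R * u - h%:~R < a / (y%:R / J%:R) * (1 + e).
  have -> : a / (y%:R / J%:R) * (1 + e) = a * (1 + e) * J%:R / y%:R.
    by field; rewrite !gt_eqF.
  by rewrite ltr_pdivlMr // mulrC.
have g1 : a / (y%:R / J%:R) * (1 + e) <= 1.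
  have -> : a / (y%:R / J%:R) * (1 + e) = a * (1 + e) * J%:R / y%:R.
    by field; rewrite !gt_eqF.
  by rewrite ler_pdivrMr // mul1r.
have g0 : 0 <= a / (y%:R / J%:R) by apply: divr_ge0; [exact: ltW|exact: divr_ge0].
have hE : Num.floor (k%:~R * u) = h.
  by apply: floor_def; rewrite intrD; clear -ht l0 t0 a0 r0 r1' g1; apply/andP; split; lra.
have frE : frac (k%:~R * u) = k%:~R * u - h%:~R by rewrite /frac /flr hE.
have k0 : k != 0.
  apply/eqP => k0.
  have h0 : h = 0 by rewrite -hE k0 mul0r floor0.
  move/negP: qp; apply; rewrite -pair_eqE /=; apply/andP; split.
    by rewrite -subr_eq0; apply/eqP; exact: h0.
  by rewrite -subr_eq0; apply/eqP; exact: k0.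
have q1J : `|i%:R - J%:R + h%:~R| <= J%:R :> R.
  have := lattice_dist t qin; rewrite /dist => /andP[q1 q2].
  have -> : i%:R - J%:R + h%:~R = q.1%:~R :> R by rewrite /h /= !(intrD, mulrNz) -!pmulrn; ring.
  by rewrite ler_norml; clear -ht l0 t0 a0 q1 q2; apply/andP; split; lra.
have kuJ : `|i%:R - J%:R + k%:~R * u| <= J%:R + 1.
  by move: q1J; rewrite !ler_norml; clear -ht l0 t0 a0 r0 r1' g1 => /andP[? ?]; apply/andP; split; lra.
have u_ge : t * J%:R - 1 <= u.
  rewrite /u /phase ler_pdivlMr //.
  have yJR : y%:R <= J%:R :> R by rewrite ler_nat.
  apply: (@le_trans _ _ ((t * J%:R - 1) * J%:R)).
    by rewrite ler_wpM2l //; clear -ht l0 t0 a0 tJ1; lra.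
  by have := ler0n R i; rewrite expr2; lra.
have k3 : `|k%:~R| < 3 :> R.
  have iJR : i%:R <= 2 * J%:R :> R by rewrite -natrM ler_nat.
  have i0 := ler0n R i.
  have ku : `|k%:~R| * u <= 2 * J%:R + 1.
    have u0 : 0 <= u by apply: le_trans u_ge; clear -ht l0 t0 a0 tJ1; lra.
    rewrite -{1}(ger0_norm u0) -normrM ler_norml.
    by move: kuJ; rewrite ler_norml; clear -ht l0 t0 a0 iJR i0 => /andP[? ?]; apply/andP; split; lra.
  rewrite ltNge; apply/negP => k3.
  have : 3 * (t * J%:R - 1) <= `|k%:~R| * u by apply: ler_pM => //; clear -ht l0 t0 a0 tJ1; lra.
  by move=> /le_trans/(_ ku); clear -ht l0 t0 a0 tJ3; lra.
rewrite -intr_norm (ltr_int R _ 3) in k3.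
have kin : k \in [:: 1; -1; 2; -2] by rewrite !inE; clear -ht l0 t0 a0 k0 k3; lia.
exists k; rewrite frE; split; first exact: kin.
  have sh := shift_bound k J0 iJ aJy'.
  have kR : `|k%:~R| <= 2 :> R.
    by rewrite -intr_norm (ler_int R _ 2); clear -ht l0 t0 a0 k3; lia.
  have ka2 : `|k%:~R| / a <= 2 / a by rewrite ler_wpM2r // invr_ge0 ltW.
  rewrite -(ler_pM2l JR) -{1}(ger0_norm (ltW JR)) -normrM.
  rewrite -/u in sh; move: sh kuJ; set A := i%:R - J%:R + k%:~R * u.
  set B := J%:R * (relx R J i + _) => sh kuJ.
  rewrite distrC in sh.
  rewrite -(subrK A B); apply: le_trans (ler_normD _ _) _.
  apply: le_trans (lerD sh kuJ) _.
  by clear -ht l0 t0 a0 ka2 eJ; lra.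
apply: lt_le_trans r1' _.
rewrite mulrDr mulr1 lerD2l ler_piMl ?(ltW e0) //.
have : 1 <= 1 + e by lra.
by move=> /(ler_wpM2l g0) h1; clear -ht l0 t0 a0 h1 g1; lra.
Qed.

End Blocking.

(** * Points away from the ends of zones and windows *)

Section Generic.
Variable R : realType.
Implicit Types (xi v w g e u : R) (k : int).

(** The values of the relative abscissa and of the fractional part at which one
    of the comparisons in [blocked] changes its outcome. *)
Definition zone_ends w : seq R := [:: 1 - w; w - 1; 1 - 2 * w; 2 * w - 1].

Definition window_ends g : seq R :=
  [:: 0; 1 / 2; 1; g; 1 - g; g / 2; 1 - g / 2; (1 + g) / 2; (1 - g) / 2].

Lemma frac_eq u (z : int) (f : R) : u = z%:~R + f -> 0 <= f < 1 -> frac u = f.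
Proof. by move=> -> f01; rewrite addrC fracDz frac_small. Qed.

Lemma far_cases (x E e : R) : e < `|x - E| -> x < E - e \/ E + e < x.
Proof. by rewrite lter_normr => /orP[] h; [right|left]; lra. Qed.

Section Multiples.
Variable u : R.
Let v := frac u.
Let uE : u = flr u + v. Proof. by rewrite /v /frac; ring. Qed.
Let v_ge0 : 0 <= v. Proof. by have /andP[] := frac_itv u. Qed.
Let v_lt1 : v < 1. Proof. by have /andP[] := frac_itv u. Qed.

Lemma frac_m1 : 0 < v -> frac (- u) = 1 - v.
Proof.
move=> v0; apply: (@frac_eq _ (- Num.floor u - 1)); last first.
  by have := v_ge0; have := v_lt1; move=> *; apply/andP; split; lra.
by rewrite intrD !mulrNz {1}uE /flr; ring.
Qed.

Lemma frac_p2_low : v < 1 / 2 -> frac (2 * u) = 2 * v.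
Proof.
move=> v2; apply: (@frac_eq _ (2 * Num.floor u)); last first.
  by have := v_ge0; have := v_lt1; move=> *; apply/andP; split; lra.
by rewrite intrM {1}uE /flr; ring.
Qed.

Lemma frac_p2_high : 1 / 2 <= v -> frac (2 * u) = 2 * v - 1.
Proof.
move=> v2; apply: (@frac_eq _ (2 * Num.floor u + 1)); last first.
  by have := v_ge0; have := v_lt1; move=> *; apply/andP; split; lra.
by rewrite intrD intrM {1}uE /flr; ring.
Qed.

Lemma frac_m2_low : 0 < v -> v < 1 / 2 -> frac (- 2 * u) = 1 - 2 * v.
Proof.
move=> v0 v2; apply: (@frac_eq _ (- (2 * Num.floor u) - 1)); last first.
  by have := v_ge0; have := v_lt1; move=> *; apply/andP; split; lra.
by rewrite intrD !mulrNz intrM {1}uE /flr; ring.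
Qed.

Lemma frac_m2_high : 1 / 2 < v -> frac (- 2 * u) = 2 - 2 * v.
Proof.
move=> v2; apply: (@frac_eq _ (- (2 * Num.floor u) - 2)); last first.
  by have := v_ge0; have := v_lt1; move=> *; apply/andP; split; lra.
by rewrite intrD !mulrNz intrM {1}uE /flr; ring.
Qed.

End Multiples.

(* Every absolute value left in the context slows linear arithmetic down. *)
Ltac near_lra :=
  repeat match goal with h : is_true (_ < `|_|)%R |- _ => clear h end; lra.
Ltac far H := case: (far_cases H) => ?; near_lra.

(** Away from all ends, strict and weak comparisons agree and leave a margin,
    so that blocking is insensitive to errors of size [e]. *)
Lemma blocked_margin xi w g u e : 0 < e <= 1 / 6 -> 2 / 3 < w -> g <= 1 ->
  -1 <= xi <= 1 ->
  all (fun E => e < `|xi - E|) (zone_ends w) ->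
  all (fun E => e < `|frac u - E|) (window_ends g) ->
  blocked xi w g (frac u) ->
  exists k, [/\ `|k| <= 2, `|xi + k%:~R * w| <= 1 - e & 0 < frac (k%:~R * u) <= g - e].
Proof.
move=> /andP[e0 e6] w23 g1 /andP[xi0 xi1] /and5P[z1 z2 z3 z4 _].
move=> /and5P[w1 w2 w3 w4].
move=> /and5P[w5 w6 w7 w8].
move=> /andP[w9 _].
have /andP[v0 v1] := frac_itv u.
have v0' : 0 < frac u by far w1.
rewrite /blocked => /or4P[/andP[h1 h2]|/andP[h1 h2]|/andP[h1 /orP[h2|/andP[h2 h3]]]|].
- exists 1; rewrite !mul1r; split=> //; [rewrite ler_norml|].
  + by apply/andP; split; far z1.
  + by apply/andP; split; far w4.
- exists (-1); rewrite !mulrNz !mulNr !mul1r frac_m1 //; split=> //; [rewrite ler_norml|].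
  + by apply/andP; split; far z2.
  + by apply/andP; split; far w5.
- have v2 : frac u < 1 / 2 by near_lra.
  exists 2; rewrite frac_p2_low //; split=> //; [rewrite ler_norml|].
  + by apply/andP; split; far z3.
  + by apply/andP; split; far w6.
- exists 2; rewrite frac_p2_high //; split=> //; [rewrite ler_norml|].
  + by apply/andP; split; far z3.
  + by apply/andP; split; [far w2|far w8].
- move=> /orP[/andP[/andP[h1 h2] h3]|/andP[h1 h2]].
  + exists (-2); rewrite !mulrNz frac_m2_low //; split=> //; [rewrite ler_norml|].
    * by apply/andP; split; far z4.
    * by apply/andP; split; [near_lra|far w9].
  + have v2 : 1 / 2 < frac u by far w2.
    exists (-2); rewrite !mulrNz frac_m2_high //; split=> //; [rewrite ler_norml|].
    * by apply/andP; split; far z4.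
    * by apply/andP; split; [near_lra|far w7].
Qed.

Lemma margin_blocked xi w g u e k : 0 < e <= 1 / 6 -> 
  all (fun E => e < `|xi - E|) (zone_ends w) ->
  all (fun E => e < `|frac u - E|) (window_ends g) ->
  k \in [:: 1; -1; 2; -2] -> `|xi + k%:~R * w| <= 1 + e -> frac (k%:~R * u) < g + e ->
  blocked xi w g (frac u).
Proof.
move=> /andP[e0 e6] /and5P[z1 z2 z3 z4 _].
move=> /and5P[w1 w2 w3 w4].
move=> /and5P[w5 w6 w7 w8].
move=> /andP[w9 _].
have /andP[v0 v1] := frac_itv u.
have v0' : 0 < frac u by far w1.
rewrite !inE => /or4P[] /eqP ->.
- rewrite !mul1r ler_norml => /andP[h1 h2] h3; apply/or4P; apply: Or41.
  by apply/andP; split; [far z1|far w4].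
- rewrite !mulrNz !mulNr !mul1r frac_m1 // ler_norml => /andP[h1 h2] h3.
  apply/or4P; apply: Or42.
  by apply/andP; split; [far z2|far w5].
- rewrite ler_norml => /andP[h1 h2]; have [v2|v2] := ltP (frac u) (1 / 2).
    rewrite frac_p2_low // => h3; apply/or4P; apply: Or43.
    by apply/andP; split; [far z3|apply/orP; left; far w6].
  rewrite frac_p2_high // => h3; apply/or4P; apply: Or43.
  apply/andP; split; [far z3|apply/orP; right].
  by rewrite v2 /=; far w8.
- rewrite !mulrNz ler_norml => /andP[h1 h2]; have [v2|v2] := ltP (frac u) (1 / 2).
    rewrite frac_m2_low // => h3; apply/or4P; apply: Or44; apply/orP; left.
    by rewrite v2 andbT; apply/andP; split; [far z4|far w9].
  have v2' : 1 / 2 < frac u by far w2.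
  rewrite frac_m2_high // => h3; apply/or4P; apply: Or44; apply/orP; right.
  by apply/andP; split; [far z4|far w7].
Qed.

End Generic.

(** * Exceptional points *)

Section Exceptional.
Variables (R : realType) (t lambda : R).
Hypotheses (ht : 2 / 3 < t) (l0 : 0 < lambda).
Implicit Types (J i y : nat) (e : R).

Let t0 : 0 < t. Proof. by apply: lt_trans ht; rewrite divr_gt0. Qed.
Let a : R := lambda * t / 2.
Let a0 : 0 < a. Proof. by rewrite divr_gt0 // mulr_gt0. Qed.

(** The points whose isolation may differ from the limiting prediction: those
    near the top, near height [a * J], in the last column, or within [e] of an
    end of a zone or window. *)
Definition exceptional e J y i : bool :=
  [|| (J < y + 2)%N, y%:R < a * (1 + e) * J%:R, i == (2 * J)%N,
      has (fun E => `|relx R J i - E| <= e) (zone_ends (t / (y%:R / J%:R)))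
    | has (fun E => `|frac (phase t J y i) - E| <= e) (window_ends (a / (y%:R / J%:R)))].

(** The upper bound for gaps forgives ties and the lower bound does not, see
    [gap_count_le] and [gap_count_ge]. *)
Definition weakly_isolated J (p : int * int) : bool :=
  all (fun q => (view_angle t J p < view_angle t J q) ==>
    (lambda * avg_gap t J <= view_angle t J q - view_angle t J p)) (lattice_points J).

Definition strictly_isolated J (p : int * int) : bool :=
  all (fun q => (q != p) && (view_angle t J p <= view_angle t J q) ==>
    (lambda * avg_gap t J <= view_angle t J q - view_angle t J p)) (lattice_points J).

Lemma strictly_weakly_isolated J p : strictly_isolated J p -> weakly_isolated J p.
Proof.
move=> /allP H; apply/allP => q qin; apply/implyP => pq.
have /implyP := H q qin; apply; rewrite (ltW pq) andbT.
by apply: contraTneq pq => ->; rewrite ltxx.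
Qed.

Lemma isolatedE e : 0 < e <= 1 / 6 -> exists J0, forall J, (J0 <= J)%N ->
  forall i y, (i <= 2 * J)%N -> a * J%:R < y%:R -> (y <= J)%N -> ~~ exceptional e J y i ->
  let b := ~~ blocked (relx R J i) (t / (y%:R / J%:R)) (a / (y%:R / J%:R))
             (frac (phase t J y i)) in
  weakly_isolated J (pt J i y) = b /\ strictly_isolated J (pt J i y) = b.
Proof.
move=> e6; have /andP[e0 _] := e6.
have [J1 H1] := blocking_row ht l0 e0.
have [J2 H2] := blocked_row ht l0 e0.
exists (maxn J1 (maxn J2 1)) => J; rewrite !geq_max => /and3P[JJ1 JJ2 J0] i y iJ aJy yJ.
rewrite /exceptional 4!negb_or -leqNgt -leNgt.
move=> /and5P[yJ2 aeJy _ /hasPn zones /hasPn windows].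
have JR : 0 < J%:R :> R by rewrite ltr0n.
have yR : 0 < y%:R :> R by apply: le_lt_trans aJy; rewrite mulr_ge0 // ltW.
have eta0 : 0 < y%:R / J%:R :> R by rewrite divr_gt0.
have eta1 : y%:R / J%:R <= 1 :> R by rewrite ler_pdivrMr // mul1r ler_nat.
have w23 : 2 / 3 < t / (y%:R / J%:R).
  by rewrite ltr_pdivlMr //; apply: le_lt_trans ht; rewrite ler_piMr.
have g1 : a / (y%:R / J%:R) <= 1.
  by rewrite ler_pdivrMr // mul1r ler_pdivlMr // ltW.
have xi1 := relx_itv R J0 iJ.
have zones' : all (fun E => e < `|relx R J i - E|) (zone_ends (t / (y%:R / J%:R))).
  by apply/allP => E /zones; rewrite -ltNge.
have windows' : all (fun E => e < `|frac (phase t J y i) - E|) (window_ends (a / (y%:R / J%:R))).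
  by apply/allP => E /windows; rewrite -ltNge.
case: (boolP (blocked _ _ _ _)) => [hb|nb] /=.
  have [k [k2 zk fk]] := blocked_margin e6 w23 g1 xi1 zones' windows' hb.
  have [q qin /andP[q0 q1]] := H1 J JJ1 i y k iJ aJy yJ2 k2 zk fk.
  have W : weakly_isolated J (pt J i y) = false.
    apply/negbTE/negP => /allP /(_ q qin) /implyP.
    by rewrite -subr_gt0 => /(_ q0); rewrite leNgt q1.
  split=> //; apply/negbTE/negP => /strictly_weakly_isolated.
  by rewrite W.
have S : strictly_isolated J (pt J i y).
  apply/allP => q qin; apply/implyP => /andP[qp pq]; rewrite leNgt; apply/negP => small.
  have [k [kin zk fk]] := H2 J JJ2 i y q iJ aeJy yJ qin qp pq small.
  by move/negP: nb; apply; exact: margin_blocked e6 zones' windows' kin zk fk.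
by split; [exact: strictly_weakly_isolated|].
Qed.

(** Indices in a zone of relative width [2 e] differ by at most [2 e J]. *)
Lemma count_zone J m (E e : R) : (0 < J)%N -> 0 <= e ->
  \sum_(0 <= i < m) (`|relx R J i - E| <= e)%R%:R <= 2 * e * J%:R + 1 :> R.
Proof.
move=> J0 e0; have JR : 0 < J%:R :> R by rewrite ltr0n.
have D0 : 0 <= 2 * e * J%:R by rewrite !mulr_ge0.
apply: le_trans (count_close_points R (d := Num.truncn (2 * e * J%:R)) _) _; last first.
  by rewrite -addn1 natrD lerD2r truncn_le.
move=> i i' _ ii' _; rewrite !ler_norml => /andP[h1 _] /andP[_ h2].
rewrite truncn_ge_nat // natrB // -ler_pdivrMr //.
have -> : (i'%:R - i%:R) / J%:R = relx R J i' - relx R J i.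
  by rewrite /relx; field; rewrite gt_eqF.
lra.
Qed.

(** The window is enlarged to the half-open interval from [E - e] to
    [E + 2 * e], on which a difference of floors is at least one; [bern_lip]
    then bounds the oscillation by the length of the interval. *)
Lemma count_window m (y : nat) (beta E e : R) : (0 < y)%N -> 0 < e ->
  \sum_(0 <= i < m) (`|frac ((i%:R + beta) / y%:R) - E| <= e)%R%:R
    <= 3 * e * m%:R + 6 * e * y%:R + m%:R / y%:R + 1 :> R.
Proof.
move=> y0 e0; have yR : 0 < y%:R :> R by rewrite ltr0n.
pose beta' := beta - (E - e) * y%:R.
have E1 (i : nat) : (i%:R + beta') / y%:R = (i%:R + beta) / y%:R - (E - e).
  by rewrite /beta'; field; rewrite gt_eqF.
have e30 : 0 <= 3 * e by rewrite mulr_ge0 // ltW.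
have H := sum_flr_window m beta' yR e30.
set S := \sum_(0 <= i < m) _ in H; set B := _ - _ - _ + _ in H.
apply: (@le_trans _ _ S).
  apply: ler_sum_nat => i _; rewrite E1; set U := (i%:R + beta) / y%:R.
  case: ler_normlP => [[h1 h2]|_] /=; last first.
    by rewrite subr_ge0; apply: le_flr; lra.
  move: h1 h2; rewrite /frac => h1 h2.
  have l1 : flr U <= flr (U - (E - e)).
    rewrite -[leLHS](_ : flr (flr U) = _); last by rewrite /flr intrKfloor.
    by apply: le_flr; lra.
  have l2 : flr (U - (E - e) - 3 * e) <= flr U - 1.
    rewrite /flr -(mulr1z 1) -mulrzBr ler_int -ltzD1 subrK -(ltr_int R).
    apply: le_lt_trans (floor_le _) _; rewrite -/(flr U).
    lra.
  lra.
have Bb : y%:R * B <= 6 * e * y%:R.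
  rewrite mulrC ler_pM2r // /B.
  have lip (z : R) : `|bern z - bern (z - 3 * e)| <= 3 * e.
    by apply: le_trans (bern_lip _ _) _; rewrite opprB addrC subrK ger0_norm.
  have := lip ((m%:R + beta') / y%:R); have := lip (beta' / y%:R).
  by rewrite !ler_norml => /andP[? ?] /andP[? ?]; lra.
move: H; rewrite ler_norml => /andP[_ H]; lra.
Qed.

Let sum_has (I : Type) (s : seq I) (P : I -> nat -> bool) (m : nat) (c : R) :
  (forall E, \sum_(0 <= i < m) (P E i)%:R <= c) ->
  \sum_(0 <= i < m) (has (P^~ i) s)%:R <= (size s)%:R * c.
Proof.
move=> H; apply: (@le_trans _ _ (\sum_(E <- s) \sum_(0 <= i < m) (P E i)%:R)).
  rewrite exchange_big /=; apply: ler_sum => i _.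
  elim: s => [|E s IH] /=; first by rewrite big_nil.
  rewrite big_cons; case: (P E i) => /=; last by rewrite add0r.
  by rewrite lerDl sumr_ge0.
apply: (@le_trans _ _ (\sum_(E <- s) c)); first exact: ler_sum.
by rewrite big_const_seq count_predT iter_addr_0 mulr_natl.
Qed.

Let exceptional_row e J y : 0 < e -> a * J%:R < y%:R -> (y <= J)%N ->
  \sum_(0 <= i < 2 * J + 1) (exceptional e J y i)%:R <=
  3 * J%:R * ((J < y + 2)%N%:R + (y%:R < a * (1 + e) * J%:R)%R%:R)
  + (14 + 27 / a + 143 * e * J%:R).
Proof.
move=> e0 aJy yJ.
have yR : 0 < y%:R :> R by apply: le_lt_trans aJy; rewrite mulr_ge0 // ltW.
have y0 : (0 < y)%N by rewrite -(ltr0n R).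
have J0 : (0 < J)%N by exact: leq_trans yJ.
have JR : 1 <= J%:R :> R by rewrite ler1n.
set w := t / (y%:R / J%:R); set g := a / (y%:R / J%:R).
pose P1 E i := `|relx R J i - E| <= e.
pose P2 E i := `|frac (phase t J y i) - E| <= e.
set b1 := (J < y + 2)%N; set b2 := (y%:R < a * (1 + e) * J%:R)%R.
apply: (@le_trans _ _ (\sum_(0 <= i < 2 * J + 1)
    ((b1%:R + b2%:R) + (i == (2 * J)%N)%:R + (has (P1^~ i) (zone_ends w))%:R
      + (has (P2^~ i) (window_ends g))%:R))).
  apply: ler_sum_nat => i _; rewrite /exceptional -/b1 -/b2 -/w -/g.
  rewrite -![has (fun E => _) _]/(has (P1^~ i) _) -/(has (P2^~ i) _).
  by case: b1; case: b2; case: (i == _); case: (has (P1^~ i) _); case: (has (P2^~ i) _);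
    rewrite //=; lra.
rewrite !big_split /=.
have h1 := sum_has (zone_ends w) (fun E => count_zone (2 * J + 1) E J0 (ltW e0)).
have h2 := sum_has (window_ends g)
  (fun E => count_window (2 * J + 1) (t * J%:R ^+ 2 - J%:R) E y0 e0).
have h3 : \sum_(0 <= i < 2 * J + 1) (i == (2 * J)%N)%:R <= 1 :> R.
  rewrite addn1 big_nat_recr //= eqxx big_nat_cond big1 ?add0r // => i.
  by rewrite andbT => /andP[_ iJ]; rewrite ltn_eqF.
have h4 : \sum_(0 <= i < 2 * J + 1) b1%:R + \sum_(0 <= i < 2 * J + 1) b2%:R
    <= 3 * J%:R * (b1%:R + b2%:R) :> R.
  rewrite !sumr_const_nat subn0 -!(mulr_natr (nat_of_bool _)%:R) -mulrDl mulrC.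
  by rewrite ler_wpM2r ?addr_ge0 // natrD natrM; lra.
have h5 : (2 * J + 1)%:R / y%:R <= 3 / a :> R.
  rewrite ler_pdivrMr // mulrAC ler_pdivlMr // natrD natrM.
  apply: (@le_trans _ _ (3 * (a * J%:R))).
    have J1 : 0 <= J%:R - 1 :> R by rewrite subr_ge0.
    by have := mulr_ge0 (ltW a0) J1; lra.
  by rewrite ler_pM2l //; exact: ltW.
have yJR : y%:R <= J%:R :> R by rewrite ler_nat.
have eyJ : e * y%:R <= e * J%:R by rewrite ler_pM2l.
have e1J : e <= e * J%:R by rewrite ler_peMr // ltW.
move: h1 h2 => /=; rewrite /P1 /P2 => h1 h2.
apply: le_trans (lerD (lerD (lerD h4 h3) h1) h2) _.
rewrite natrD natrM in h5 *.
have -> : 27 / a = 9 * (3 / a) by ring.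
by move: (3 / a) h5 => z h5; lra.
Qed.

Lemma exceptional_sum e J : 0 < e -> (0 < J)%N ->
  \sum_(row0 a J <= y < J.+1) \sum_(0 <= i < 2 * J + 1) (exceptional e J y i)%:R
  <= (3 * a + 143) * e * J%:R ^+ 2 + (23 + 27 / a) * J%:R.
Proof.
move=> e0 J0; have JR : 0 < J%:R :> R by rewrite ltr0n.
have aJ y : (row0 a J <= y)%N -> a * J%:R < y%:R by apply: row0P; exact: ltW.
apply: (@le_trans _ _ (\sum_(row0 a J <= y < J.+1)
  (3 * J%:R * ((J < y + 2)%N%:R + (y%:R < a * (1 + e) * J%:R)%R%:R)
  + (14 + 27 / a + 143 * e * J%:R)))).
  apply: ler_sum_nat => y /andP[ry yJ]; apply: exceptional_row => //; exact: aJ.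
rewrite big_split /= -mulr_sumr big_split /=.
have h1 : \sum_(row0 a J <= y < J.+1) (J < y + 2)%N%:R <= 2 :> R.
  apply: le_trans (count_close_points R (d := 1) _) _ => //.
  by move=> y y' _ _; lia.
have h2 : \sum_(row0 a J <= y < J.+1) (y%:R < a * (1 + e) * J%:R)%R%:R <= a * e * J%:R + 1.
  have D0 : 0 <= a * e * J%:R by rewrite !mulr_ge0 // ltW.
  apply: le_trans (count_close_points R (d := Num.truncn (a * e * J%:R)) _) _; last first.
    by rewrite -addn1 natrD lerD2r truncn_le.
  move=> y y' /aJ h yy' _ _ h'; rewrite truncn_ge_nat // natrB //.
  by move: h'; rewrite mulrDr mulr1 mulrDl; lra.
have c0 : 0 <= 14 + 27 / a + 143 * e * J%:R.
  by rewrite !addr_ge0 ?divr_ge0 ?mulr_ge0 // ltW.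
have h3 : \sum_(row0 a J <= y < J.+1) (14 + 27 / a + 143 * e * J%:R)
    <= J%:R * (14 + 27 / a + 143 * e * J%:R).
  rewrite sumr_const_nat -(mulr_natl (_ + _)) ler_wpM2r // ler_nat.
  by rewrite /row0 subSS leq_subr.
have J30 : 0 <= 3 * J%:R :> R by rewrite mulr_ge0.
apply: le_trans (lerD (ler_wpM2l J30 (lerD h1 h2)) h3) _.
by rewrite expr2; lra.
Qed.

End Exceptional.

(** * Counting gaps *)

Section Assembly.
Variables (R : realType) (t lambda : R).
Hypotheses (ht : 2 / 3 < t) (l0 : 0 < lambda).
Implicit Types (J i y : nat) (e : R).

Let t0 : 0 < t. Proof. by apply: lt_trans ht; rewrite divr_gt0. Qed.
Let a : R := lambda * t / 2.
Let a0 : 0 < a. Proof. by rewrite divr_gt0 // mulr_gt0. Qed.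

Lemma count_lattice J (P : pred (int * int)) :
  (count P (lattice_points J))%:R =
  \sum_(0 <= y < J.+1) \sum_(0 <= i < 2 * J + 1) (P (pt J i y))%:R :> R.
Proof.
rewrite -sum1_count big_mkcond /= /lattice_points big_allpairs_dep exchange_big /=.
rewrite natr_sum addn1 /index_iota subn0; apply: eq_bigr => y _.
by rewrite natr_sum subn0; apply: eq_bigr => i _; rewrite /pt; case: (P _).
Qed.

(** Below height [a * J] the left neighbour in the same row already hides a
    point. *)
Lemma low_rows_sum e : 0 < e -> e < 1 -> exists J0, forall J, (J0 <= J)%N ->
  \sum_(0 <= y < minn (row0 a J) J.+1) \sum_(0 <= i < 2 * J + 1)
     (weakly_isolated t lambda J (pt J i y))%:R <= 3 * a * e * J%:R ^+ 2 + 8 * J%:R.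
Proof.
move=> e0 e1.
have ka : a * (1 - e) < lambda * t / 2 by rewrite -/a mulrBr mulr1 gtrBl mulr_gt0.
have ka0 : 0 <= a * (1 - e) by rewrite mulr_ge0 ?(ltW a0) // subr_ge0 ltW.
have [J1 H1] := small_cross_small_angle t0 l0 ka0 ka.
have [J2 J20 H2] := nat_above (1 / t + 1).
exists (maxn J1 J2) => J; rewrite geq_max => /andP[JJ1 JJ2].
have J0 : (0 < J)%N by exact: leq_trans JJ2.
have JR : 0 < J%:R :> R by rewrite ltr0n.
have J1R : 1 <= J%:R :> R by rewrite ler1n.
have b1 (b : bool) : b%:R <= 1 :> R by case: b.
have row_bound y i : (y < minn (row0 a J) J.+1)%N -> (i < 2 * J + 1)%N ->
    (weakly_isolated t lambda J (pt J i y))%:R <=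
    (y == 0)%N%:R + (i == 0)%N%:R + (a * (1 - e) * J%:R < y%:R)%R%:R :> R.
  rewrite leq_min => /andP[_ yJ] iJ.
  have [->|y0] := posnP y; first by apply: le_trans (b1 _) _; rewrite -addrA lerDl addr_ge0.
  have [->|i0] := posnP i.
    by apply: le_trans (b1 _) _; rewrite addrAC lerDr addr_ge0.
  case: ltP => [_|low]; first by apply: le_trans (b1 _) _; rewrite lerDr addr_ge0.
  have yJ' : (y <= J)%N by [].
  have iJ' : (i <= 2 * J)%N by move: (iJ); rewrite addn1 ltnS.
  have pin := pt_lattice iJ' yJ'.
  have qin := pt_lattice (leq_trans (leq_pred i) iJ') yJ'.
  have cross : 0 < ((pt J i.-1 y).2%:~R : R) * dist t J (pt J i y)
      - (pt J i y).2%:~R * dist t J (pt J i.-1 y) <= a * (1 - e) * J%:R.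
    rewrite !dist_pt /= -pmulrn.
    have -> : i%:R = i.-1%:R + 1 :> R by rewrite natr1 prednK.
    rewrite (_ : _ - _ = y%:R); last by ring.
    by rewrite ltr0n y0.
  have /andP[v0 v1] := H1 J JJ1 _ _ pin qin cross.
  rewrite (_ : weakly_isolated _ _ _ _ = false).
    by rewrite !addr_ge0.
  apply/negbTE/negP => /allP /(_ _ qin) /implyP.
  by rewrite -subr_gt0 => /(_ v0); rewrite leNgt v1.
set r := minn (row0 a J) J.+1 in row_bound *.
have rJ : (r <= J.+1)%N by rewrite geq_minr.
apply: (@le_trans _ _ (\sum_(0 <= y < r) \sum_(0 <= i < 2 * J + 1)
  ((y == 0)%N%:R + (i == 0)%N%:R + (a * (1 - e) * J%:R < y%:R)%R%:R))).
  by apply: ler_sum_nat => y /andP[_ yr]; apply: ler_sum_nat => i /andP[_ iJ]; exact: row_bound.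
have one (m : nat) : \sum_(0 <= i < m) (i == 0)%N%:R <= 1 :> R.
  case: m => [|m]; first by rewrite big_geq.
  by rewrite big_nat_recl //= big1 ?addr0.
apply: (@le_trans _ _ (\sum_(0 <= y < r) ((2 * J + 1)%:R *
   ((y == 0)%N%:R + (a * (1 - e) * J%:R < y%:R)%R%:R) + 1))).
  apply: ler_sum_nat => y _; rewrite !big_split /= !sumr_const_nat subn0.
  rewrite -!(mulr_natl (nat_of_bool _)%:R).
  by have := one (2 * J + 1)%N; lra.
rewrite big_split /= -mulr_sumr big_split /=.
have h1 := one r.
have h2 : \sum_(0 <= y < r) (a * (1 - e) * J%:R < y%:R)%R%:R <= a * e * J%:R + 1.
  have D0 : 0 <= a * e * J%:R by rewrite !mulr_ge0 // ltW.
  apply: le_trans (count_close_points R (d := Num.truncn (a * e * J%:R)) _) _; last first.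
    by rewrite -addn1 natrD lerD2r truncn_le.
  move=> y y' _ yy'; rewrite /r leq_min => /andP[y'r _] h _.
  rewrite truncn_ge_nat // natrB //.
  have : y'%:R <= a * J%:R.
    by move: y'r; rewrite /row0 ltnS truncn_ge_nat // mulr_ge0 // ltW.
  by move: h; rewrite mulrBr mulr1 mulrBl; lra.
have h3 : \sum_(0 <= y < r) 1 <= J%:R + 1 :> R.
  by rewrite sumr_const_nat subn0 -(mulr_natl 1) mulr1 natr1 ler_nat.
have h4 : (2 * J + 1)%:R <= 3 * J%:R :> R by rewrite natrD natrM; lra.
have s1 : 0 <= \sum_(0 <= y < r) (y == 0)%N%:R + \sum_(0 <= y < r) (a * (1 - e) * J%:R < y%:R)%R%:R :> R.
  by rewrite addr_ge0 // sumr_ge0.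
have J3 : 0 <= 3 * J%:R :> R by rewrite mulr_ge0.
have h5 := ler_pM (ler0n _ _) s1 h4 (lerD h1 h2).
apply: le_trans (lerD h5 h3) _.
by rewrite expr2; lra.
Qed.

Let w (x : R) := t / x.
Let g (x : R) := a / x.

(** The asymptotic number of isolated points in the row at relative height [x],
    in units of [J]: the length [2] of the row, corrected by the areas of the
    five boxes of [unblocked_boxes]. *)
Definition isolated_density (x : R) : R :=
  2 - (Num.max (-1) (1 - w x) - -1) * (g x - 0)
    - (1 - Num.min 1 (w x - 1)) * (1 - (1 - g x))
    + (Num.max 0 (1 - w x) - - Num.max 0 (1 - w x)) * (Num.max (1 - g x) (g x) - (1 - g x))
    - (Num.max (-1) (1 - 2 * w x) - -1) * ((1 + g x) / 2 - Num.max (g x) (1 / 2))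
    - (1 - Num.min 1 (2 * w x - 1)) * (Num.min (1 / 2) (1 - g x) - (1 - g x) / 2).

Let tw : tame a w.
Proof. by apply: tameM; [exact: tame_cst|exact: tame_inv]. Qed.

Let tg : tame a g.
Proof. by apply: tameM; [exact: tame_cst|exact: tame_inv]. Qed.

Let w_pos x : a <= x <= 1 -> 2 / 3 < w x.
Proof.
move=> /andP[ax x1]; have x0 : 0 < x by exact: lt_le_trans ax.
by rewrite /w ltr_pdivlMr //; apply: le_lt_trans ht; rewrite ler_piMr.
Qed.

Let g01 x : a <= x <= 1 -> 0 <= g x <= 1.
Proof.
move=> /andP[ax x1]; have x0 : 0 < x by exact: lt_le_trans ax.
by rewrite /g divr_ge0 ?(ltW a0) ?(ltW x0) //= ler_pdivrMr // mul1r.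
Qed.

(** The boxes of [unblocked_boxes] as cells of the lattice. *)
Definition row_approx J y i : R :=
  let x := y%:R / J%:R in
  1 - cell t J y (-1) (Num.max (-1) (1 - w x)) 0 (g x) i
    - cell t J y (Num.min 1 (w x - 1)) 1 (1 - g x) 1 i
    + cell t J y (- Num.max 0 (1 - w x)) (Num.max 0 (1 - w x)) (1 - g x) (Num.max (1 - g x) (g x)) i
    - cell t J y (-1) (Num.max (-1) (1 - 2 * w x)) (Num.max (g x) (1 / 2)) ((1 + g x) / 2) i
    - cell t J y (Num.min 1 (2 * w x - 1)) 1 ((1 - g x) / 2) (Num.min (1 / 2) (1 - g x)) i.

Lemma left_ofE J (xi : R) i : (0 < J)%N -> left_of J xi i = (relx R J i < xi).
Proof.
move=> J0; have JR : 0 < J%:R :> R by rewrite ltr0n.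
by rewrite /left_of /relx ltr_pdivrMr // ltrBlDr mulrDr mulr1 addrC (mulrC xi).
Qed.

Lemma row_approxE J y i : (0 < J)%N -> (i < 2 * J)%N -> a * J%:R < y%:R -> (y <= J)%N ->
  row_approx J y i =
  (~~ blocked (relx R J i) (w (y%:R / J%:R)) (g (y%:R / J%:R)) (frac (phase t J y i)))%:R.
Proof.
move=> J0 iJ aJy yJ; have JR : 0 < J%:R :> R by rewrite ltr0n.
have eta : a <= (y%:R / J%:R : R) <= 1.
  by rewrite ler_pdivlMr // ler_pdivrMr // mul1r ler_nat yJ ltW.
rewrite unblocked_boxes ?frac_itv ?g01 ?w_pos //.
  by rewrite /row_approx /cell /box !left_ofE.
have /andP[-> _] /= := relx_itv R J0 (ltnW iJ).
rewrite /relx ltr_pdivrMr // mul1r ltrBlDr.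
have : i%:R < 2 * J%:R :> R by rewrite -natrM ltr_nat.
lra.
Qed.

Lemma cell_bound J y (xi1 xi2 b1 b2 : R) i : `|cell t J y xi1 xi2 b1 b2 i| <= 1.
Proof.
rewrite /cell.
case: (left_of _ xi2 _); case: (left_of _ xi1 _); case: (_ < b2); case: (_ < b1);
  rewrite /= ?(subrr, subr0, sub0r, mul0r, mulr0, mulr1, mul1r, mulrN, mulNr, normrN, normr0, normr1, opprK) //.
Qed.

Lemma row_approx_bound J y i : `|row_approx J y i| <= 6.
Proof.
rewrite /row_approx.
have := cell_bound J y; move=> B.
set c1 := cell _ _ _ _ _ _ _ _; set c2 := cell _ _ _ _ _ _ _ _.
set c3 := cell _ _ _ _ _ _ _ _; set c4 := cell _ _ _ _ _ _ _ _.
set c5 := cell _ _ _ _ _ _ _ _.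
have h1 : `|c1| <= 1 by exact: cell_bound.
have h2 : `|c2| <= 1 by exact: cell_bound.
have h3 : `|c3| <= 1 by exact: cell_bound.
have h4 : `|c4| <= 1 by exact: cell_bound.
have h5 : `|c5| <= 1 by exact: cell_bound.
move: h1 h2 h3 h4 h5; rewrite !ler_norml.
by move=> /andP[? ?] /andP[? ?] /andP[? ?] /andP[? ?] /andP[? ?]; apply/andP; split; lra.
Qed.

(** Up to exceptional points, the rows above height [a * J] consist of
    isolated points exactly where [row_approx] equals one. *)
Lemma high_rows_approx e : 0 < e <= 1 / 6 -> exists J0, forall J, (J0 <= J)%N ->
  forall P : nat -> pred (int * int), P = weakly_isolated t lambda \/
      P = strictly_isolated t lambda ->
  `|\sum_(row0 a J <= y < J.+1) \sum_(0 <= i < 2 * J + 1)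
      ((P J (pt J i y))%:R - row_approx J y i)|
  <= 7 * ((3 * a + 143) * e * J%:R ^+ 2 + (23 + 27 / a) * J%:R).
Proof.
move=> e6; have /andP[e0 _] := e6.
have [J1 H1] := isolatedE ht l0 e6.
exists (maxn J1 1) => J; rewrite geq_max => /andP[JJ1 J0] P HP.
apply: (@le_trans _ _ (7 * \sum_(row0 a J <= y < J.+1) \sum_(0 <= i < 2 * J + 1)
   (exceptional t lambda e J y i)%:R)); last first.
  by rewrite ler_pM2l //; exact: exceptional_sum.
apply: le_trans (ler_norm_sum _ _ _) _; rewrite mulr_sumr.
apply: ler_sum_nat => y /andP[ry yJ]; rewrite ltnS in yJ.
have aJy : a * J%:R < y%:R by apply: row0P => //; exact: ltW.
apply: le_trans (ler_norm_sum _ _ _) _; rewrite mulr_sumr.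
apply: ler_sum_nat => i /andP[_ iJ].
case: (boolP (exceptional _ _ _ _ _ _)) => [_|nex].
  rewrite mulr1; apply: le_trans (ler_normB _ _) _.
  have := row_approx_bound J y i.
  by case: (P J _) => /=; rewrite ?normr1 ?normr0; lra.
have iJ2 : (i < 2 * J)%N.
  move: nex; rewrite /exceptional 2!negb_or => /and3P[_ _].
  rewrite negb_or => /andP[iN _].
  by move: iJ; rewrite addn1 ltnS leq_eqVlt (negbTE iN).
have [E1 E2] := H1 J JJ1 i y (ltnW iJ2) aJy yJ nex.
rewrite row_approxE //.
by case: HP => ->; rewrite ?E1 ?E2 subrr normr0 mulr0.
Qed.

Let cB (c : R) f : tame a f -> tame a (fun x => c - f x).
Proof. by move=> tf; apply: tameB => //; exact: tame_cst. Qed.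

Let Bc (c : R) f : tame a f -> tame a (fun x => f x - c).
Proof. by move=> tf; apply: tameB => //; exact: tame_cst. Qed.

Let cM (c : R) f : tame a f -> tame a (fun x => c * f x).
Proof. by move=> tf; apply: tameM => //; exact: tame_cst. Qed.

Let Mc (c : R) f : tame a f -> tame a (fun x => f x * c).
Proof. by move=> tf; apply: tameM => //; exact: tame_cst. Qed.

Let tc (c : R) : tame a (fun=> c). Proof. exact: tame_cst. Qed.

Let x1 x := Num.max (-1) (1 - w x).
Let x2 x := Num.min 1 (w x - 1).
Let x3 x := Num.max 0 (1 - w x).
Let x4 x := Num.max (-1) (1 - 2 * w x).
Let x5 x := Num.min 1 (2 * w x - 1).
Let v3 x := Num.max (1 - g x) (g x).
Let v4 x := Num.max (g x) (1 / 2).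
Let v4' x := (1 + g x) / 2.
Let v5 x := (1 - g x) / 2.
Let v5' x := Num.min (1 / 2) (1 - g x).

Let tx1 : tame a x1. Proof. by apply: tame_max; [exact: tc|exact: cB]. Qed.
Let tx2 : tame a x2. Proof. by apply: tame_min; [exact: tc|exact: Bc]. Qed.
Let tx3 : tame a x3. Proof. by apply: tame_max; [exact: tc|exact: cB]. Qed.
Let tx3N : tame a (fun x => - x3 x). Proof. exact: tameN. Qed.
Let tx4 : tame a x4. Proof. by apply: tame_max; [exact: tc|apply: cB; exact: cM]. Qed.
Let tx5 : tame a x5. Proof. by apply: tame_min; [exact: tc|apply: Bc; exact: cM]. Qed.
Let tgc : tame a (fun x => 1 - g x). Proof. exact: cB. Qed.
Let tv3 : tame a v3. Proof. by apply: tame_max. Qed.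
Let tv4 : tame a v4. Proof. by apply: tame_max => //; exact: tc. Qed.
Let tv4' : tame a v4'. Proof. by apply: Mc; apply: tameD => //; exact: tc. Qed.
Let tv5 : tame a v5. Proof. by apply: Mc; exact: cB. Qed.
Let tv5' : tame a v5'. Proof. by apply: tame_min => //; exact: tc. Qed.

Let ends x : a <= x <= 1 ->
  [/\ -1 <= x1 x <= 1, -1 <= x2 x <= 1, -1 <= x3 x <= 1, -1 <= - x3 x <= 1
      & -1 <= x4 x <= 1 /\ -1 <= x5 x <= 1].
Proof.
move=> /w_pos; rewrite /x1 /x2 /x3 /x4 /x5 /Num.max /Num.min; move: (w x) => z z0.
by split; [| | | |split]; case: ltP => h; apply/andP; split; lra.
Qed.

Let levels x : a <= x <= 1 ->
  [/\ 0 <= 1 - g x <= 1, 0 <= v3 x <= 1, 0 <= v4 x <= 1, 0 <= v4' x <= 1 &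
     0 <= v5 x <= 1 /\ 0 <= v5' x <= 1].
Proof.
move=> /g01; rewrite /v3 /v4 /v4' /v5 /v5' /Num.max /Num.min; move: (g x) => z /andP[z0 z1].
by split; [|case: ltP => h|case: ltP => h| |split; [|case: ltP => h]];
  apply/andP; split; lra.
Qed.

Lemma row_approx_sum eps : 0 < eps -> exists J0, forall J, (J0 <= J)%N ->
  `|\sum_(row0 a J <= y < J.+1) (\sum_(0 <= i < 2 * J + 1) row_approx J y i
      - J%:R * isolated_density (y%:R / J%:R))| <= eps * J%:R ^+ 2.
Proof.
move=> e0; have e6 : 0 < eps / 6 by rewrite divr_gt0.
have m1 x : a <= x <= 1 -> -1 <= (-1 : R) <= 1 by move=> _; apply/andP; split; lra.
have p1 x : a <= x <= 1 -> -1 <= (1 : R) <= 1 by move=> _; apply/andP; split; lra.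
have z0 x : a <= x <= 1 -> 0 <= (0 : R) <= 1 by move=> _; apply/andP; split; lra.
have z1 x : a <= x <= 1 -> 0 <= (1 : R) <= 1 by move=> _; apply/andP; split; lra.
have [J1 H1] : exists J0, forall J, (J0 <= J)%N -> _ :=
  cell_sum t0 a0 (tc (-1)) tx1 (tc 0) tg m1
   (fun x h => let: And5 h1 _ _ _ _ := ends h in h1) z0 g01 e6.
have [J2 H2] : exists J0, forall J, (J0 <= J)%N -> _ :=
  cell_sum t0 a0 tx2 (tc 1) tgc (tc 1)
   (fun x h => let: And5 _ h1 _ _ _ := ends h in h1) p1
   (fun x h => let: And5 h1 _ _ _ _ := levels h in h1) z1 e6.
have [J3 H3] : exists J0, forall J, (J0 <= J)%N -> _ :=
  cell_sum t0 a0 tx3N tx3 tgc tv3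
   (fun x h => let: And5 _ _ _ h1 _ := ends h in h1)
   (fun x h => let: And5 _ _ h1 _ _ := ends h in h1)
   (fun x h => let: And5 h1 _ _ _ _ := levels h in h1)
   (fun x h => let: And5 _ h1 _ _ _ := levels h in h1) e6.
have [J4 H4] : exists J0, forall J, (J0 <= J)%N -> _ :=
  cell_sum t0 a0 (tc (-1)) tx4 tv4 tv4' m1
   (fun x h => let: And5 _ _ _ _ (conj h1 _) := ends h in h1)
   (fun x h => let: And5 _ _ h1 _ _ := levels h in h1)
   (fun x h => let: And5 _ _ _ h1 _ := levels h in h1) e6.
have [J5 H5] : exists J0, forall J, (J0 <= J)%N -> _ :=
  cell_sum t0 a0 tx5 (tc 1) tv5 tv5'
   (fun x h => let: And5 _ _ _ _ (conj _ h1) := ends h in h1) p1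
   (fun x h => let: And5 _ _ _ _ (conj h1 _) := levels h in h1)
   (fun x h => let: And5 _ _ _ _ (conj _ h1) := levels h in h1) e6.
have [J6 J60 H6] := nat_above (1 / (eps / 6)).
exists (maxn J1 (maxn J2 (maxn J3 (maxn J4 (maxn J5 J6))))) => J.
rewrite !geq_max => /andP[JJ1 /and5P[JJ2 JJ3 JJ4 JJ5 JJ6]].
move: (H1 J JJ1) (H2 J JJ2) (H3 J JJ3) (H4 J JJ4) (H5 J JJ5) => {}H1 {}H2 {}H3 {}H4 {}H5.
have J0 : (0 < J)%N by exact: leq_trans JJ6.
have JR : 0 < J%:R :> R by rewrite ltr0n.
cbv zeta in H1, H2, H3, H4, H5.
set S1 := \sum_(_ <= _ < _) _ in H1; set S2 := \sum_(_ <= _ < _) _ in H2.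
set S3 := \sum_(_ <= _ < _) _ in H3; set S4 := \sum_(_ <= _ < _) _ in H4.
set S5 := \sum_(_ <= _ < _) _ in H5.
pose S0 : R := \sum_(row0 a J <= y < J.+1) 1.
have HS0 : 0 <= S0 <= eps / 6 * J%:R ^+ 2.
  rewrite /S0 sumr_ge0 //= sumr_const_nat.
  apply: (@le_trans _ _ J%:R).
    by rewrite ler_nat /row0 subSS leq_subr.
  rewrite expr2 mulrA ler_peMl ?(ltW JR) //.
  rewrite mulrC -ler_pdivrMr //; apply: le_trans H6 _; by rewrite ler_nat.
rewrite [X in `|X|](_ : _ = S0 - S1 - S2 + S3 - S4 - S5).
  move: HS0 H1 H2 H3 H4 H5; rewrite !ler_norml.
  by move=> /andP[? ?] /andP[? ?] /andP[? ?] /andP[? ?] /andP[? ?] /andP[? ?];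
    apply/andP; split; lra.
rewrite /S0 -!sumrB -big_split -!sumrB /=; apply: eq_bigr => y _.
rewrite /row_approx /= !(sumrB, big_split) /= sumr_const_nat subn0.
rewrite natrD natrM /isolated_density -/x1 -/x2 -/x3 -/x4 -/x5.
rewrite /x1 /x2 /x3 /x4 /x5 /v3 /v4 /v4' /v5 /v5'.
ring.
Qed.

End Assembly.

Section GapAsymptotics.
Variables (R : realType) (t lambda : R).
Hypotheses (ht : 2 / 3 < t) (l0 : 0 < lambda).

Let t0 : 0 < t. Proof. by apply: lt_trans ht; rewrite divr_gt0. Qed.
Let a : R := lambda * t / 2.
Let a0 : 0 < a. Proof. by rewrite divr_gt0 // mulr_gt0. Qed.

Let avg_gap_gt0 J : (0 < J)%N -> J%:R < t * J%:R ^+ 2 -> 0 < lambda * avg_gap t J.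
Proof.
move=> J0 cJ; have JR : 0 < J%:R :> R by rewrite ltr0n.
rewrite avg_gapE // mulr_gt0 // divr_gt0 ?mulr_gt0 //.
by rewrite -(@atan0 R) lt_atan //= divr_gt0 // subr_gt0.
Qed.

(** Every gap of the required size starts at a weakly isolated point, and every
    strictly isolated point but the last one starts such a gap; both kinds of
    points have the same asymptotic count. *)
Lemma gap_count_asymptotics eps : 0 < eps -> exists J0, forall J, (J0 <= J)%N ->
  `|(gap_count (lambda * avg_gap t J) (sorted_angles t J))%:R
    - J%:R * \sum_(row0 a J <= y < J.+1) isolated_density t lambda (y%:R / J%:R)|
  <= eps * J%:R ^+ 2.
Proof.
move=> e0.
pose K := 7 * (3 * a + 143) + 3 * a.
have K0 : 0 < K by rewrite addr_gt0 ?mulr_gt0 ?addr_gt0 ?mulr_gt0.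
(* [K * e] collects the densities of exceptional points and of low rows. *)
pose e := Num.min (1 / 6) (eps / 4 / K).
have epos : 0 < e by rewrite lt_min !divr_gt0.
have e6 : 0 < e <= 1 / 6 by rewrite epos ge_min lexx.
have e1 : e < 1 by case/andP: e6; lra.
have eK : K * e <= eps / 4.
  by rewrite mulrC -ler_pdivlMr // ge_min lexx orbT.
have [J1 H1] := low_rows_sum ht l0 epos e1.
have [J2 H2] := high_rows_approx ht l0 e6.
have e4 : 0 < eps / 4 by rewrite divr_gt0.
have [J3 H3] := row_approx_sum ht l0 e4.
have [J4 J40 H4] := nat_above ((7 * (23 + 27 / a) + 9) / (eps / 4)).
have [J5 J50 H5] := nat_above (1 / t + 1).
exists (maxn J1 (maxn J2 (maxn J3 (maxn J4 J5)))) => J.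
rewrite !geq_max => /and5P[JJ1 JJ2 JJ3 JJ4 JJ5].
have {}H1 := H1 J JJ1; have {}H2 := H2 J JJ2; have {}H3 := H3 J JJ3.
rewrite -/a in H1 H2 H3.
have J0 : (0 < J)%N by exact: leq_trans JJ5.
have JR : 0 < J%:R :> R by rewrite ltr0n.
have J1R : 1 <= J%:R :> R by rewrite ler1n.
have cJ : J%:R < t * J%:R ^+ 2.
  have : 1 / t < J%:R by have : J5%:R <= J%:R :> R; [rewrite ler_nat|lra].
  by rewrite ltr_pdivrMr // => h; rewrite expr2 mulrA ltr_pMl // mulrC.
have d0 := avg_gap_gt0 J0 cJ.
have {}H4 : 7 * (23 + 27 / a) * J%:R + 9 * J%:R <= eps / 4 * J%:R ^+ 2.
  rewrite -mulrDl expr2 mulrA ler_wpM2r // (mulrC (eps / 4)) -ler_pdivrMr //.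
  by apply: le_trans H4 _; rewrite ler_nat.
have upper : ((gap_count (lambda * avg_gap t J) (sorted_angles t J))%:R : R) <=
    (count (weakly_isolated t lambda J) (lattice_points J))%:R.
  rewrite ler_nat; apply: gap_count_le => // p pin H.
  by apply/allP => q qin; apply/implyP; exact: H.
have lower : (count (strictly_isolated t lambda J) (lattice_points J))%:R <=
    ((gap_count (lambda * avg_gap t J) (sorted_angles t J))%:R + 1 : R).
  rewrite natr1 ler_nat; apply: gap_count_ge => //; first exact: uniq_lattice_points.
  move=> p /allP H pin q qin qp pq.
  by have /implyP := H q qin; apply; rewrite qp.
rewrite !count_lattice in upper lower.
have split_rows (F : nat -> R) : \sum_(0 <= y < J.+1) F y =
    \sum_(0 <= y < minn (row0 a J) J.+1) F y + \sum_(row0 a J <= y < J.+1) F y.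
  case: (leqP (row0 a J) J.+1) => rJ.
    by rewrite (@big_cat_nat _ _ _ (row0 a J)).
  by rewrite [X in _ + X]big_geq ?addr0 // ltnW.
rewrite !split_rows in upper lower.
have HW := H2 _ (or_introl erefl); have HS := H2 _ (or_intror erefl).
have lowS : 0 <= \sum_(0 <= y < minn (row0 a J) J.+1) \sum_(0 <= i < 2 * J + 1)
    (strictly_isolated t lambda J (pt J i y))%:R :> R.
  by apply: sumr_ge0 => y _; apply: sumr_ge0.
have sub_sum (P : nat -> nat -> R) (Q : nat -> nat -> R) :
  \sum_(row0 a J <= y < J.+1) \sum_(0 <= i < 2 * J + 1) (P y i - Q y i) =
  \sum_(row0 a J <= y < J.+1) \sum_(0 <= i < 2 * J + 1) P y i -
  \sum_(row0 a J <= y < J.+1) \sum_(0 <= i < 2 * J + 1) Q y i.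
  by rewrite -sumrB; apply: eq_bigr => y _; rewrite sumrB.
rewrite sub_sum in HW; rewrite sub_sum in HS; rewrite sumrB -mulr_sumr in H3.
have eKJ : K * e * J%:R ^+ 2 <= eps / 4 * J%:R ^+ 2.
  by rewrite ler_wpM2r // exprn_ge0 // ltW.
rewrite /K in eKJ.
set W1 := \sum_(0 <= y < _) _ in upper H1.
set W2 := \sum_(row0 _ _ <= y < _) _ in upper HW.
set S1 := \sum_(0 <= y < _) _ in lower lowS.
set S2 := \sum_(row0 _ _ <= y < _) _ in lower HS.
set B := \sum_(row0 _ _ <= y < _) \sum_(0 <= i < _) row_approx _ _ _ _ _ in HW HS H3.
set D := \sum_(row0 _ _ <= y < _) isolated_density _ _ _ in H3 *.
move: HW HS H3; rewrite !ler_norml => /andP[w1 w2] /andP[s1 s2] /andP[b1 b2].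
move: upper lower; set G := (gap_count _ _)%:R => upper lower.
have eJ2 : 0 <= eps * J%:R ^+ 2 by rewrite mulr_ge0 ?exprn_ge0 // ltW.
have aeJ2 : 0 <= a * e * J%:R ^+ 2 by rewrite !mulr_ge0 ?exprn_ge0 // ltW.
clear - ht l0 t0 a0 aeJ2 eJ2 eKJ H4 H1 upper lower lowS w1 w2 s1 s2 b1 b2 J1R e0.
move: (J%:R ^+ 2) (27 / a) aeJ2 eJ2 eKJ H4 H1 w1 w2 s1 s2 b1 b2.
move=> J2 z aeJ2 eJ2 eKJ H4 H1 w1 w2 s1 s2 b1 b2.
by apply/andP; split; lra.
Qed.

Local Open Scope classical_set_scope.

(** The gap count is asymptotic to [J ^ 2 * V], and the rectangle has about
    [2 * J ^ 2] points. *)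
Lemma cvg_gap_distribution (V : R) :
  (forall eps, 0 < eps -> exists J0, forall J, (J0 <= J)%N ->
   `|\sum_(row0 a J <= y < J.+1) isolated_density t lambda (y%:R / J%:R) - J%:R * V|
   <= eps * J%:R) ->
  gap_distribution t J lambda @[J --> \oo] --> V / 2.
Proof.
move=> HV; apply/cvgrPdist_le => eps e0.
have e3 : 0 < eps / 3 by rewrite divr_gt0.
have [J1 H1] := gap_count_asymptotics e3.
have [J2 H2] := HV _ e3.
have [J3 J30 H3] := nat_above (2 * `|V| / (eps / 3)).
have [J4 J40 H4] := nat_above (1 / t + 1).
exists (maxn J1 (maxn J2 (maxn J3 J4))) => // J /=.
rewrite !geq_max => /and4P[JJ1 JJ2 JJ3 JJ4].
have {}H1 := H1 J JJ1; have {}H2 := H2 J JJ2.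
have J0 : (0 < J)%N by exact: leq_trans JJ3.
have JR : 0 < J%:R :> R by rewrite ltr0n.
have J1R : 1 <= J%:R :> R by rewrite ler1n.
have cJ : J%:R < t * J%:R ^+ 2.
  have : 1 / t < J%:R by have : J4%:R <= J%:R :> R; [rewrite ler_nat|lra].
  by rewrite ltr_pdivrMr // => h; rewrite expr2 mulrA ltr_pMl // mulrC.
rewrite gap_distributionE //.
set G := (gap_count _ _)%:R in H1 *; set D := \sum_(_ <= _ < _) _ in H1 H2.
have N0 : 0 < (2 * J%:R + 1) * (J%:R + 1) :> R by rewrite mulr_gt0 // addr_gt0 // mulr_gt0.
rewrite (_ : V / 2 - _ = (V / 2 * ((2 * J%:R + 1) * (J%:R + 1)) - G)
    / ((2 * J%:R + 1) * (J%:R + 1))); last by rewrite mulrBl mulfK // gt_eqF.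
rewrite normrM (ger0_norm (_ : 0 <= _^-1)) ?invr_ge0 ?(ltW N0) // ler_pdivrMr //.
have h2 : `|J%:R * (D - J%:R * V)| <= eps / 3 * J%:R ^+ 2.
  rewrite normrM ger0_norm // expr2 mulrA (mulrC (eps / 3)) -mulrA ler_wpM2l //.
have h3 : `|V * ((3 * J%:R + 1) / 2)| <= eps / 3 * J%:R ^+ 2.
  rewrite normrM (ger0_norm (_ : 0 <= _ / 2)) ?divr_ge0 ?addr_ge0 ?mulr_ge0 //.
  apply: (@le_trans _ _ (`|V| * (2 * J%:R))).
    by rewrite ler_wpM2l //; lra.
  have {}H3 : 2 * `|V| <= J%:R * (eps / 3).
    by rewrite -ler_pdivrMr //; apply: le_trans H3 _; rewrite ler_nat.
  have := ler_wpM2r (ltW JR) H3; rewrite expr2; lra.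
have eJ2 : 0 <= eps * J%:R ^+ 2 by rewrite mulr_ge0 ?exprn_ge0 // ltW.
have NJ : J%:R ^+ 2 <= (2 * J%:R + 1) * (J%:R + 1) :> R by rewrite expr2; nra.
have h4 := ler_wpM2l (ltW e0) NJ.
apply: le_trans h4.
rewrite (_ : _ - G = V * ((3 * J%:R + 1) / 2) - J%:R * (D - J%:R * V) - (G - J%:R * D)); last by field.
move: h2 h3 H1; rewrite !ler_norml => /andP[? ?] /andP[? ?] /andP[? ?].
by apply/andP; split; lra.
Qed.

End GapAsymptotics.

(** * Integrating the density *)

Section Integral.
Variables (R : realType) (t lambda : R).
Hypotheses (ht : 2 / 3 < t <= 1) (l0 : 0 < lambda).

Let t23 : 2 / 3 < t. Proof. by case/andP: ht. Qed.
Let t1 : t <= 1. Proof. by case/andP: ht. Qed.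
Let t0 : 0 < t. Proof. by apply: lt_trans t23; rewrite divr_gt0. Qed.
Let a : R := lambda * t / 2.
Let a0 : 0 < a. Proof. by rewrite divr_gt0 // mulr_gt0. Qed.

(** Inclusion-exclusion in closed form, with [w = t / x] and [g = a / x]: rows
    one and two steps away meet the rectangle in zones of length [2 - w] and
    [2 - 2 w]. *)
Lemma isolated_densityE (x : R) :
  isolated_density t lambda x =
  2 - 2 * a * (x^-1 * Num.max 0 (2 - t / x)) - 2 * a * (x^-1 * Num.max 0 (1 - t / x))
  + 4 * (Num.max 0 (2 * a / x - 1) * Num.max 0 (1 - t / x)).
Proof.
rewrite /isolated_density -/a.
have E (z : R) : 2 * a * (x^-1 * z) = 2 * (a / x) * z by ring.
rewrite !E -(mulrA 2 a); move: (t / x) (a / x) => w g.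
have -> : Num.max (-1) (1 - w) = -1 + Num.max 0 (2 - w).
  by rewrite /Num.max; case: ltP => ?; case: ltP => ?; lra.
have -> : Num.min 1 (w - 1) = 1 - Num.max 0 (2 - w).
  by rewrite /Num.max /Num.min; case: ltP => ?; case: ltP => ?; lra.
have -> : Num.max (-1) (1 - 2 * w) = -1 + 2 * Num.max 0 (1 - w).
  by rewrite /Num.max; case: ltP => ?; case: ltP => ?; lra.
have -> : Num.min 1 (2 * w - 1) = 1 - 2 * Num.max 0 (1 - w).
  by rewrite /Num.max /Num.min; case: ltP => ?; case: ltP => ?; lra.
have -> : Num.max (1 - g) g = 1 - g + Num.max 0 (2 * g - 1).
  by rewrite /Num.max; case: ltP => ?; case: ltP => ?; lra.
have -> : Num.max g (1 / 2) = 1 / 2 + Num.max 0 (2 * g - 1) / 2.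
  by rewrite /Num.max; case: ltP => ?; case: ltP => ?; lra.
have -> : Num.min (1 / 2) (1 - g) = 1 / 2 - Num.max 0 (2 * g - 1) / 2.
  by rewrite /Num.max /Num.min; case: ltP => ?; case: ltP => ?; lra.
by field.
Qed.

Let f2 (x : R) := 2 * x^-1 + (- t) * (x ^+ 2)^-1.
Let F2 (x : R) := 2 * ln x + (- t) * (- x^-1).
Let f1 (x : R) := x^-1 + (- t) * (x ^+ 2)^-1.
Let F1 (x : R) := ln x + (- t) * (- x^-1).
Let f4 (x : R) := (2 * a + t) * x^-1 + (- (2 * a * t)) * (x ^+ 2)^-1 + (- 1).
Let F4 (x : R) := (2 * a + t) * ln x + (- (2 * a * t)) * (- x^-1) + (- 1) * x.

Let tame_inv2 : tame a (fun x => (x ^+ 2)^-1).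
Proof.
apply: (@eq_tame _ _ (fun x => x^-1 * x^-1)); last by apply: tameM; exact: tame_inv.
by move=> x; rewrite -expr2 exprVn.
Qed.

Let tZ (c : R) f : tame a f -> tame a (fun x => c * f x).
Proof. by move=> tf; apply: tameM => //; exact: tame_cst. Qed.

Let tf2 : tame a f2. Proof. by apply: tameD; apply: tZ => //; exact: tame_inv. Qed.
Let tf1 : tame a f1. Proof. by apply: tameD; [exact: tame_inv|exact: tZ]. Qed.
Let tf4 : tame a f4.
Proof.
apply: tameD; last exact: tame_cst.
by apply: tameD; [apply: tZ; exact: tame_inv|exact: tZ].
Qed.

Let pF2 : prim a f2 F2.
Proof. by apply: primD; apply: primZ; [exact: prim_inv|exact: prim_inv2]. Qed.
Let pF1 : prim a f1 F1.
Proof. by apply: primD; [exact: prim_inv|apply: primZ; exact: prim_inv2]. Qed.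
Let pF4 : prim a f4 F4.
Proof.
apply: primD; last exact: prim_cst.
by apply: primD; apply: primZ; [exact: prim_inv|exact: prim_inv2].
Qed.

Let clip_itv m1 m2 x : a <= m2 -> m1 <= 1 -> a <= x <= 1 -> a <= clip m1 m2 x <= 1.
Proof.
by move=> am2 m11 /andP[ax x1]; rewrite /clip le_min ge_min le_max ge_max ax am2 x1 m11.
Qed.

Let tame_id : tame a (fun x => x).
Proof.
exists 1; split=> // [x y _ _|x /andP[ax x1]]; first by rewrite mul1r.
by rewrite ger0_norm // (le_trans (ltW a0)).
Qed.

Let tame_clip f m1 m2 : tame a f -> a <= m2 -> m1 <= 1 -> tame a (f \o clip m1 m2).
Proof.
move=> [L [L0 fL fB]] am2 m11.
have [M [M0 cM _]] : tame a (clip m1 m2).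
  by apply: tame_min; [apply: tame_max|]; [exact: tame_id|exact: tame_cst|exact: tame_cst].
exists (L * M + L); split; first by rewrite addr_ge0 ?mulr_ge0.
  move=> x y hx hy; apply: le_trans (fL _ _ (clip_itv am2 m11 hx) (clip_itv am2 m11 hy)) _.
  rewrite mulrDl; apply: ler_wpDr; first by rewrite mulr_ge0.
  by rewrite -mulrA ler_wpM2l //; exact: cM.
move=> x hx; apply: le_trans (fB _ (clip_itv am2 m11 hx)) _.
by rewrite lerDr mulr_ge0.
Qed.

(** The last term of the density is supported between its zeros [t] and
    [2 * a = lambda * t], an interval that is empty for [lambda < 1]. *)
Let T4 (x : R) : R := if lambda < 1 then 0 else f4 (clip t (2 * a) x).
Let P4 (x : R) : R := if lambda < 1 then 0 else F4 (clip t (2 * a) x).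

Let density_clip x : a <= x <= 1 ->
  isolated_density t lambda x =
  2 + (- (2 * a)) * f2 (clip (t / 2) 1 x) + (- (2 * a)) * f1 (clip t 1 x) + 4 * T4 x.
Proof.
move=> /andP[ax x1]; have x0 : 0 < x by exact: lt_le_trans ax.
rewrite isolated_densityE.
have -> : f2 (clip (t / 2) 1 x) = x^-1 * Num.max 0 (2 - t / x).
  rewrite /clip /Num.max; case: (ltP x (t / 2)) => h.
    have t2 : t / 2 <= 1 by move: t1 t0; lra.
    have -> : Num.min (t / 2) 1 = t / 2 by exact: min_l.
    have /negbTE -> : ~~ (0 < 2 - t / x).
      by rewrite -leNgt subr_le0 ler_pdivlMr //; lra.
    by rewrite mulr0 /f2; field; rewrite gt_eqF.
  rewrite min_l // /f2.
  case: ltP => h'; first by field; rewrite gt_eqF.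
  rewrite mulr0 (_ : _ + _ = x^-1 * (2 - t / x)); last by field; rewrite gt_eqF.
  have -> : 2 - t / x = 0; last by rewrite mulr0.
  by apply/eqP; rewrite eq_le h' /= subr_ge0 ler_pdivrMr //; lra.
have -> : f1 (clip t 1 x) = x^-1 * Num.max 0 (1 - t / x).
  rewrite /clip /Num.max; case: (ltP x t) => h.
    have -> : Num.min t 1 = t by exact: min_l.
    have /negbTE -> : ~~ (0 < 1 - t / x).
      by rewrite -leNgt subr_le0 ler_pdivlMr // mul1r ltW.
    by rewrite mulr0 /f1; field; rewrite gt_eqF.
  rewrite min_l // /f1.
  case: ltP => h'; first by field; rewrite gt_eqF.
  rewrite mulr0 (_ : _ + _ = x^-1 * (1 - t / x)); last by field; rewrite gt_eqF.
  have -> : 1 - t / x = 0; last by rewrite mulr0.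
  by apply/eqP; rewrite eq_le h' /= subr_ge0 ler_pdivrMr // mul1r.
have -> : T4 x = Num.max 0 (2 * a / x - 1) * Num.max 0 (1 - t / x).
  have a2 : 2 * a = lambda * t by rewrite /a; field.
  have pos1 (z : R) : (0 < z / x - 1) = (x < z) by rewrite subr_gt0 ltr_pdivlMr // mul1r.
  have pos2 (z : R) : (0 < 1 - z / x) = (z < x) by rewrite subr_gt0 ltr_pdivrMr // mul1r.
  rewrite /T4; case: ltP => l1.
    rewrite {1 2}/Num.max pos1 pos2.
    case: (ltP x (2 * a)) => h1; rewrite ?mul0r //; case: (ltP t x) => h2; rewrite ?mulr0 //.
    have lt : lambda * t < t by rewrite gtr_pMl.
    by move: h1; rewrite a2; lra.
  have ta : t <= 2 * a by rewrite a2 ler_peMl // ltW.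
  rewrite {1 2}/Num.max pos1 pos2 /clip /Num.max.
  case: (ltP x t) => h1.
    have /negbTE -> : ~~ (t < x) by rewrite -leNgt ltW.
    by rewrite min_l // mulr0 /f4; field; rewrite gt_eqF.
  case: (ltP x (2 * a)) => h2; last first.
    by rewrite mul0r /f4; field; rewrite gt_eqF // mulr_gt0.
  case: (ltP t x) => h3; first by rewrite /f4; field; rewrite gt_eqF.
  have -> : x = t by apply/eqP; rewrite eq_le h1 h3.
  by rewrite mulr0 /f4; field; rewrite gt_eqF.
by ring.
Qed.

Let Ftot x := 2 * x + (- (2 * a)) * F2 (clip (t / 2) 1 x)
  + (- (2 * a)) * F1 (clip t 1 x) + 4 * P4 x.

Local Open Scope classical_set_scope.

Let cvg_primitive : a <= 1 ->
  gap_distribution t J lambda @[J --> \oo] --> (Ftot 1 - Ftot a) / 2.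
Proof.
move=> a1; apply: cvg_gap_distribution => // eps e0.
pose f (x : R) := 2 + (- (2 * a)) * (f2 \o clip (t / 2) 1) x
  + (- (2 * a)) * (f1 \o clip t 1) x + 4 * T4 x.
have t2 : t / 2 <= 1 by move: t1 t0; lra.
have tT4 : tame a T4.
  rewrite /T4; case: ltP => l1; first exact: tame_cst.
  apply: (tame_clip tf4) => //.
  by rewrite mulr_natl mulr2n lerDl ltW.
have pT4 : prim a T4 P4.
  rewrite /T4 /P4; case: ltP => l1.
    by apply: (@eq_prim _ a (fun=> 0) _ (fun x => 0 * x)) => // [x|]; [rewrite mul0r|exact: prim_cst].
  have ta : t <= 2 * a by rewrite /a mulrCA divff // mulr1 ler_peMl // ltW.
  apply: prim_clip => //.
  - by rewrite mulr_natl mulr2n lerDl ltW.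
  - by left; rewrite /f4; field; rewrite gt_eqF.
  - by left; rewrite /f4; field; rewrite gt_eqF // mulr_gt0.
have tf : tame a f.
  apply: tameD; last exact: tZ.
  apply: tameD; last by apply: tZ; exact: tame_clip.
  by apply: tameD; [exact: tame_cst|apply: tZ; exact: tame_clip].
have pf : prim a f Ftot.
  apply: primD; last exact: primZ.
  apply: primD; last first.
    apply: primZ; apply: (prim_clip tf1) => //; last by right.
    by left; rewrite /f1; field; rewrite gt_eqF.
  apply: primD; first exact: prim_cst.
  apply: primZ; apply: (prim_clip tf2) => //; last by right.
  by left; rewrite /f2; field; rewrite gt_eqF.
have [J0 HJ0] := row_riemann_sum a0 tf pf a1 e0.
exists (maxn J0 1) => J; rewrite geq_max => /andP[/HJ0 H Jpos].
have JR : 0 < J%:R :> R by rewrite ltr0n.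
move: H; congr (`|_ - _| <= _); apply: eq_big_nat => y /andP[ry yJ].
rewrite density_clip // ler_pdivlMr // ler_pdivrMr // mul1r ler_nat -ltnS yJ andbT.
by apply: ltW; apply: row0P => //; exact: ltW.
Qed.

Lemma cvg_gap_distribution0 : 2 / t <= lambda ->
  gap_distribution t J lambda @[J --> \oo] --> (0 : R).
Proof.
rewrite ler_pdivrMr // => a1.
rewrite -(mul0r 2^-1); apply: cvg_gap_distribution => // eps e0.
exists 0%N => J _; rewrite mulr0 subr0 big_geq ?normr0 ?mulr_ge0 ?(ltW e0) //.
rewrite -/a /row0 ltnS truncn_ge_nat; last by rewrite mulr_ge0 // ltW.
by rewrite ler_peMl // ler_pdivlMr // mul1r.
Qed.

Let F2at x := 2 * ln x + t / x.
Let F1at x := ln x + t / x.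
Let F4at x := (2 * a + t) * ln x + 2 * a * t / x - x.

(** The closed forms differ only in the order of [a], [t / 2], [t], [2 * a]
    and [1]. *)
Let value : a <= 1 -> (Ftot 1 - Ftot a) / 2 =
  1 - a - a * (t - F2at (Num.max a (t / 2))) - a * (t - F1at (Num.max a t))
  + (if lambda < 1 then 0 else 2 * (F4at (Num.min 1 (2 * a)) - F4at (Num.max a t))).
Proof.
move=> a1; rewrite /Ftot /P4 /clip.
have t2 : t / 2 <= 1 by move: t1 t0; lra.
have m1 m : m <= 1 -> Num.min (Num.max 1 m) 1 = 1.
  by move=> h; rewrite (max_l h) min_l.
have m2 m : m <= 1 -> Num.min (Num.max a m) 1 = Num.max a m.
  by move=> h; rewrite min_l // ge_max a1.
rewrite !m1 // !m2 // (max_l t1).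
case: ltP => l1.
  by rewrite /F2 /F1 /F2at /F1at ln1 invr1; field;
    rewrite !gt_eqF // lt_max a0.
have ta : t <= 2 * a by rewrite /a mulrCA divff // mulr1 ler_peMl // ltW.
have -> : Num.min (Num.max a t) (2 * a) = Num.max a t.
  by rewrite min_l // ge_max ta andbT mulr_natl mulr2n lerDl ltW.
have r0 : 0 < Num.min 1 (2 * a) by rewrite lt_min ltr01 mulr_gt0.
rewrite /F2 /F1 /F4 /F2at /F1at /F4at ln1 invr1; field.
by rewrite !gt_eqF // lt_max a0.
Qed.

Let eq_limit (u : nat -> R) (x y : R) : x = y -> u n @[n --> \oo] --> x -> u n @[n --> \oo] --> y.
Proof. by move=> ->. Qed.

Let ln_a : ln a = ln lambda + ln t - ln 2.
Proof. by rewrite /a ln_div ?posrE ?mulr_gt0 // lnM ?posrE. Qed.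

Let aE : a = lambda * t / 2. Proof. by []. Qed.

Lemma cvg_gap_distribution1 : lambda <= 1 ->
  gap_distribution t J lambda @[J --> \oo] -->
    1 + lambda * t - lambda * t ^+ 2 + 3 / 2 * lambda * t * ln t - lambda * t * ln 2.
Proof.
move=> l1; have at2 : a <= t / 2 by rewrite /a ler_pM2r // ger_pMl.
have tt : t / 2 <= t by move: t0; lra.
have a1 : a <= 1 by apply: le_trans at2 (le_trans tt t1).
have := cvg_primitive a1; rewrite value //.
rewrite (max_r at2) (max_r (le_trans at2 tt)) /F2at /F1at ln_div ?posrE //.
have [E|l1'] := eqVneq lambda 1.
  have a2 : 2 * a = t by rewrite aE E; field.
  have -> : (lambda < 1) = false by rewrite E ltxx.
  rewrite a2 (min_r t1) subrr mulr0; apply: eq_limit.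
  by rewrite aE E; field; rewrite gt_eqF.
rewrite lt_neqAle l1' l1 /=; apply: eq_limit.
by rewrite aE; field; rewrite gt_eqF.
Qed.

Lemma cvg_gap_distribution2 : 1 <= lambda -> lambda <= 1 / t ->
  gap_distribution t J lambda @[J --> \oo] -->
    1 + 5 * t - 4 * lambda * t - lambda * t ^+ 2 + t * (2 + 3 * lambda) * ln lambda
    + 3 / 2 * lambda * t * ln t - lambda * t * ln 2.
Proof.
move=> l1; rewrite ler_pdivlMr // => lt1.
have at2 : t / 2 <= a by rewrite /a ler_pM2r // ler_peMl // ltW.
have at1 : a <= t by move: lt1 t23; rewrite aE; lra.
have a1 : a <= 1 by exact: le_trans t1.
have a2 : 2 * a <= 1 by move: lt1; rewrite aE; lra.
have := cvg_primitive a1; rewrite value //.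
rewrite (max_l at2) (max_r at1) (min_r a2) ltNge l1 /= /F2at /F1at /F4at.
have -> : ln (2 * a) = ln lambda + ln t.
  by rewrite -lnM ?posrE //; congr (ln _); rewrite aE; field.
rewrite ln_a; apply: eq_limit.
by rewrite aE; field; rewrite !gt_eqF.
Qed.

Lemma cvg_gap_distribution3 : 1 / t <= lambda -> lambda <= 2 ->
  gap_distribution t J lambda @[J --> \oo] -->
    - 1 + 3 * t - 2 * lambda * t + lambda * t ^+ 2
    + lambda * t * ln (lambda / 2) - t * (2 + 1 / 2 * lambda) * ln t.
Proof.
rewrite ler_pdivrMr // => lt1 l2.
have l1 : 1 <= lambda by apply: le_trans lt1 _; rewrite ger_pMr.
have at2 : t / 2 <= a by rewrite /a ler_pM2r // ler_peMl // ltW.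
have at1 : a <= t by rewrite aE ler_pdivrMr // mulrC ler_pM2l.
have a1 : a <= 1 by exact: le_trans t1.
have a2 : 1 <= 2 * a by move: lt1; rewrite aE; lra.
have := cvg_primitive a1; rewrite value //.
rewrite (max_l at2) (max_r at1) (min_l a2) ltNge l1 /= /F2at /F1at /F4at.
rewrite ln_a ln1 ln_div ?posrE //; apply: eq_limit.
by rewrite aE; field; rewrite !gt_eqF.
Qed.

Lemma cvg_gap_distribution4 : 2 <= lambda -> lambda <= 2 / t ->
  gap_distribution t J lambda @[J --> \oo] -->
    - 1 - 2 * t + 1 / 2 * lambda * t + lambda * t ^+ 2
    - t * (2 + 1 / 2 * lambda) * ln (lambda * t / 2).
Proof.
move=> l2; rewrite ler_pdivlMr // => lt2.
have l1 : 1 <= lambda by apply: le_trans l2; rewrite ler1n.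
have at1 : t <= a by rewrite aE ler_pdivlMr // mulrC ler_pM2r.
have at2 : t / 2 <= a by move: at1 t0; lra.
have a1 : a <= 1 by move: lt2; rewrite aE; lra.
have a2 : 1 <= 2 * a by move: at1 t23; lra.
have := cvg_primitive a1; rewrite value //.
rewrite (max_l at2) (max_l at1) (min_l a2) ltNge l1 /= /F2at /F1at /F4at ln1 -/a.
apply: eq_limit; move: (ln a) => z.
by rewrite aE; field; rewrite !gt_eqF.
Qed.

End Integral.

(** * The limiting gap distribution *)

(** Every gap counts for [lambda = 0]. *)
Lemma cvg_gap_distribution_at0 (R : realType) (t : R) :
  gap_distribution t J 0 @[J --> \oo] --> (1 : R).
Proof.
apply/cvgrPdist_le => eps e0.
have [J0 J00 HJ0] := nat_above eps^-1.
exists J0 => // J /= J0J.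
have JR : eps^-1 <= J%:R by apply: le_trans HJ0 _; rewrite ler_nat.
have Npos : (0 < numpts J)%N by rewrite /numpts size_lattice_points muln_gt0 !addn1.
have sorted_s : sorted <=%R (sorted_angles t J) by apply: sort_sorted; exact: le_total.
have -> : gap_distribution t J 0 = (numpts J).-1%:R / (numpts J)%:R.
  rewrite /gap_distribution; congr (_%:R / _).
  rewrite (@eq_in_count _ _ predT) ?count_predT ?size_iota ?subn1 // => j.
  rewrite mem_index_iota mul0r subr_ge0 => /andP[j1 jN].
  rewrite /alpha /=; apply: (sorted_leq_nth le_trans le_refl) => //; last exact: leq_pred.
    by rewrite inE size_sort size_map (leq_ltn_trans (leq_pred j)).
  by rewrite inE size_sort size_map.
have NR : 0 < (numpts J)%:R :> R by rewrite ltr0n.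
have -> : 1 - (numpts J).-1%:R / (numpts J)%:R = (numpts J)%:R^-1 :> R.
  have -> : (numpts J).-1%:R = (numpts J)%:R - 1 :> R by rewrite -subn1 natrB.
  by field; rewrite gt_eqF.
rewrite ger0_norm ?invr_ge0 ?(ltW NR) // -[leRHS]invrK lef_pV2 ?posrE ?invr_gt0 //.
apply: le_trans JR _; rewrite ler_nat /numpts size_lattice_points; nia.
Qed.

Unset Implicit Arguments.
Set Strict Implicit.

Theorem corollary2p5 (R : realType) (t : R) (ht : 2 / 3 < t <= 1) (lambda : R) :
  [/\ 0 <= lambda <= 1 ->
        gap_distribution t J lambda @[J --> \oo] -->
          1 + lambda * t - lambda * t ^+ 2 + 3 / 2 * lambda * t * ln t
          - lambda * t * ln 2,
      1 <= lambda <= 1 / t ->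
        gap_distribution t J lambda @[J --> \oo] -->
          1 + 5 * t - 4 * lambda * t - lambda * t ^+ 2
          + t * (2 + 3 * lambda) * ln lambda + 3 / 2 * lambda * t * ln t
          - lambda * t * ln 2,
      1 / t <= lambda <= 2 ->
        gap_distribution t J lambda @[J --> \oo] -->
          - 1 + 3 * t - 2 * lambda * t + lambda * t ^+ 2
          + lambda * t * ln (lambda / 2) - t * (2 + 1 / 2 * lambda) * ln t,
      2 <= lambda <= 2 / t ->
        gap_distribution t J lambda @[J --> \oo] -->
          - 1 - 2 * t + 1 / 2 * lambda * t + lambda * t ^+ 2
          - t * (2 + 1 / 2 * lambda) * ln (lambda * t / 2)
    & 2 / t <= lambda ->
        gap_distribution t J lambda @[J --> \oo] --> (0 : R)].
Proof.
have t0 : 0 < t by case/andP: ht => h _; apply: lt_trans h; rewrite divr_gt0.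
split.
- move=> /andP[]; rewrite le_eqVlt => /orP[/eqP <- _|l0 l1].
    rewrite (_ : _ - _ = 1); last by ring.
    exact: cvg_gap_distribution_at0.
  exact: cvg_gap_distribution1.
- move=> /andP[l1 lt]; have l0 : 0 < lambda by exact: lt_le_trans l1.
  exact: cvg_gap_distribution2.
- move=> /andP[lt l2]; have l0 : 0 < lambda by apply: lt_le_trans lt; rewrite divr_gt0.
  exact: cvg_gap_distribution3.
- move=> /andP[l2 lt]; have l0 : 0 < lambda by exact: lt_le_trans l2.
  exact: cvg_gap_distribution4.
- move=> lt; have l0 : 0 < lambda by apply: lt_le_trans lt; rewrite divr_gt0.
  exact: cvg_gap_distribution0.
Qed.
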